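(* Let $b_0,\dots,b_m:\mathbb{R}\times\mathbb{R}^n\to\mathbb{R}^n$ and $u_1,\dots,u_m:\mathbb{R}\times\mathbb{R}\to\mathbb{R}$ satisfy Assumptions A1--A4 listed in the context. For $\omega\in(0,\infty)$ consider the input-affine system $$\dot x=b_0(t,x)+\sum_{i=1}^m b_i(t,x)\sqrt{\omega}\,u_i(t,\omega t)\qquad(\mathrm{IA}_\omega)$$ and its Lie bracket system $$\dot z=b_0(t,z)+\sum_{i=1}^m\sum_{j=i+1}^m[b_i,b_j](t,z)\,\nu_{ji}(t),\qquad \nu_{ji}(t)=\frac1T\int_0^T u_j(t,\theta)\int_0^\theta u_i(t,\tau)\,d\tau\,d\theta.\qquad(\mathrm{LB})$$ Let $\mathcal{B}\subseteq\mathbb{R}^n$ be a set of initial conditions with uniformly bounded solutions of (LB), i.e. there exists $A\in(0,\infty)$ such that for all $t_0\in\mathbb{R}$, $z(t_0)\in\mathcal{B}$ implies that the solution $z$ of (LB) exists on $[t_0,\infty)$ and $|z(t)|<A$ for all $t\in[t_0,\infty)$. Then for every bounded set $\mathcal{K}\subseteq\mathcal{B}$, every $D\in(0,\infty)$ and every $t_f\in(0,\infty)$ there exists an $\omega_0\in(0,\infty)$ such that for every $\omega\in(\omega_0,\infty)$, every $t_0\in\mathbb{R}$ and every $x_0\in\mathcal{K}$ there exist solutions $x$ of $(\mathrm{IA}_\omega)$ and $z$ of (LB) through $x(t_0)=z(t_0)=x_0$ which satisfy $$|x(t)-z(t)|<D,\qquad t\in[t_0,t_0+t_f].$$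
   Context: $|\cdot|$ is the Euclidean norm (with a corresponding norm for matrices). For vector fields $f,g:\mathbb{R}\times\mathbb{R}^n\to\mathbb{R}^n$ that are $C^1$ in $x$, the Lie bracket is $[f,g](t,x):=\frac{\partial g(t,x)}{\partial x}f(t,x)-\frac{\partial f(t,x)}{\partial x}g(t,x)$. Measurable means Lebesgue-measurable. A solution of $\dot x=f(t,x)$ through $x(t_0)=x_0$ is an absolutely continuous function with $x(t)=x_0+\int_{t_0}^t f(\tau,x(\tau))\,d\tau$ on the interval considered (so the ODE holds almost everywhere). Assumptions: A1: $b_i\in C^2(\mathbb{R}\times\mathbb{R}^n;\mathbb{R}^n)$, $i=0,\dots,m$. A2: For every compact set $\mathcal{C}\subseteq\mathbb{R}^n$ there exist $A_1,\dots,A_6\in[0,\infty)$ such that $|b_i(t,x)|\le A_1$, $|\frac{\partial b_i(t,x)}{\partial t}|\le A_2$, $|\frac{\partial b_i(t,x)}{\partial x}|\le A_3$, $|\frac{\partial^2 b_j(t,x)}{\partial t\,\partial x}|\le A_4$, $|\frac{\partial[b_j,b_k](t,x)}{\partial x}|\le A_5$, $|\frac{\partial[b_j,b_k](t,x)}{\partial t}|\le A_6$ for all $x\in\mathcal{C}$, $t\in\mathbb{R}$, $i=0,\dots,m$, $j=1,\dots,m$, $k=j,\dots,m$. A3: $u_i:\mathbb{R}\times\mathbb{R}\to\mathbb{R}$, $i=1,\dots,m$, are measurable, and for every $i$ there exist $L_i,M_i\in(0,\infty)$ with $|u_i(t_1,\theta)-u_i(t_2,\theta)|\le L_i|t_1-t_2|$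 for all $t_1,t_2,\theta\in\mathbb{R}$ and $\sup_{t,\theta\in\mathbb{R}}|u_i(t,\theta)|\le M_i$. A4: There is $T\in(0,\infty)$ such that for all $i=1,\dots,m$ and $t,\theta\in\mathbb{R}$: $u_i(t,\theta+T)=u_i(t,\theta)$ and $\int_0^T u_i(t,\tau)\,d\tau=0$. *)

(* Defs.v *)
From HB Require Import structures.
From mathcomp Require Import all_boot all_order all_algebra.
From mathcomp Require Import all_classical all_reals all_analysis.
From mathcomp Require Import measurable_realfun.
Set Implicit Arguments.
Unset Strict Implicit.
Unset Printing Implicit Defensive.
Import Order.TTheory GRing.Theory Num.Theory.
Import numFieldNormedType.Exports.
Local Open Scope classical_set_scope.
Local Open Scope ring_scope.

(* Vectors are row vectors, so a Jacobian ['J f x] acts on the right: the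
   product (df/dx) v reads [v *m 'J f x].  The library norm on ['M_(m, n)] is
   the sup norm, hence the Euclidean norm and its induced matrix norm below. *)
Definition enorm (R : realType) (n : nat) (v : 'rV[R]_n) : R :=
  Num.sqrt (\sum_i v 0 i ^+ 2).

Definition opnorm (R : realType) (n p : nat) (M : 'M[R]_(n, p)) : R :=
  sup [set enorm (v *m M) | v in [set v : 'rV[R]_n | enorm v <= 1]].

(* [Ck] is the usual notion of class C^k only for finite-dimensional [V]. *)
Fixpoint Ck (R : realType) (k : nat) (V W : normedModType R) (f : V -> W)
    : Prop :=
  if k is k'.+1 then
    (forall p, differentiable f p) /\ (forall v, Ck k' ('D_v f))
  else continuous f.

Definition lie_bracket (R : realType) (n : nat)
    (f g : R -> 'rV[R]_n -> 'rV[R]_n) (t : R) (x : 'rV[R]_n) : 'rV[R]_n :=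
  f t x *m 'J (g t) x - g t x *m 'J (f t) x.

(* The library's measurable structure on [R] is the Borel one: one-dimensional
   integrals are taken against the completed Lebesgue measure, and
   measurability on the plane is relative to the completion of the product
   sigma-algebra. *)
Definition lebint (R : realType) (a b : R) (f : R -> R) : R :=
  \int[@completed_lebesgue_measure R]_(s in `[a, b]) f s.

Definition lebesgue_integrable (R : realType) (a b : R) (f : R -> R) : Prop :=
  (@completed_lebesgue_measure R).-integrable `[a, b] (EFin \o f).

Definition plane_lebesgue_measurable (R : realType) (f : R -> R -> R) : Prop :=
  measurable_fun
    [set: g_sigma_algebraType (completed_algebra_gen
            (@lebesgue_measure R \x @lebesgue_measure R)%E)]
    (fun p : R * R => f p.1 p.2).

Definition absolutely_continuous_on (R : realType) (n : nat) (a b : R)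
    (x : R -> 'rV[R]_n) : Prop :=
  forall e : R, 0 < e -> exists2 d : R, 0 < d &
    forall (k : nat) (l r : 'I_k -> R),
      (forall i, a <= l i <= r i /\ r i <= b) ->
      (forall i j, i != j -> r i <= l j \/ r j <= l i) ->
      \sum_i (r i - l i) < d ->
      \sum_i enorm (x (r i) - x (l i)) < e.

(* Forward solutions only: [J] is an interval with left endpoint [t0].
   The integral is taken componentwise. *)
Definition is_solution (R : realType) (n : nat)
    (f : R -> 'rV[R]_n -> 'rV[R]_n) (t0 : R) (x0 : 'rV[R]_n) (J : interval R)
    (x : R -> 'rV[R]_n) : Prop :=
  x t0 = x0 /\
  forall t, t \in J ->
    absolutely_continuous_on t0 t x /\
    forall i, lebesgue_integrable t0 t (fun s => f s (x s) 0 i) /\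
      x t 0 i = x0 0 i + lebint t0 t (fun s => f s (x s) 0 i).

(* A family b_0, ..., b_m is indexed by ['I_m.+1], and u_1, ..., u_m by ['I_m];
   [ctrl b i] is the field that u_i multiplies. *)
Definition ctrl (R : realType) (n m : nat)
    (b : 'I_m.+1 -> R -> 'rV[R]_n -> 'rV[R]_n) (i : 'I_m) :=
  b (lift ord0 i).

Definition ia_field (R : realType) (n m : nat)
    (b : 'I_m.+1 -> R -> 'rV[R]_n -> 'rV[R]_n) (u : 'I_m -> R -> R -> R)
    (w : R) (t : R) (x : 'rV[R]_n) : 'rV[R]_n :=
  b ord0 t x + \sum_(i < m) (Num.sqrt w * u i t (w * t)) *: ctrl b i t x.

Definition nu (R : realType) (m : nat) (u : 'I_m -> R -> R -> R) (T : R)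
    (j i : 'I_m) (t : R) : R :=
  T^-1 * lebint 0 T (fun th => u j t th * lebint 0 th (u i t)).

Definition lb_field (R : realType) (n m : nat)
    (b : 'I_m.+1 -> R -> 'rV[R]_n -> 'rV[R]_n) (u : 'I_m -> R -> R -> R)
    (T : R) (t : R) (x : 'rV[R]_n) : 'rV[R]_n :=
  b ord0 t x + \sum_(i < m) \sum_(j < m | (i < j)%N)
    nu u T j i t *: lie_bracket (ctrl b i) (ctrl b j) t x.

Definition C2_fields (R : realType) (n m : nat)
    (b : 'I_m.+1 -> R -> 'rV[R]_n -> 'rV[R]_n) : Prop :=
  forall i, Ck 2 (fun p : R * 'rV[R]_n => b i p.1 p.2).

Definition bounded_fields (R : realType) (n m : nat)
    (b : 'I_m.+1 -> R -> 'rV[R]_n -> 'rV[R]_n) : Prop :=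
  forall C : set 'rV[R]_n, compact C ->
  exists A1 A2 A3 A4 A5 A6 : R,
    [/\ 0 <= A1, 0 <= A2 & 0 <= A3] /\ [/\ 0 <= A4, 0 <= A5 & 0 <= A6] /\
    forall (x : 'rV[R]_n) (t : R), C x ->
      [/\ forall i : 'I_m.+1,
            [/\ enorm (b i t x) <= A1,
                enorm (derive1 (fun s => b i s x) t) <= A2 &
                opnorm ('J (b i t) x) <= A3],
          forall j : 'I_m,
            opnorm (derive1 (fun s => 'J (ctrl b j s) x) t) <= A4 &
          forall j k : 'I_m, (j <= k)%N ->
            opnorm ('J (lie_bracket (ctrl b j) (ctrl b k) t) x) <= A5 /\
            enorm (derive1 (fun s => lie_bracket (ctrl b j) (ctrl b k) s x) t)
              <= A6].

Definition regular_inputs (R : realType) (m : nat) (u : 'I_m -> R -> R -> R)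
    : Prop :=
  forall i, plane_lebesgue_measurable (u i) /\
    exists L M : R, [/\ 0 < L, 0 < M,
      forall t1 t2 th, `|u i t1 th - u i t2 th| <= L * `|t1 - t2| &
      forall t th, `|u i t th| <= M].

Definition periodic_zero_mean (R : realType) (m : nat) (u : 'I_m -> R -> R -> R)
    (T : R) : Prop :=
  0 < T /\ forall i t, (forall th, u i t (th + T) = u i t th) /\
    lebint 0 T (u i t) = 0.

Definition uniformly_bounded_solutions (R : realType) (n : nat)
    (f : R -> 'rV[R]_n -> 'rV[R]_n) (B : set 'rV[R]_n) : Prop :=
  exists2 A : R, 0 < A &
    forall (t0 : R) (z0 : 'rV[R]_n), B z0 ->
      exists2 z : R -> 'rV[R]_n, is_solution f t0 z0 `[t0, +oo[ z &
        forall t, t0 <= t -> enorm (z t) < A.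

(* Main.v *)
(* Averaging over one fast period T / w with error O(w^(-3/2)) per period gives
   O(w^(-1/2)) over [t0, t0 + tf] by a discrete Gronwall argument on the grid of
   periods.  A2 does not bound second derivatives of the fields in x uniformly
   in t, so the one-period estimate must not involve them.  Over one period the
   slow time is frozen and the input is cut into P pieces, which turns the
   trajectory into an Euler polygon driven by a closed loop of coefficients;
   scaling the loop by rho in [0, 1] and differentiating in rho expresses the
   displacement through the Lie brackets alone: second derivatives enter only
   in a term O(1/P), which vanishes as P grows.  Solutions of the input-affine
   system come from Picard iteration for the fields clamped to a large box,
   which the averaging estimate shows is never left. *)

Require Import Defs.
From HB Require Import structures.
From mathcomp Require Import all_boot all_order all_algebra.
From mathcomp Require Import all_classical all_reals all_analysis.
From mathcomp Require Import measurable_realfun.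
From mathcomp Require Import ring lra.
Set Implicit Arguments.
Unset Strict Implicit.
Unset Printing Implicit Defensive.
Import Order.TTheory GRing.Theory Num.Theory.
Import numFieldNormedType.Exports.
Local Open Scope classical_set_scope.
Local Open Scope ring_scope.

(** Why brackets appear: with coefficients c and partial sums U, the polygon driven by rho c has, to
    first order, the rho-derivative B = sum of U_i f_i, and B vanishes at the end of a closed loop.
    What remains obeys a linear recurrence whose source is rho times the bracket of B with the next
    increment; frozen at the starting point and integrated over rho, it gives half the sum of areas
    times brackets, and the areas converge to (T / w) nu. Its constant may depend on s, but it is
    divided by P while s is fixed, so the limit in P removes it before any uniformity in s is asked
    for.

    A second obstacle is measurability: the system sees the inputs only along lines th = w t, null
    sets of the plane, and for the completed measure a composition of measurable functions need not
    be measurable. Hence the work on sections, diagonals and affine changes of time. *)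

(** * Lebesgue measurability *)

(* The Caratheodory sigma-algebra, on which the completed measure lives. *)
Definition lebesgue_type (R : realType) : measurableType _ :=
  caratheodory_type (mu_ext (wlength (R := R) idfun)).

Definition lmeas (R : realType) (f : R -> R) : Prop :=
  @measurable_fun _ _ (lebesgue_type R) (measurableTypeR R) setT f.

(** * Affine changes of variable *)

Section outer_scaling.
Context {R : realType}.
Local Open Scope ereal_scope.
Notation mu := (mu_ext (wlength (R := R) idfun)).

(** A positive affine map pulls half-open intervals back to half-open intervals, so a cover goes to
    a cover and its total length is divided by [w]. *)
Let affine_cover (w c : R) (X : set R) (A : nat -> set (ocitv_type R)) :
  (0 < w)%R -> @measurable_cover _ (ocitv_type R) X A ->
  @measurable_cover _ (ocitv_type R) ((fun x => w * x + c)%R @^-1` X)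
    (fun k => (fun x => w * x + c)%R @^-1` A k) /\
  \sum_(k <oo) wlength (R := R) idfun ((fun x => w * x + c)%R @^-1` A k) =
  w^-1%:E * \sum_(k <oo) wlength (R := R) idfun (A k).
Proof.
move=> w0 [mA XA].
have pre (k : nat) : exists a b : R, [/\ (a <= b)%R, A k = `]a, b]%classic &
    (fun x => w * x + c)%R @^-1` A k =
      `]((a - c) / w)%R, ((b - c) / w)%R]%classic].
  have : ocitv (A k) := mA k.
  have eqs (a b : R) : (fun x => w * x + c)%R @^-1` `]a, b]%classic =
      `]((a - c) / w)%R, ((b - c) / w)%R]%classic.
    apply/seteqP; split=> x /=; rewrite !in_itv/= ltr_pdivrMr// ler_pdivlMr//;
    by rewrite [(x * w)%R]mulrC ltrBlDr lerBrDr.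
  move=> /ocitvP[->|[[a b]/= ab ->]].
    exists 0%R, 0%R; split => //; first by rewrite set_itv_ge// bnd_simp ltxx.
    by rewrite preimage_set0 set_itv_ge// bnd_simp ltxx.
  by exists a, b; split; [exact: ltW ab|by []|exact: eqs].
split.
  split=> [i|x /= Xwx]; last first.
    by have [k _ Ak] := XA _ Xwx; exists k.
  by have [a [b [_ _ ->]]] := pre i; exact: is_ocitv.
rewrite -nneseriesZl; last by move=> i _; exact: wlength_ge0.
apply: eq_eseriesr => k _.
have [a [b [ab -> ->]]] := pre k.
rewrite !wlength_itv_bnd//=; last first.
  by rewrite ler_pM2r ?invr_gt0// lerD2r.
rewrite -EFinM; congr EFin; rewrite -mulrBl mulrC; congr (_ * _)%R; ring.
Qed.

Let outer_affine_le (w c : R) (X : set R) : (0 < w)%R ->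
  mu ((fun x => w * x + c)%R @^-1` X) <= w^-1%:E * mu X.
Proof.
move=> w0.
rewrite -[leLHS]mul1e -(@divrr _ w) ?unitfE ?gt_eqF// mulrC EFinM -muleA.
rewrite lee_pmul2l ?lte_fin ?invr_gt0//.
apply: le_ereal_inf_tmp => _ [A cA <-].
have [cA' sA'] := affine_cover c w0 cA.
rewrite -lee_pdivlMl// -sA'.
by apply: ereal_inf_lbound; exists (fun k => (fun x => w * x + c)%R @^-1` A k).
Qed.

(* The inequality [outer_affine_le] applied to the inverse map is the converse. *)
Lemma outer_affine (w c : R) (X : set R) : (0 < w)%R ->
  mu ((fun x => w * x + c)%R @^-1` X) = w^-1%:E * mu X.
Proof.
move=> w0; apply/eqP; rewrite eq_le outer_affine_le//= muleC.
rewrite lee_pdivrMr//.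
have := outer_affine_le (- (c / w)) ((fun x => w * x + c)%R @^-1` X)
  (w := w^-1); rewrite invr_gt0 invrK => /(_ w0).
rewrite muleC; apply: le_trans.
rewrite -comp_preimage (_ : _ \o _ = id)//.
by apply/funext => x /=; rewrite mulrDr mulrN !mulrA divff ?gt_eqF// mul1r;
  rewrite [(w * c)%R]mulrC mulfK ?gt_eqF// subrK.
Qed.

(** The Caratheodory criterion is transported: every test set is the preimage of its image, and all
    outer measures in the criterion are multiplied by the same factor. Continuity alone would not
    do, since preimages of null sets must remain measurable. *)
Lemma measurable_affine (w c : R) : (0 < w)%R ->
  @measurable_fun _ _ (lebesgue_type R) (lebesgue_type R) setT
    (fun x => w * x + c)%R.
Proof.
move=> w0 _ A mA; rewrite setTI; move=> X.
have inv Y : Y = (fun x => w * x + c)%R @^-1`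
    ((fun x => w^-1 * x + - (c / w))%R @^-1` Y).
  rewrite -comp_preimage (_ : _ \o _ = id)//; apply/funext => x /=.
  rewrite mulrDr mulrA mulVf ?gt_eqF// mul1r [(w^-1 * c)%R]mulrC; ring.
rewrite [X in mu X = _]inv.
rewrite [X in _ = mu (X `&` _) + _]inv [X in _ = _ + mu (X `&` _)]inv.
rewrite preimage_setC -!preimage_setI !(outer_affine c _ w0).
rewrite [in LHS](mA ((fun x => w^-1 * x + - (c / w))%R @^-1` X)) muleDr//.
by rewrite ge0_adde_def// inE; exact: mu_ext_ge0.
Qed.

End outer_scaling.

Section lebesgue_measurable.
Context {R : realType}.
Implicit Types f g : R -> R.

Lemma lebesgue_type_measurable (A : set R) :
  @measurable _ (measurableTypeR R) A -> @measurable _ (lebesgue_type R) A.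
Proof. exact: sub_caratheodory. Qed.

Lemma measurable_lmeas f : measurable_fun [set: measurableTypeR R] f -> lmeas f.
Proof.
by move=> mf _ A mA; apply: lebesgue_type_measurable; exact: mf.
Qed.

Lemma continuous_lmeas f : continuous f -> lmeas f.
Proof. by move=> cf; apply/measurable_lmeas; exact: continuous_measurable_fun. Qed.

Lemma lmeas_comp_affine f (w c : R) : 0 < w ->
  lmeas f -> lmeas (fun x => f (w * x + c)).
Proof.
move=> w0 mf; apply: (@measurable_comp _ _ _ (lebesgue_type R) (lebesgue_type R)
  _ setT) => //; exact: measurable_affine.
Qed.

Lemma lmeas_cst (c : R) : lmeas (fun=> c).
Proof. exact: measurable_cst. Qed.

Lemma lmeasD f g : lmeas f -> lmeas g -> lmeas (fun x => f x + g x).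
Proof. exact: measurable_funD. Qed.

Lemma lmeasM f g : lmeas f -> lmeas g -> lmeas (fun x => f x * g x).
Proof. exact: measurable_funM. Qed.

Lemma lmeas_sum (I : Type) (r : seq I) (P : pred I) (F : I -> R -> R) :
  (forall i, lmeas (F i)) -> lmeas (fun x => \sum_(i <- r | P i) F i x).
Proof.
move=> mF.
elim: r => [|i r IH].
  by rewrite (_ : (fun _ => _) = fun=> 0); [exact: lmeas_cst|
    apply/funext => x; rewrite big_nil].
under eq_fun do rewrite big_cons.
by case: (P i) => //; apply: lmeasD.
Qed.

Lemma lmeas_cvg (h : nat -> R -> R) f : (forall k, lmeas (h k)) ->
  (forall x, (h ^~ x) @ \oo --> f x) -> lmeas f.
Proof.
by move=> mh hf; apply: (@measurable_fun_cvg _ (lebesgue_type R) R setT h f) => // x _; exact: hf.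
Qed.

End lebesgue_measurable.

(** * Integrals over an interval *)

Section lebint_theory.
Context {R : realType}.
Implicit Types (f g : R -> R) (a b c M : R).
Notation mu := (@completed_lebesgue_measure R : {measure set (lebesgue_type R) -> \bar R}).

Lemma measurable_itv_lebesgue (i : interval R) :
  @measurable _ (lebesgue_type R) [set` i].
Proof. by apply: lebesgue_type_measurable; exact: measurable_itv. Qed.

Lemma completed_lebesgue_itv a b : a <= b -> mu `[a, b]%classic = (b - a)%:E.
Proof.
move=> ab; transitivity (@lebesgue_measure R `[a, b]) => //.
rewrite lebesgue_measure_itv/= lte_fin.
case: ltP => // ba; have -> : a = b by apply/le_anti; rewrite ab ba.
by rewrite subrr.
Qed.

Lemma lmeas_integrable f a b M : lmeas f ->
  (forall s, a <= s <= b -> `|f s| <= M) -> lebesgue_integrable a b f.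
Proof.
move=> mf fM; have mi := measurable_itv_lebesgue `[a, b].
apply: (measurable_bounded_integrable (mu := mu)) => //.
- have [ab|ba] := leP a b; first by rewrite completed_lebesgue_itv// ltry.
  by rewrite set_itv_ge ?bnd_simp -?ltNge//= measure0.
- exact: measurable_funTS.
- exists M; split => //; first exact: num_real.
  move=> N MN s /=; rewrite in_itv/= => sab.
  by apply: le_trans (ltW MN); exact: fM.
Qed.

Lemma integrable_lebesgueS f a b a' b' : a <= a' -> b' <= b ->
  lebesgue_integrable a b f -> lebesgue_integrable a' b' f.
Proof.
move=> aa bb; apply: integrableS; try exact: measurable_itv_lebesgue.
by apply: subset_itvScc; rewrite bnd_simp.
Qed.

Lemma lebesgue_integrable_cst a b c : lebesgue_integrable a b (fun=> c).
Proof. by apply: (@lmeas_integrable _ _ _ `|c|) => //; exact: lmeas_cst. Qed.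

Lemma lebesgue_integrableD f g a b : lebesgue_integrable a b f ->
  lebesgue_integrable a b g -> lebesgue_integrable a b (fun s => f s + g s).
Proof.
by move=> fi gi; exact: (integrableD (measurable_itv_lebesgue `[a, b]) fi gi).
Qed.

Lemma lebesgue_integrableZ f a b c : lebesgue_integrable a b f ->
  lebesgue_integrable a b (fun s => c * f s).
Proof.
by move=> fi; exact: (integrableZl (measurable_itv_lebesgue `[a, b]) c fi).
Qed.

Lemma lebesgue_integrableB f g a b : lebesgue_integrable a b f ->
  lebesgue_integrable a b g -> lebesgue_integrable a b (fun s => f s - g s).
Proof.
by move=> fi gi; exact: (integrableB (measurable_itv_lebesgue `[a, b]) fi gi).
Qed.

Lemma lebesgue_integrable_sum (I : Type) (r : seq I) (P : pred I)
    (F : I -> R -> R) a b :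
  (forall i, P i -> lebesgue_integrable a b (F i)) ->
  lebesgue_integrable a b (fun s => \sum_(i <- r | P i) F i s).
Proof.
move=> iF; elim: r => [|i r IH].
  by under eq_fun do rewrite big_nil; exact: lebesgue_integrable_cst.
under eq_fun do rewrite big_cons.
case Pi: (P i) => //; apply: lebesgue_integrableD => //; exact: iF.
Qed.

Lemma eq_lebint f g a b : (forall s, a <= s <= b -> f s = g s) ->
  lebint a b f = lebint a b g.
Proof.
move=> fg; apply: eq_Rintegral => s; rewrite inE/= in_itv/=; exact: fg.
Qed.

Lemma lebintD f g a b : lebesgue_integrable a b f ->
  lebesgue_integrable a b g ->
  lebint a b (fun s => f s + g s) = lebint a b f + lebint a b g.
Proof.
by move=> fi gi; apply: RintegralD => //; exact: measurable_itv_lebesgue.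
Qed.

Lemma lebintB f g a b : lebesgue_integrable a b f ->
  lebesgue_integrable a b g ->
  lebint a b (fun s => f s - g s) = lebint a b f - lebint a b g.
Proof.
by move=> fi gi; apply: RintegralB => //; exact: measurable_itv_lebesgue.
Qed.

Lemma lebintZ f a b c : lebesgue_integrable a b f ->
  lebint a b (fun s => c * f s) = c * lebint a b f.
Proof.
by move=> fi; apply: RintegralZl => //; exact: measurable_itv_lebesgue.
Qed.

Lemma lebint_cst a b c : a <= b -> lebint a b (fun=> c) = c * (b - a).
Proof.
move=> ab; rewrite /lebint Rintegral_cst; last exact: measurable_itv_lebesgue.
by rewrite completed_lebesgue_itv.
Qed.

Lemma lebint_sum (I : Type) (r : seq I) (P : pred I) (F : I -> R -> R) a b :
  a <= b -> (forall i, P i -> lebesgue_integrable a b (F i)) ->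
  lebint a b (fun s => \sum_(i <- r | P i) F i s) =
  \sum_(i <- r | P i) lebint a b (F i).
Proof.
move=> ab iF; elim: r => [|i r IH].
  rewrite big_nil -[RHS](mul0r (b - a)) -lebint_cst//.
  by apply: eq_lebint => s _; rewrite big_nil.
rewrite big_cons -IH; have [Pi|Pi] := boolP (P i).
  rewrite -lebintD; [|exact: iF|exact: lebesgue_integrable_sum].
  by apply: eq_lebint => s _; rewrite big_cons Pi.
by apply: eq_lebint => s _; rewrite big_cons (negbTE Pi).
Qed.

Lemma lebint_point f a : lebint a a f = 0.
Proof.
have -> : lebint a a f = lebint a a (fun=> f a).
  by apply: eq_lebint => s sa; congr f; apply/le_anti; rewrite andbC.
by rewrite lebint_cst// subrr mulr0.
Qed.

Lemma lebint_bound f a b M : a <= b -> lebesgue_integrable a b f ->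
  (forall s, a <= s <= b -> `|f s| <= M) -> `|lebint a b f| <= M * (b - a).
Proof.
move=> ab fi fM; have mi := measurable_itv_lebesgue `[a, b].
apply: le_trans (le_normr_Rintegral _ _) _ => //.
rewrite -lebint_cst//; apply: le_Rintegral => //.
- exact: (integrable_norm fi).
- exact: lebesgue_integrable_cst.
Qed.

Lemma lebint_cat f a b c : a <= c -> c <= b -> lebesgue_integrable a b f ->
  lebint a b f = lebint a c f + lebint c b f.
Proof.
move=> ac cb fi.
(* Removing the common endpoint [c] from the right piece makes the union disjoint without changing
   the integral. *)
have oc : lebint c b f = (\int[mu]_(s in `]c, b]) f s)%R.
  have -> : lebint c b f = (\int[mu]_(s in [set c] `|` `]c, b]) f s)%R.
    by rewrite /lebint; congr (Rintegral _ _ _); rewrite setU1itv.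
  have e1 : [set c] = `[c, c]%classic by rewrite set_itv1.
  rewrite e1 Rintegral_setU; [|exact: measurable_itv_lebesgue
    |exact: measurable_itv_lebesgue| |].
  - by have := lebint_point f c; rewrite /lebint => ->; rewrite add0r.
  - by rewrite -e1 setU1itv//; apply: integrable_lebesgueS fi.
  - apply/disj_set2P; rewrite -e1; apply/seteqP; split=> // x [/= ->].
    by rewrite in_itv/= ltxx.
have -> : lebint a b f = (\int[mu]_(s in `[a, c] `|` `]c, b]) f s)%R.
  by rewrite /lebint; congr (Rintegral _ _ _); rewrite -itv_bndbnd_setU.
rewrite Rintegral_setU ?oc//; try exact: measurable_itv_lebesgue.
- by rewrite -itv_bndbnd_setU.
- apply/disj_set2P; apply/seteqP; split=> // x [/=]; rewrite !in_itv/=.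
  by move=> /andP[_ xc] /andP[cx _]; move: (le_lt_trans xc cx); rewrite ltxx.
Qed.

(** The pushforward of the measure under the affine map is [w^-1] times the measure, by
    [outer_affine]. *)
Lemma lebint_affine f a b (w c : R) : 0 < w -> lmeas f ->
  lebesgue_integrable (w * a + c) (w * b + c) f ->
  lebesgue_integrable a b (fun s => f (w * s + c)) ->
  lebint (w * a + c) (w * b + c) f = w * lebint a b (fun s => f (w * s + c)).
Proof.
move=> w0 mf fi fi1.
have mphi := measurable_affine c w0.
have mI := measurable_itv_lebesgue `[w * a + c, w * b + c].
have pre : (fun s : R => w * s + c) @^-1` `[w * a + c, w * b + c] = `[a, b]%classic.
  apply/seteqP; split=> x /=;
  by rewrite !in_itv/= !lerD2r !ler_pM2l.
have mEf : @measurable_fun _ _ (lebesgue_type R) _ setT (EFin \o f).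
  by apply/measurable_EFinP.
have fi' : mu.-integrable ((fun s : R => w * s + c) @^-1`
    `[w * a + c, w * b + c]) ((EFin \o f) \o (fun s => w * s + c)).
  by rewrite pre.
have w'0 : 0 <= w^-1 by rewrite invr_ge0 ltW.
have := integral_pushforward mphi mEf fi' mI.
rewrite [X in X = _ -> _](@eq_measure_integral _ _ _ _ (mscale (NngNum w'0) mu)); last first.
  by move=> A mA _; exact: outer_affine.
(* The scalar is taken out of the positive and negative parts; integrability makes their difference
   well defined. *)
rewrite integralE !ge0_integral_mscale//; first last.
- exact/measurable_funepos/measurable_funTS.
- exact/measurable_funeneg/measurable_funTS.
rewrite -muleBr//; last first.
  rewrite fin_num_adde_defr//.
  by apply: integrable_fin_num => //; exact: integrable_funepos.
rewrite -integralE pre => /(congr1 fine) /=.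
rewrite fineM//; last exact: integrable_fin_num.
move=> e; rewrite /lebint /Rintegral -[in RHS]e /= mulrA divff ?mul1r//.
by rewrite gt_eqF.
Qed.

End lebint_theory.

(** * Sections and diagonals of inputs measurable on the plane *)

Section plane_sections.
Context {R : realType}.
Notation lam := (@lebesgue_measure R).

Let good_sections (S : set (R * R)) : Prop :=
  lam.-negligible [set t | ~ @measurable _ (lebesgue_type R) (xsection S t)].

Let null_measurable (N : set R) :
  lam.-negligible N -> @measurable _ (lebesgue_type R) N.
Proof.
move=> [A [mA A0 NA]]; apply: completed_lebesgue_measure_is_complete.
exists A; split => //; exact: lebesgue_type_measurable.
Qed.

(** Sets almost all of whose sections are measurable form a sigma-algebra, so only the generators
    matter: measurable sets up to a null set. By Tonelli almost every section of a null set is null,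
    hence measurable for the completed measure. *)
Let good_sections_completed (S : set (R * R)) :
  measurable_structure.measurable
    (S : set (g_sigma_algebraType (completed_algebra_gen (lam \x lam)%E))) ->
  good_sections S.
Proof.
move: S; apply: smallest_sub; last first.
  move=> _ [A mA [N [N' [mN' N'0 NN']] <-]].
  have mx := measurable_fun_xsection lam mN'.
  have : (\int[lam]_(x in setT) `|(lam \o xsection N') x|)%E = 0%E.
    rewrite -[RHS]N'0 /product_measure1; apply: eq_integral => x _.
    by rewrite gee0_abs.
  move/(ae_eq_integral_abs lam measurableT mx).1; apply: negligibleS => t /=.
  apply: contra_not => /(_ I) /= N't0.
  rewrite (_ : xsection _ t = xsection A t `|` xsection N t); last first.
    apply/seteqP; split => [x /set_mem[]h|x []/set_mem h].
    - by left; exact/mem_set.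
    - by right; exact/mem_set.
    - by apply/mem_set; left; exact: h.
    - by apply/mem_set; right; exact: h.
  apply: measurableU.
    by apply: lebesgue_type_measurable; exact: measurable_xsection.
  apply: null_measurable; exists (xsection N' t); split => //.
    exact: measurable_xsection.
  exact: le_xsection.
split.
- rewrite /good_sections; apply: negligibleS (negligible_set0 lam) => t /=.
  by rewrite xsection0; apply; exact: measurable0.
- move=> A; apply: negligibleS => t /=; apply: contra_not => mt.
  rewrite setTD (_ : xsection _ _ = ~` xsection A t); first exact: measurableC.
  by apply/seteqP; split => x; rewrite /xsection/= !inE.
- move=> F gF; rewrite /good_sections.
  apply: negligibleS (negligible_bigcup gF) => t /= nF.
  apply: contrapT => nt; apply: nF.
  rewrite xsection_bigcup; apply: bigcupT_measurable => k.
  by apply: contrapT => nk; apply: nt; exists k.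
Qed.

Lemma lmeas_rayP (f : R -> R) :
  (forall c, @measurable _ (lebesgue_type R) [set x | c < f x]) -> lmeas f.
Proof.
move=> mf; apply: (measurability (@RGenOInfty.G R)); first exact: RGenOInfty.measurableE.
move=> _ [_ [c ->] <-]; rewrite setTI.
rewrite (_ : _ @^-1` _ = [set x | c < f x])//.
by apply/seteqP; split => x /=; rewrite in_itv/= andbT.
Qed.

Lemma lmeas_ray (f : R -> R) c : lmeas f ->
  @measurable _ (lebesgue_type R) [set x | c < f x].
Proof.
move=> mf; have := mf measurableT `]c, +oo[%classic (measurable_itv _).
rewrite setTI (_ : _ @^-1` _ = [set x | c < f x])//.
by apply/seteqP; split => x /=; rewrite in_itv/= andbT.
Qed.

(** Level sets at rational heights suffice, since every ray is a union of rational ones; the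
    exceptional times are then a countable union of null sets. *)
Let ae_section (u : R -> R -> R) : plane_lebesgue_measurable u ->
  lam.-negligible [set t | ~ lmeas (u t)].
Proof.
move=> mu_.
have good q : good_sections [set p : R * R | ratr q < u p.1 p.2].
  apply: good_sections_completed.
  have := mu_ measurableT `]ratr q, +oo[%classic (measurable_itv _).
  rewrite setTI (_ : _ @^-1` _ = [set p : R * R | ratr q < u p.1 p.2])//.
  by apply/seteqP; split => x /=; rewrite in_itv/= andbT.
(* [unpickle] enumerates the rationals; an index that encodes none contributes the empty set. *)
pose F k := if unpickle k is Some q
  then [set t | ~ @measurable _ (lebesgue_type R)
    (xsection [set p : R * R | ratr q < u p.1 p.2] t)] else set0.
have gF k : lam.-negligible (F k).
  rewrite /F; case: unpickle => [q|]; [exact: good | exact: negligible_set0].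
apply: negligibleS (negligible_bigcup gF) => t /= nt.
apply: contrapT => nF; apply: nt; apply: lmeas_rayP => c.
rewrite (_ : mkset _ = \bigcup_(q : rat) (if c < ratr q then
  xsection [set p : R * R | ratr q < u p.1 p.2] t else set0)).
  apply: bigcupT_measurable_rat => q; case: ifP => // _.
  apply: contrapT => nq; apply: nF; exists (pickle q); first exact: I.
  by rewrite /F pickleK.
apply/seteqP; split => x /=.
  move=> /rat_in_itvoo[q]; rewrite in_itv/= => /andP[cq qu].
  by exists q => //; rewrite cq /xsection/= inE/=.
move=> [q _]; case: ifP => // cq; rewrite /xsection/= inE/=.
exact: lt_trans.
Qed.

(* Almost every section is measurable, hence those at times tending to t; the
   Lipschitz bound makes them converge uniformly. *)
Lemma lmeas_section (u : R -> R -> R) (L : R) : plane_lebesgue_measurable u ->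
  (forall t1 t2 th, `|u t1 th - u t2 th| <= L * `|t1 - t2|) ->
  forall t, lmeas (u t).
Proof.
move=> mu_ uL t.
have ae := ae_section mu_.
(* An interval of positive length cannot lie inside the null set of bad times. *)
have pick k : exists s, `|s - t| <= k.+1%:R^-1 /\ lmeas (u s).
  apply: contrapT => no; have [N [mN N0 sN]] := ae.
  have : (lam `[t, (t + k.+1%:R^-1)%R]%classic <= lam N)%E.
    apply: le_measure; rewrite ?inE//.
    move=> s /=; rewrite in_itv/= => /andP[ts st]; apply: sN => /= ms.
    by apply: no; exists s; split => //; rewrite ger0_norm ?subr_ge0// lerBlDl.
  rewrite N0 lebesgue_measure_itv/= lte_fin ltrDl invr_gt0 ltr0n/=.
  by rewrite -EFinB lee_fin addrAC subrr add0r leNgt invr_gt0 ltr0n.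
pose s k := projT1 (cid (pick k)).
have [sP1 sP2] : (forall k, `|s k - t| <= k.+1%:R^-1) /\ forall k, lmeas (u (s k)).
  by split => k; have [] := projT2 (cid (pick k)).
apply: (lmeas_cvg sP2) => th; apply/cvgrPdist_le => e e0.
near=> k; apply: le_trans (uL _ _ _) _.
have L0 : 0 <= L.
  by have := le_trans (normr_ge0 _) (uL 1 0 0); rewrite subr0 normr1 mulr1.
have : L * `|s k - t| <= L * k.+1%:R^-1 by rewrite ler_wpM2l.
rewrite distrC; move/le_trans; apply.
rewrite -ler_pdivlMr ?invr_gt0// invrK.
near: k; near=> k.
have := ltW (truncnS_gt (L / e)); rewrite ler_pdivrMr// mulrC.
move/le_trans; apply; rewrite (ler_pM2l e0) ler_nat ltnS.
by near: k; exists (Num.truncn (L / e)).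
Unshelve. all: by end_near. Qed.

(** The line th = w s is a null set of the plane, so measurability on the plane says nothing along
    it; the Lipschitz bound in the slow time recovers it from the sections. *)
Lemma lmeas_diagonal (u : R -> R -> R) (L w : R) : 0 < w ->
  plane_lebesgue_measurable u ->
  (forall t1 t2 th, `|u t1 th - u t2 th| <= L * `|t1 - t2|) ->
  lmeas (fun s => u s (w * s)).
Proof.
move=> w0 mu_ uL.
have L0 : 0 <= L.
  by have := le_trans (normr_ge0 _) (uL 1 0 0); rewrite subr0 normr1 mulr1.
(* [u s (w * s)] is the supremum over rational q of [u q (w * s) - L * `|s - q|]. *)
apply: lmeas_rayP => c.
rewrite (_ : mkset _ = \bigcup_(q : rat)
    [set s | c < u (ratr q) (w * s + 0) + - L * `|s - ratr q|]).
  apply: bigcupT_measurable_rat => q; apply: lmeas_ray; apply: lmeasD.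
    exact: (lmeas_comp_affine 0 w0 (lmeas_section mu_ uL _)).
  apply: lmeasM; first exact: lmeas_cst.
  apply: continuous_lmeas => x; apply: cvg_norm; apply: cvgB => //.
  exact: cvg_cst.
apply/seteqP; split => s /=; last first.
  move=> [q _] /=; rewrite addr0 => /lt_le_trans; apply.
  rewrite mulNr lerBlDr -lerBlDl; apply: le_trans (ler_norm _) _.
  by rewrite distrC; apply: le_trans (uL _ _ _) _; rewrite distrC.
rewrite -subr_gt0 => cu; set d := _ - _ in cu.
(* Passing from s to q costs at most 2 L |s - q|, kept below the available margin [d]; adding 1 to
   [L] covers a zero constant. *)
have e0 : 0 < d / (2 * (L + 1)) by rewrite divr_gt0// mulr_gt0// ltr_wpDl.
have /rat_in_itvoo[q] : s < s + d / (2 * (L + 1)) by rewrite ltrDl.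
rewrite in_itv/= => /andP[sq qs]; exists q => //=; rewrite addr0.
have := uL s (ratr q) (w * s).
have sqd : `|s - ratr q| < d / (2 * (L + 1)).
  by rewrite distrC ger0_norm ?subr_ge0 ?ltW// ltrBlDl.
have : (L + 1) * `|s - ratr q| < d / 2.
  have L10 : 0 < L + 1 by rewrite ltr_wpDl.
  rewrite -ltr_pdivlMl//; apply: lt_le_trans sqd _.
  by rewrite invfM mulrA mulrC.
rewrite /d => h1 /ler_normlP[h2 h3]; have := normr_ge0 (s - ratr q).
lra.
Qed.

End plane_sections.

(** * Euler polygons along a closed loop *)

Ltac vring := apply/rowP => ?; rewrite !mxE; ring.

Ltac nonneg := by repeat first [assumption | apply: ltW; assumption
  | apply: mulr_ge0 | apply: addr_ge0 | apply: exprn_ge0 | apply: divr_ge0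
  | exact: ler0n | exact: normr_ge0 | rewrite invr_ge0].

Section loop.
Context {R : realType}.

(** Linear growth at rate 2 b reproduces itself: with a <= 1/2 and l <= P, one step amplifies the
    bound 2 b l / P by at most b / P, the size of the forcing. *)
Lemma small_gronwall (P : nat) (e : nat -> R) (a b : R) :
  (0 < P)%N -> 0 <= a <= 1 / 2 -> 0 <= b -> e 0%N <= 0 ->
  (forall l, (l < P)%N -> e l.+1 <= e l * (1 + a / P%:R) + b / P%:R) ->
  forall l, (l <= P)%N -> e l <= 2 * b * (l%:R / P%:R).
Proof.
move=> P0 /andP[a0 a2] b0 e0 eS; elim=> [_|l IH lP].
  by rewrite mul0r mulr0.
have PR : 0 < P%:R :> R by rewrite ltr0n.
have {IH} := IH (ltnW lP); have := eS _ lP.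
have l1 : l%:R / P%:R <= 1 :> R by rewrite ler_pdivrMr// mul1r ler_nat ltnW.
have -> : l.+1%:R / P%:R = l%:R / P%:R + P%:R^-1 :> R.
  by rewrite -natr1; ring.
have : 0 < P%:R^-1 :> R by rewrite invr_gt0.
have lP0 : 0 <= l%:R / P%:R :> R by rewrite divr_ge0.
move: l1 lP0; set q := l%:R / _; set p := P%:R^-1 => q1 q0 p0 h1 h2.
have h3 : e l * (a * p) <= 2 * b * q * (a * p).
  by apply: ler_wpM2r => //; nonneg.
have h4 : 2 * b * q * (a * p) <= b * p.
  have -> : 2 * b * q * (a * p) = b * p * (q * (2 * a)) by ring.
  apply: ler_piMr; first nonneg.
  by apply: mulr_ile1 => //; lra.
lra.
Qed.

(* [F l] is the increment of the l-th Euler step and [B l] the sum of the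
   preceding increments at a fixed point, which closes up at [l = P]; [DF] and
   [DB] play the role of the derivatives. *)
Variable n : nat.
Notation V := 'rV[R]_n.
Variables (P : nat) (F B : nat -> V -> V) (DF DB : nat -> V -> V -> V).
Variables (x0 : V) (r a M L E Lg : R).
Hypothesis P0 : (0 < P)%N.
Hypotheses (a0 : 0 <= a) (M0 : 0 <= M) (L0 : 0 <= L) (E0 : 0 <= E).
Hypotheses (Lg0 : 0 <= Lg) (aL : a * L <= 1 / 2) (x0r : `|x0| + a * M <= r).
Hypothesis DFD : forall l y d1 d2, DF l y (d1 + d2) = DF l y d1 + DF l y d2.
Hypothesis DFZ : forall l y c d, DF l y (c *: d) = c *: DF l y d.
Hypothesis DBZ : forall l y c d, DB l y (c *: d) = c *: DB l y d.
Hypothesis B_0 : forall y, B 0 y = 0.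
Hypothesis B_P : forall y, B P y = 0.
Hypothesis BS : forall l y, B l.+1 y = B l y + F l y.
Hypothesis FM : forall l y, (l < P)%N -> `|y| <= r -> `|F l y| <= a * M / P%:R.
Hypothesis BM : forall l y, (l < P)%N -> `|y| <= r -> `|B l y| <= a * M.
Hypothesis FL : forall l y y', (l < P)%N -> `|y| <= r -> `|y'| <= r ->
  `|F l y' - F l y| <= a * L / P%:R * `|y' - y|.
Hypothesis DFL : forall l y d, (l < P)%N -> `|y| <= r ->
  `|DF l y d| <= a * L / P%:R * `|d|.
Hypothesis DBL : forall l y d, (l < P)%N -> `|y| <= r ->
  `|DB l y d| <= a * L * `|d|.
Hypothesis FE : forall l y y', (l < P)%N -> `|y| <= r -> `|y'| <= r ->
  `|F l y' - F l y - DF l y (y' - y)| <= a * E / P%:R * `|y' - y| ^+ 2.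
Hypothesis BE : forall l y y', (l < P)%N -> `|y| <= r -> `|y'| <= r ->
  `|B l y' - B l y - DB l y (y' - y)| <= a * E * `|y' - y| ^+ 2.
(** The Lie bracket of [B l] with [F l]. Its Lipschitz constant is a separate datum in [HL], since
    deriving it from the fields would bring in their second derivatives. *)
Let H l y := DF l y (B l y) - DB l y (F l y).
Hypothesis HL : forall l y y', (l < P)%N -> `|y| <= r -> `|y'| <= r ->
  `|H l y' - H l y| <= a ^+ 2 * Lg / P%:R * `|y' - y|.

Fixpoint euler (rho : R) (l : nat) : V :=
  if l is l'.+1 then euler rho l' + rho *: F l' (euler rho l') else x0.

Let p : R := P%:R^-1.
Let p0 : 0 < p. Proof. by rewrite invr_gt0 ltr0n. Qed.

(** The increments are controlled only inside the ball of radius r, so the distance bound and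
    membership in the ball come from one induction. *)
Lemma euler_near rho l : 0 <= rho <= 1 -> (l <= P)%N ->
  `|euler rho l - x0| <= a * M * (l%:R * p) /\ `|euler rho l| <= r.
Proof.
move=> /andP[rho0 rho1].
have aM0 : 0 <= a * M by exact: mulr_ge0.
have inr y k : (k <= P)%N -> `|y - x0| <= a * M * (k%:R * p) -> `|y| <= r.
  move=> kP yx; rewrite -(subrK x0 y); apply: le_trans (ler_normD _ _) _.
  apply: le_trans x0r; rewrite addrC lerD2l; apply: le_trans yx _.
  by rewrite ler_piMr// ler_pdivrMr ?ltr0n// mul1r ler_nat.
suff h : (l <= P)%N -> `|euler rho l - x0| <= a * M * (l%:R * p).
  by move=> lP; split; [exact: h|apply: inr (h lP)].
elim: l => [_|l IH lP]; first by rewrite subrr normr0 mul0r mulr0.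
have {IH} h := IH (ltnW lP); have yr := inr _ _ (ltnW lP) h.
rewrite /= addrAC; apply: le_trans (ler_normD _ _) _.
have -> : a * M * (l.+1%:R * p) = a * M * (l%:R * p) + a * M * p.
  by rewrite -natr1; ring.
rewrite lerD// normrZ ger0_norm//; apply: le_trans (FM lP yr).
by rewrite ler_piMl.
Qed.

(** Local error of [W_step] in units of [p ^+ 3]: 3 = 2 + 1 from two first-order differences of [F],
    5 = 4 + 1 from the Taylor remainders of [F] and [B]. *)
Let Q := 3 * (a ^+ 2 * L * M) + 5 * (a ^+ 3 * E * M ^+ 2).

Section homotopy_step.
Variable rho : R.
Hypotheses (rho0 : 0 <= rho) (rho1 : rho + p <= 1).
Let y l := euler rho l.
Let y' l := euler (rho + p) l.
Let d l := y' l - y l.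
(* Subtracting [p *: B l (y l)] removes the first-order part of [d l], which
   closes up at the end of the loop. *)
Let W l := d l - p *: B l (y l).

Let rhoI : 0 <= rho <= 1.
Proof. by rewrite rho0/= (le_trans _ rho1)// lerDl ltW. Qed.
Let rhoI' : 0 <= rho + p <= 1.
Proof. by rewrite rho1 andbT addr_ge0// ltW. Qed.
Let yr l : (l <= P)%N -> `|y l| <= r.
Proof. by move=> lP; have [] := euler_near rhoI lP. Qed.
Let y'r l : (l <= P)%N -> `|y' l| <= r.
Proof. by move=> lP; have [] := euler_near rhoI' lP. Qed.

(** Moving rho by p changes every increment directly by p [F]; the feedback through the position is
    absorbed by [small_gronwall]. *)
Let d_bound l : (l <= P)%N -> `|d l| <= 2 * p * (a * M).
Proof.
move=> lP.
apply: (@le_trans _ _ (2 * (p * (a * M)) * (l%:R / P%:R))); last first.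
  rewrite -[leRHS]mulrA; apply: ler_piMr; first nonneg.
  by rewrite ler_pdivrMr ?ltr0n// mul1r ler_nat.
apply: (@small_gronwall P (fun l => `|d l|) (a * L)) => //.
- by rewrite aL mulr_ge0.
- nonneg.
- by rewrite /d /y /y' /= subrr normr0.
move=> {lP}k kP.
have -> : d k.+1 = d k + (p *: F k (y k) +
    (rho + p) *: (F k (y' k) - F k (y k))).
  by rewrite /d /y' /y /= -/(y k) -/(y' k); vring.
apply: le_trans (ler_normD _ _) _; rewrite mulrDr mulr1 -[leRHS]addrA lerD2l.
apply: le_trans (ler_normD _ _) _; rewrite addrC; apply: lerD.
  rewrite normrZ gtr0_norm// -[leRHS]mulrA ler_pM2l//.
  exact: FM (yr (ltnW kP)).
rewrite normrZ ger0_norm; last by case/andP: rhoI'.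
apply: (@le_trans _ _ (`|F k (y' k) - F k (y k)|)); first by rewrite ler_piMl.
rewrite mulrC; apply: FL => //; [exact: yr (ltnW kP)|exact: y'r (ltnW kP)].
Qed.

(** Substitute d = W + p B in the linearised recurrence for [d]: the terms p F cancel against the
    growth of [B], and what drives [W] is rho p (DF B - DB F), that is, the bracket [H]. *)
Let W_step l : (l < P)%N ->
  `|W l.+1 - (W l + rho *: DF l (y l) (W l) + (p * rho) *: H l (y l))| <=
  Q * p ^+ 3.
Proof.
move=> lP; have yl := yr (ltnW lP); have y'l := y'r (ltnW lP).
have yS : y l.+1 = y l + rho *: F l (y l) by [].
have yS1 : y l.+1 - y l = rho *: F l (y l) by rewrite yS addrC addKr.
have dl := d_bound (ltnW lP).
have eW : DF l (y l) (W l) = DF l (y l) (d l) - p *: DF l (y l) (B l (y l)).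
  by rewrite /W -scaleNr DFD DFZ scaleNr.
have eB : DB l (y l) (y l.+1 - y l) = rho *: DB l (y l) (F l (y l)).
  by rewrite yS1 DBZ.
(* An exact identity: the defect consists of two first-order differences of [F], bounded in [t1] and
   [t4], and two Taylor remainders, bounded in [t2] and [t3]. *)
have -> : W l.+1 - (W l + rho *: DF l (y l) (W l) + (p * rho) *: H l (y l)) =
   p *: (F l (y' l) - F l (y l)) +
   rho *: (F l (y' l) - F l (y l) - DF l (y l) (y' l - y l)) -
   p *: (B l (y l.+1) - B l (y l) - DB l (y l) (y l.+1 - y l)) -
   p *: (F l (y l.+1) - F l (y l)).
  rewrite eW eB /W BS /H.
  have -> : d l.+1 = d l + (p *: F l (y l) +
      (rho + p) *: (F l (y' l) - F l (y l))).
    by rewrite /d /y' /y /= -/(y l) -/(y' l); vring.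
  rewrite -/(d l).
  move: (DF l (y l) (d l)) (DF l (y l) (B l (y l))) (DB l (y l) (F l (y l))).
  move: (d l) (B l (y l.+1)) (F l (y l.+1)) (F l (y l)) (F l (y' l)) (B l (y l)).
  by move=> *; vring.
have aM0 : 0 <= a * M by exact: mulr_ge0.
have yy : `|y l.+1 - y l| <= a * M * p.
  rewrite yS1 normrZ ger0_norm//; apply: le_trans (FM lP yl).
  by rewrite ler_piMl//; case/andP: rhoI.
have yl1 := yr lP.
have t1 : `|p *: (F l (y' l) - F l (y l))| <= 2 * (a ^+ 2 * L * M) * p ^+ 3.
  rewrite normrZ gtr0_norm//; have := FL lP yl y'l; rewrite -/(d l) -/p => h.
  have -> : 2 * (a ^+ 2 * L * M) * p ^+ 3 =
    p * (a * L * p * (2 * p * (a * M))) by ring.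
  rewrite ler_pM2l//; apply: le_trans h _.
  by apply: ler_wpM2l => //; rewrite !mulr_ge0// ltW.
have t2 : `|rho *: (F l (y' l) - F l (y l) - DF l (y l) (y' l - y l))| <=
    4 * (a ^+ 3 * E * M ^+ 2) * p ^+ 3.
  rewrite normrZ ger0_norm//; have := FE lP yl y'l; rewrite -/(d l) -/p => h.
  have -> : 4 * (a ^+ 3 * E * M ^+ 2) * p ^+ 3 =
    a * E * p * (2 * p * (a * M)) ^+ 2 by ring.
  apply: (le_trans (ler_piMl _ _)) => //; first by case/andP: rhoI.
  apply: le_trans h _; apply: ler_wpM2l; first nonneg.
  by apply: lerXn2r => //; rewrite nnegrE// (le_trans _ dl).
have t3 : `|p *: (B l (y l.+1) - B l (y l) - DB l (y l) (y l.+1 - y l))| <=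
    (a ^+ 3 * E * M ^+ 2) * p ^+ 3.
  rewrite normrZ gtr0_norm//; have := BE lP yl yl1 => h.
  have -> : (a ^+ 3 * E * M ^+ 2) * p ^+ 3 =
    p * (a * E * (a * M * p) ^+ 2) by ring.
  rewrite ler_pM2l//.
  apply: le_trans h _; apply: ler_wpM2l; first by rewrite !mulr_ge0.
  by apply: lerXn2r => //; rewrite nnegrE// (le_trans _ yy).
have t4 : `|p *: (F l (y l.+1) - F l (y l))| <= (a ^+ 2 * L * M) * p ^+ 3.
  rewrite normrZ gtr0_norm//; have := FL lP yl yl1; rewrite -/p => h.
  have -> : (a ^+ 2 * L * M) * p ^+ 3 = p * (a * L * p * (a * M * p)) by ring.
  rewrite ler_pM2l//; apply: le_trans h _.
  by apply: ler_wpM2l => //; rewrite !mulr_ge0// ltW.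
have -> : Q * p ^+ 3 = 2 * (a ^+ 2 * L * M) * p ^+ 3 +
  4 * (a ^+ 3 * E * M ^+ 2) * p ^+ 3 + (a ^+ 3 * E * M ^+ 2) * p ^+ 3 +
  (a ^+ 2 * L * M) * p ^+ 3 by rewrite /Q; ring.
apply: le_trans (ler_normB _ _) _; rewrite lerD//.
apply: le_trans (ler_normB _ _) _; rewrite lerD//.
by apply: le_trans (ler_normD _ _) _; rewrite lerD.
Qed.

Let H_bound l : (l < P)%N -> `|y l| <= r ->
  `|H l (y l)| <= 2 * (a ^+ 2 * L * M) * p.
Proof.
move=> lP yl; rewrite /H; apply: le_trans (ler_normB _ _) _.
have -> : 2 * (a ^+ 2 * L * M) * p =
  a * L * p * (a * M) + a * L * (a * M * p) by ring.
apply: lerD.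
  apply: le_trans (DFL _ lP yl) _; apply: ler_wpM2l (BM lP yl).
  nonneg.
by apply: le_trans (DBL _ lP yl) _; apply: ler_wpM2l (FM lP yl); rewrite mulr_ge0.
Qed.

Let Q0 : 0 <= Q.
Proof. by rewrite /Q addr_ge0// !mulr_ge0// exprn_ge0. Qed.

(** Up to the local error, [W] starts at zero and is driven by the bracket alone, so it has order
    a^2 where [d] has order a. *)
Let W_bound l : (l <= P)%N ->
  `|W l| <= 4 * p * (a ^+ 2 * L * M) + 2 * (Q * p ^+ 2).
Proof.
move=> lP; set b := p * (2 * (a ^+ 2 * L * M)) + Q * p ^+ 2.
have b0 : 0 <= b.
  by rewrite /b addr_ge0// !mulr_ge0 ?exprn_ge0// ltW.
apply: (@le_trans _ _ (2 * b * (l%:R / P%:R))); last first.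
  rewrite [leRHS](_ : _ = 2 * b); last by rewrite /b; ring.
  by rewrite ler_piMr// ?mulr_ge0// ler_pdivrMr ?ltr0n// mul1r ler_nat.
apply: (@small_gronwall P (fun l => `|W l|) (a * L)) => //.
- by rewrite aL mulr_ge0.
- by rewrite /W /d /y /y' /= B_0 subrr scaler0 subr0 normr0.
move=> k kP; have yk := yr (ltnW kP).
have -> : W k.+1 = W k + (rho *: DF k (y k) (W k) + ((p * rho) *: H k (y k) +
  (W k.+1 - (W k + rho *: DF k (y k) (W k) + (p * rho) *: H k (y k))))).
  move: (W k.+1) (W k) (DF k (y k) (W k)) (H k (y k)) => *; vring.
apply: le_trans (ler_normD _ _) _; rewrite mulrDr mulr1 -[leRHS]addrA lerD2l.
apply: le_trans (ler_normD _ _) _; apply: lerD.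
  rewrite normrZ ger0_norm// mulrC; apply: le_trans (ler_piMr _ _) _ => //.
    by case/andP: rhoI.
  by rewrite mulrC; exact: DFL.
apply: le_trans (ler_normD _ _) _.
have -> : b / P%:R = p * (2 * (a ^+ 2 * L * M) * p) + Q * p ^+ 3.
  by rewrite /b -/p; ring.
apply: lerD; last exact: W_step.
rewrite normrZ ger0_norm; last nonneg.
rewrite -[leLHS]mulrA ler_pM2l//.
apply: le_trans (ler_piMl _ _) _ => //; first by case/andP: rhoI.
exact: H_bound.
Qed.

(** Since [B P] vanishes, [W P] is the whole displacement. Freezing [H] at x0 costs the term with
    [Lg]; discarding the feedback [DF] of [W] costs 4 L^2 M, where 4 comes from [W_bound]. *)
Lemma euler_homotopy_step :
  `|euler (rho + p) P - euler rho P - (p * rho) *: \sum_(l < P) H l x0| <=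
  p * (a ^+ 3 * (4 * L ^+ 2 * M + Lg * M)) + 2 * (Q * p ^+ 2).
Proof.
have -> : euler (rho + p) P - euler rho P = W P.
  by rewrite /W B_P scaler0 subr0.
set c := p * (p * (a ^+ 3 * (4 * L ^+ 2 * M + Lg * M)) + 2 * (Q * p ^+ 2)).
have step l : (l < P)%N ->
    `|W l.+1 - W l - (p * rho) *: H l x0| <= c.
  move=> lP; have yl := yr (ltnW lP).
  have -> : W l.+1 - W l - (p * rho) *: H l x0 =
    (W l.+1 - (W l + rho *: DF l (y l) (W l) + (p * rho) *: H l (y l))) +
    (p * rho) *: (H l (y l) - H l x0) + rho *: DF l (y l) (W l).
    move: (W l.+1) (W l) (DF l (y l) (W l)) (H l (y l)) (H l x0) => *; vring.
  have aM0 : 0 <= a * M by exact: mulr_ge0.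
  have aL0 : 0 <= a * L by exact: mulr_ge0.
  have rho1' : rho <= 1 by case/andP: rhoI.
  have h1 := W_step lP.
  have h2 : `|(p * rho) *: (H l (y l) - H l x0)| <= p * (a ^+ 3 * (Lg * M)) * p.
    rewrite normrZ ger0_norm; last nonneg.
    rewrite -[leLHS]mulrA -[leRHS]mulrA ler_pM2l//.
    apply: le_trans (ler_piMl _ _) _ => //.
    have x0r' : `|x0| <= r by apply: le_trans x0r; rewrite lerDl.
    apply: le_trans (HL lP x0r' yl) _; rewrite -/p.
    have -> : a ^+ 3 * (Lg * M) * p = a ^+ 2 * Lg * p * (a * M) by ring.
    apply: ler_wpM2l; first nonneg.
    have [h _] := euler_near rhoI (ltnW lP); apply: le_trans h _.
    by rewrite ler_piMr// ler_pdivrMr ?ltr0n// mul1r ler_nat ltnW.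
  have h3 : `|rho *: DF l (y l) (W l)| <=
      p * (a ^+ 3 * (4 * L ^+ 2 * M)) * p + Q * p ^+ 3.
    rewrite normrZ ger0_norm//; apply: le_trans (ler_piMl _ _) _ => //.
    apply: le_trans (DFL _ lP yl) _; rewrite -/p.
    apply: le_trans (ler_wpM2l _ (W_bound (ltnW lP))) _.
      by rewrite mulr_ge0// ltW.
    rewrite mulrDr; apply: lerD.
      by rewrite le_eqVlt; apply/orP; left; apply/eqP; ring.
    have -> : a * L * p * (2 * (Q * p ^+ 2)) = Q * p ^+ 3 * (2 * (a * L)) by ring.
    apply: ler_piMr; first by rewrite mulr_ge0// exprn_ge0// ltW.
    by move: aL; rewrite ler_pdivlMr// mulrC.
  have -> : c = Q * p ^+ 3 + p * (a ^+ 3 * (Lg * M)) * p +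
      (p * (a ^+ 3 * (4 * L ^+ 2 * M)) * p + Q * p ^+ 3) by rewrite /c; ring.
  apply: le_trans (ler_normD _ _) _; apply: lerD => //.
  by apply: le_trans (ler_normD _ _) _; apply: lerD.
have sum k : (k <= P)%N ->
    `|W k - (p * rho) *: \sum_(l < k) H l x0| <= k%:R * c.
  elim: k => [_|k IH kP].
    by rewrite big_ord0 /W /d /y /y' /= B_0 subrr scaler0 subr0 scaler0 subr0
      normr0 mul0r.
  rewrite big_ord_recr/= -natr1 mulrDl mul1r.
  have -> : W k.+1 - (p * rho) *: (\sum_(i < k) H i x0 + H k x0) =
    (W k - (p * rho) *: \sum_(i < k) H i x0) +
    (W k.+1 - W k - (p * rho) *: H k x0).
    move: (W k.+1) (W k) (\sum_(i < k) H i x0) (H k x0) => *; vring.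
  apply: le_trans (ler_normD _ _) _; apply: lerD; first exact: IH (ltnW kP).
  exact: step.
apply: le_trans (sum P (leqnn P)) _.
by rewrite /c mulrA divff ?mul1r// pnatr_eq0 -lt0n.
Qed.

End homotopy_step.

(* Summing the steps rho -> rho + 1/P from 0 to 1 approximates the integral of
   rho, whence the factor 1/2. *)
Lemma euler_loop :
  `|euler 1 P - x0 - (1 / 2) *: \sum_(l < P) H l x0| <=
  a ^+ 3 * (4 * L ^+ 2 * M + Lg * M) + (2 * Q + a ^+ 2 * L * M) * p.
Proof.
set S := \sum_(l < P) H l x0.
set c := p * (a ^+ 3 * (4 * L ^+ 2 * M + Lg * M)) + 2 * (Q * p ^+ 2).
have pP : P%:R * p = 1 by rewrite divff// pnatr_eq0 -lt0n.
have e0 k : euler 0 k = x0 by elim: k => //= k ->; rewrite scale0r addr0.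
(* The coefficient of [S] is the left Riemann sum of rho over [0, k p]; at k = P it falls short of
   1/2 by p / 2, which accounts for the term a^2 L M p of the bound. *)
have ind k : (k <= P)%N ->
    `|euler (k%:R * p) P - x0 - (p ^+ 2 * (k%:R * (k%:R - 1) / 2)) *: S| <=
    k%:R * c.
  elim: k => [_|k IH kP].
    by rewrite mul0r e0 subrr !mul0r mulr0 scale0r subr0 normr0.
  have h1 := IH (ltnW kP).
  have /euler_homotopy_step : 0 <= k%:R * p by rewrite mulr_ge0// ltW.
  have -> : k%:R * p + p = k.+1%:R * p by rewrite -natr1; ring.
  have kp : k.+1%:R * p <= 1 by rewrite ler_pdivrMr ?ltr0n// mul1r ler_nat.
  move=> /(_ kp) h2.
  have -> : euler (k.+1%:R * p) P - x0 -
      (p ^+ 2 * (k.+1%:R * (k.+1%:R - 1) / 2)) *: S =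
    (euler (k%:R * p) P - x0 - (p ^+ 2 * (k%:R * (k%:R - 1) / 2)) *: S) +
    (euler (k.+1%:R * p) P - euler (k%:R * p) P - (p * (k%:R * p)) *: S).
    have -> : k.+1%:R = k%:R + 1 :> R by rewrite -natr1.
    by move: (euler _ _) (euler _ _) => *; apply/rowP => ?; rewrite !mxE; field.
  apply: le_trans (ler_normD _ _) _.
  rewrite [leRHS](_ : _ = k%:R * c + c); first exact: lerD.
  by rewrite -natr1; ring.
have := ind P (leqnn P); rewrite pP => h.
have -> : euler 1 P - x0 - (1 / 2) *: S =
    (euler 1 P - x0 - (p ^+ 2 * (P%:R * (P%:R - 1) / 2)) *: S) -
    (p / 2) *: S.
  have -> : p ^+ 2 * (P%:R * (P%:R - 1) / 2) = (1 - p) / 2.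
    rewrite (_ : p ^+ 2 * _ = ((P%:R * p) * (P%:R * p) - (P%:R * p) * p) / 2).
      by rewrite pP; ring.
    by field.
  by move: (euler _ _) => *; apply/rowP => ?; rewrite !mxE; field.
apply: le_trans (ler_normB _ _) _.
have -> : a ^+ 3 * (4 * L ^+ 2 * M + Lg * M) + (2 * Q + a ^+ 2 * L * M) * p =
  P%:R * c + p / 2 * (2 * (a ^+ 2 * L * M)).
  have -> : P%:R * c = (P%:R * p) * (a ^+ 3 * (4 * L ^+ 2 * M + Lg * M)) +
    2 * Q * p * (P%:R * p) by rewrite /c; ring.
  by rewrite pP; field.
apply: lerD => //; rewrite normrZ ger0_norm; last nonneg.
apply: ler_wpM2l; first nonneg.
have x0r' : `|x0| <= r by apply: le_trans x0r; rewrite lerDl mulr_ge0.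
have Hb (l : 'I_P) : `|H l x0| <= 2 * (a ^+ 2 * L * M) * p.
  rewrite /H; apply: le_trans (ler_normB _ _) _.
  have -> : 2 * (a ^+ 2 * L * M) * p =
    a * L * p * (a * M) + a * L * (a * M * p) by ring.
  apply: lerD.
    apply: le_trans (DFL _ (ltn_ord l) x0r') _.
    apply: ler_wpM2l (BM (ltn_ord l) x0r'); nonneg.
  apply: le_trans (DBL _ (ltn_ord l) x0r') _.
  by apply: ler_wpM2l (FM (ltn_ord l) x0r'); rewrite mulr_ge0.
apply: le_trans (ler_norm_sum _ _ _) _.
apply: le_trans (ler_sum _ (fun l _ => Hb l)) _.
rewrite sumr_const card_ord -[_ *+ P]mulr_natr.
rewrite (_ : _ * P%:R = 2 * (a ^+ 2 * L * M) * (P%:R * p)); last by ring.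
by rewrite pP mulr1.
Qed.

End loop.

(** * Loops driven by combinations of vector fields *)

Section field_loop.
Context {R : realType}.

Lemma norm_lincomb (m n : nat) (c : 'I_m -> R) (v : 'I_m -> 'rV[R]_n)
    (k b : R) : 0 <= k -> (forall j, `|c j| <= k) -> (forall j, `|v j| <= b) ->
  `|\sum_j c j *: v j| <= m%:R * k * b.
Proof.
move=> k0 ck vb; apply: le_trans (ler_norm_sum _ _ _) _.
rewrite -mulrA mulr_natl -[m in leRHS]card_ord -sumr_const.
apply: ler_sum => j _; rewrite normrZ.
by apply: ler_pM.
Qed.

Lemma sum_antisym (m n : nat) (c : 'I_m -> 'I_m -> R)
    (G : 'I_m -> 'I_m -> 'rV[R]_n) :
  (forall i j, G j i = - G i j) ->
  \sum_i \sum_j c i j *: G i j =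
  \sum_(i < m) \sum_(j < m | (i < j)%N) (c i j - c j i) *: G i j.
Proof.
move=> Ga.
have G0 i : G i i = 0.
  have := Ga i i => /eqP; rewrite -addr_eq0 -mulr2n -scaler_nat scaler_eq0.
  by rewrite pnatr_eq0/= => /eqP.
have -> : \sum_i \sum_j c i j *: G i j =
    \sum_(i < m) \sum_(j < m | (i < j)%N) c i j *: G i j +
    \sum_(i < m) \sum_(j < m | (j < i)%N) c i j *: G i j.
  rewrite -big_split/=; apply: eq_bigr => i _.
  rewrite (bigID (fun j : 'I_m => (i < j)%N))/=; congr (_ + _).
  rewrite (bigID (fun j : 'I_m => j == i))/= big1 ?add0r.
    apply: eq_bigl => j; rewrite -leqNgt [RHS]ltn_neqAle andbC.
    by congr (_ && _).
  by move=> j /andP[_ /eqP ->]; rewrite G0 scaler0.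
rewrite [X in _ + X](exchange_big_dep xpredT)//= -big_split/=.
apply: eq_bigr => i _; rewrite -big_split/=; apply: eq_bigr => j _.
by rewrite [G j i]Ga scalerN scalerBl.
Qed.

Variables (m n P : nat) (f : 'I_m -> 'rV[R]_n -> 'rV[R]_n).
Variable Df : 'I_m -> 'rV[R]_n -> 'rV[R]_n -> 'rV[R]_n.
Variables (c : 'I_m -> nat -> R) (x0 : 'rV[R]_n) (r k M L E Lg : R).
Hypothesis P0 : (0 < P)%N.
Hypotheses (k0 : 0 <= k) (M0 : 0 <= M) (L0 : 0 <= L) (E0 : 0 <= E).
Hypothesis Lg0 : 0 <= Lg.
Let a := m%:R * k.
Hypotheses (aL : a * L <= 1 / 2) (x0r : `|x0| + a * M <= r).
Hypothesis DfD : forall j y d1 d2, Df j y (d1 + d2) = Df j y d1 + Df j y d2.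
Hypothesis DfZ : forall j y s d, Df j y (s *: d) = s *: Df j y d.
Hypothesis ck : forall j l, (l < P)%N -> `|c j l| <= k / P%:R.
Hypothesis c0 : forall j, \sum_(l < P) c j l = 0.
Hypothesis fM : forall j y, `|y| <= r -> `|f j y| <= M.
Hypothesis fL : forall j y y', `|y| <= r -> `|y'| <= r ->
  `|f j y' - f j y| <= L * `|y' - y|.
Hypothesis DfL : forall j y d, `|y| <= r -> `|Df j y d| <= L * `|d|.
Hypothesis fE : forall j y y', `|y| <= r -> `|y'| <= r ->
  `|f j y' - f j y - Df j y (y' - y)| <= E * `|y' - y| ^+ 2.
Let G i j y := Df j y (f i y) - Df i y (f j y).
Hypothesis GL : forall i j y y', `|y| <= r -> `|y'| <= r ->
  `|G i j y' - G i j y| <= Lg * `|y' - y|.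

Definition lincomb (l : nat) (y : 'rV[R]_n) := \sum_j c j l *: f j y.

(** The discrete primitive of the coefficients; it returns to zero at l = P by [c0]. *)
Let U i l := \sum_(q < l) c i q.
Let B (l : nat) y := \sum_i U i l *: f i y.
Let DF (l : nat) y d := \sum_j c j l *: Df j y d.
Let DB (l : nat) y d := \sum_j U j l *: Df j y d.

Let Uk i l : (l <= P)%N -> `|U i l| <= k.
Proof.
move=> lP; apply: le_trans (ler_norm_sum _ _ _) _.
apply: (@le_trans _ _ (\sum_(q < l) k / P%:R)).
  by apply: ler_sum => q _; apply: ck; apply: leq_trans lP.
rewrite sumr_const card_ord -[_ *+ l]mulr_natr -mulrA ler_piMr//.
by rewrite mulrC ler_pdivrMr ?ltr0n// mul1r ler_nat.
Qed.

Let Df0 j y : Df j y 0 = 0.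
Proof. by have := DfZ j y 0 0; rewrite !scale0r. Qed.

Let Df_sum (I : Type) (s : seq I) j y (v : I -> 'rV[R]_n) :
  Df j y (\sum_(i <- s) v i) = \sum_(i <- s) Df j y (v i).
Proof.
by elim: s => [|i s IH]; rewrite ?big_nil ?Df0// !big_cons DfD IH.
Qed.

(** The coefficients depend on l but not on y, so the bracket of two combinations expands bilinearly
    into pairwise brackets. *)
Let HE l y : DF l y (B l y) - DB l y (lincomb l y) =
  \sum_i \sum_j (c j l * U i l) *: G i j y.
Proof.
rewrite /DF /DB /B /lincomb.
under eq_bigr do (rewrite Df_sum; under eq_bigr do rewrite DfZ).
under eq_bigr do rewrite scaler_sumr.
rewrite exchange_big/=.
under [X in _ - X]eq_bigr do (rewrite Df_sum; under eq_bigr do rewrite DfZ).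
under [X in _ - X]eq_bigr do rewrite scaler_sumr.
rewrite -sumrB; apply: eq_bigr => i _; rewrite -sumrB; apply: eq_bigr => j _.
by rewrite /G scalerBr !scalerA [U i l * _]mulrC.
Qed.

(** Riemann sum of the iterated integral of c_j against the primitive of c_i: for a closed loop, up
    to O(1/P), the signed area enclosed in the (i, j) plane. *)
Definition area i j := \sum_(l < P) c j l * U i l.

(* Summation by parts around a closed loop: [area] is antisymmetric up to O(1/P). *)
Let area_sym i j : `|area i j + area j i| <= k ^+ 2 / P%:R.
Proof.
have tel N : U i N * U j N = \sum_(l < N) (c j l * U i l + c i l * U j l +
    c i l * c j l).
  elim: N => [|N IH]; first by rewrite /U !big_ord0 mul0r.
  rewrite big_ord_recr/= -IH /U !big_ord_recr/=; ring.
have := tel P; rewrite {1}/U c0 mul0r !big_split/= -/(area i j) -/(area j i).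
move/esym/eqP; rewrite addr_eq0 => /eqP ->; rewrite normrN.
apply: le_trans (ler_norm_sum _ _ _) _.
apply: (@le_trans _ _ (\sum_(q < P) (k / P%:R * (k / P%:R)))).
  by apply: ler_sum => q _; rewrite normrM; apply: ler_pM => //; apply: ck.
have PR : P%:R != 0 :> R by rewrite pnatr_eq0 -lt0n.
rewrite sumr_const card_ord -[_ *+ P]mulr_natr.
by rewrite (_ : _ * P%:R = k ^+ 2 / P%:R)//; field.
Qed.

(** The factor 1/2 of [euler_loop] and the antisymmetry of [G] turn the sum over all pairs into half
    of area i j - area j i over i < j, which is area i j up to O(1/P) by [area_sym]. The constant 8
    is 2 * 3 + 1 from [euler_loop] plus 1 from this symmetrisation. *)
Lemma field_loop :
  `|euler lincomb x0 1 P - x0 -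
    \sum_(i < m) \sum_(j < m | (i < j)%N) area i j *: G i j x0| <=
  a ^+ 3 * (4 * L ^+ 2 * M + Lg * M) +
  (8 * (a ^+ 2 * L * M) + 10 * (a ^+ 3 * E * M ^+ 2)) / P%:R.
Proof.
have a0 : 0 <= a by rewrite mulr_ge0.
have p0 : 0 < P%:R^-1 :> R by rewrite invr_gt0 ltr0n.
have kP0 : 0 <= k / P%:R by nonneg.
have akP b : m%:R * (k / P%:R) * b = a * b / P%:R by rewrite /a; ring.
have x0r' : `|x0| <= r by apply: le_trans x0r; rewrite lerDl; nonneg.
have main := @euler_loop R n P lincomb B DF DB x0 r a M L E Lg P0 a0 M0 L0 E0
  Lg0 aL x0r.
have {main} : `|euler lincomb x0 1 P - x0 - (1 / 2) *:
    \sum_(l < P) (DF l x0 (B l x0) - DB l x0 (lincomb l x0))| <=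
    a ^+ 3 * (4 * L ^+ 2 * M + Lg * M) + (2 * (3 * (a ^+ 2 * L * M) +
    5 * (a ^+ 3 * E * M ^+ 2)) + a ^+ 2 * L * M) / P%:R.
  apply: main.
  - by move=> l y d1 d2; rewrite /DF -big_split; apply: eq_bigr => j _;
      rewrite DfD scalerDr.
  - by move=> l y s d; rewrite /DF scaler_sumr; apply: eq_bigr => j _;
      rewrite DfZ !scalerA mulrC.
  - by move=> l y s d; rewrite /DB scaler_sumr; apply: eq_bigr => j _;
      rewrite DfZ !scalerA mulrC.
  - by move=> y; rewrite /B big1// => i _; rewrite /U big_ord0 scale0r.
  - by move=> y; rewrite /B big1// => i _; rewrite /U c0 scale0r.
  - move=> l y; rewrite /B /lincomb -big_split; apply: eq_bigr => i _.
    by rewrite /U big_ord_recr scalerDl.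
  - move=> l y lP yr; rewrite -akP; apply: norm_lincomb => // j; [exact: ck|].
    exact: fM.
  - move=> l y lP yr; apply: norm_lincomb => // j; [exact: Uk (ltnW lP)|].
    exact: fM.
  - move=> l y y' lP yr y'r; rewrite [leRHS](_ : _ = a * (L * `|y' - y|) / P%:R).
      rewrite -akP /lincomb -sumrB.
      under eq_bigr do rewrite -scalerBr.
      apply: norm_lincomb => // j; [exact: ck|exact: fL].
    by ring.
  - move=> l y d lP yr; rewrite [leRHS](_ : _ = a * (L * `|d|) / P%:R).
      rewrite -akP; apply: norm_lincomb => // j; [exact: ck|exact: DfL].
    by ring.
  - move=> l y d lP yr; rewrite -mulrA.
    apply: norm_lincomb => // j; [exact: Uk (ltnW lP)|exact: DfL].
  - move=> l y y' lP yr y'r.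
    rewrite [leRHS](_ : _ = a * (E * `|y' - y| ^+ 2) / P%:R).
      rewrite -akP /lincomb /DF -!sumrB.
      under eq_bigr do rewrite -!scalerBr.
      apply: norm_lincomb => // j; [exact: ck|exact: fE].
    by ring.
  - move=> l y y' lP yr y'r; rewrite -mulrA /B /DB -!sumrB.
    under eq_bigr do rewrite -!scalerBr.
    apply: norm_lincomb => // j; [exact: Uk (ltnW lP)|exact: fE].
  - move=> l y y' lP yr y'r; rewrite !HE -sumrB.
    rewrite [leRHS](_ : _ = m%:R * 1 * (m%:R * (k / P%:R * k) *
      (Lg * `|y' - y|))); last by rewrite /a; ring.
    rewrite (_ : \sum_i _ = \sum_(i < m) 1 *: \sum_(j < m)
      (c j l * U i l) *: (G i j y' - G i j y)); last first.
      apply: eq_bigr => i _; rewrite scale1r -sumrB; apply: eq_bigr => j _.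
      by rewrite [RHS]scalerBr.
    apply: norm_lincomb => // [i|i]; first by rewrite normr1.
    apply: norm_lincomb => [|j|j]; [nonneg| |exact: GL].
    rewrite normrM; apply: ler_pM => //; [exact: ck|exact: Uk (ltnW lP)].
set S := \sum_(l < P) _; set S' := \sum_i _.
have SE : S = \sum_i \sum_j area i j *: G i j x0.
  rewrite /S; under eq_bigr do rewrite HE.
  rewrite exchange_big/=; apply: eq_bigr => i _.
  rewrite exchange_big/=; apply: eq_bigr => j _.
  by rewrite /area scaler_suml.
have Ga i j : G j i x0 = - G i j x0 by rewrite /G opprB.
rewrite (sum_antisym _ Ga) in SE.
have SS : (1 / 2) *: S = S' - (1 / 2) *: \sum_(i < m) \sum_(j < m | (i < j)%N)
    (area i j + area j i) *: G i j x0.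
  rewrite SE /S' !scaler_sumr -sumrB; apply: eq_bigr => i _.
  rewrite !scaler_sumr -sumrB; apply: eq_bigr => j _.
  by rewrite !scalerA -scalerBl; congr (_ *: _); field.
have Sb : `|(1 / 2) *: \sum_(i < m) \sum_(j < m | (i < j)%N)
    (area i j + area j i) *: G i j x0| <= a ^+ 2 * L * M / P%:R.
  rewrite [leRHS](_ : _ = m%:R * (1 / 2) * (m%:R * (k ^+ 2 / P%:R) *
    (2 * (L * M)))); last by rewrite /a; field; rewrite pnatr_eq0 -lt0n.
  rewrite scaler_sumr; apply: norm_lincomb => [|i|i].
  - by rewrite divr_ge0.
  - by rewrite ger0_norm// divr_ge0.
  rewrite big_mkcond/=.
  rewrite (eq_bigr (fun j : 'I_m => (if (i < j)%N then area i j + area j i else 0)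
    *: G i j x0)); last by move=> j _; case: ifP; rewrite ?scale0r.
  apply: norm_lincomb => [|j|j]; first nonneg.
    by case: ifP => _; [exact: area_sym|rewrite normr0; nonneg].
  rewrite /G; apply: le_trans (ler_normB _ _) _.
  rewrite mulr_natl mulr2n; apply: lerD; apply: le_trans (DfL _ _ x0r') _;
    by apply: ler_wpM2l => //; exact: fM.
move=> h.
have -> : euler lincomb x0 1 P - x0 - S' =
  (euler lincomb x0 1 P - x0 - (1 / 2) *: S) - (1 / 2) *: \sum_(i < m)
   \sum_(j < m | (i < j)%N) (area i j + area j i) *: G i j x0.
  have X (u v w : 'rV[R]_n) : u - v = u - (v - w) - w by vring.
  by rewrite SS; exact: X.
apply: le_trans (ler_normB _ _) _.
apply: le_trans (lerD h Sb) _.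
rewrite -addrA lerD2l -mulrDl; apply: ler_wpM2r; first nonneg.
by rewrite le_eqVlt; apply/orP; left; apply/eqP; ring.
Qed.

End field_loop.

(** * Sup norm and Euclidean norm *)

Section rv_norm.
Context {R : realType} {n : nat}.
Implicit Types v : 'rV[R]_n.

Lemma rv_norm_coord v i : `|v 0 i| <= `|v|.
Proof.
rewrite [leRHS]mx_normrE.
exact: (le_bigmax _ (fun ij : 'I_1 * 'I_n => `|v ij.1 ij.2|) (0, i)).
Qed.

Lemma rv_norm_le v (b : R) : 0 <= b -> (forall i, `|v 0 i| <= b) -> `|v| <= b.
Proof.
move=> b0 vb; rewrite [leLHS]mx_normrE; apply/bigmax_leP; split => // -[i j] _.
by rewrite /= [i]ord1.
Qed.

Lemma norm_le_enorm v : `|v| <= enorm v.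
Proof.
apply: rv_norm_le => [|i]; first exact: sqrtr_ge0.
rewrite -sqrtr_sqr /enorm ler_sqrt; last by apply: sumr_ge0 => j _; exact: sqr_ge0.
by rewrite (bigD1 i)//= lerDl; apply: sumr_ge0 => j _; exact: sqr_ge0.
Qed.

Lemma enorm_le_norm v : enorm v <= n%:R * `|v|.
Proof.
have nv0 : 0 <= n%:R * `|v| by nonneg.
rewrite -[leRHS]ger0_norm// -sqrtr_sqr /enorm ler_sqrt ?sqr_ge0//.
apply: (@le_trans _ _ (\sum_(i < n) `|v| ^+ 2)).
  by apply: ler_sum => i _; rewrite -normr_id -[leLHS]real_normK ?num_real// ;
    apply: lerXn2r; rewrite ?nnegrE// normr_id; exact: rv_norm_coord.
rewrite sumr_const card_ord -[_ *+ n]mulr_natl exprMn.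
apply: ler_wpM2r; first exact: sqr_ge0.
by rewrite -natrX ler_nat; case: (n) => // k; rewrite -mulnn leq_pmull.
Qed.

End rv_norm.

(** * Componentwise integrals *)

Section vector_integral.
Context {R : realType} {n : nat}.
Implicit Types F G : R -> 'rV[R]_n.

Definition vint (a b : R) F : 'rV[R]_n := \row_i lebint a b (fun s => F s 0 i).

Definition vintegrable (a b : R) F : Prop :=
  forall i, lebesgue_integrable a b (fun s => F s 0 i).

Definition vlmeas F : Prop := forall i, lmeas (fun s => F s 0 i).

Lemma vlmeas_integrable F (a b M : R) : vlmeas F ->
  (forall s, a <= s <= b -> `|F s| <= M) -> vintegrable a b F.
Proof.
move=> mF FM i; apply: (lmeas_integrable (M := M)) (mF i) _ => s sab.
exact: le_trans (rv_norm_coord _ _) (FM s sab).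
Qed.

Lemma vint_bound F (a b M : R) : a <= b -> 0 <= M -> vintegrable a b F ->
  (forall s, a <= s <= b -> `|F s| <= M) -> `|vint a b F| <= M * (b - a).
Proof.
move=> ab M0 iF FM; apply: rv_norm_le => [|i].
  by rewrite mulr_ge0// subr_ge0.
rewrite mxE; apply: lebint_bound => // s sab.
exact: le_trans (rv_norm_coord _ _) (FM s sab).
Qed.

Lemma vint_cat F (a b c : R) : a <= c -> c <= b -> vintegrable a b F ->
  vint a b F = vint a c F + vint c b F.
Proof. by move=> ac cb iF; apply/rowP => i; rewrite !mxE; exact: lebint_cat. Qed.

Lemma vintB F G (a b : R) : vintegrable a b F -> vintegrable a b G ->
  vint a b (fun s => F s - G s) = vint a b F - vint a b G.
Proof.
move=> iF iG; apply/rowP => i; rewrite !mxE -lebintB//.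
by apply: eq_lebint => s _; rewrite !mxE.
Qed.

Lemma vintegrableB F G (a b : R) : vintegrable a b F -> vintegrable a b G ->
  vintegrable a b (fun s => F s - G s).
Proof.
move=> iF iG i; under eq_fun do rewrite !mxE.
exact: lebesgue_integrableB.
Qed.

Lemma vint_cst (a b : R) (v : 'rV[R]_n) : a <= b ->
  vint a b (fun=> v) = (b - a) *: v.
Proof. by move=> ab; apply/rowP => i; rewrite !mxE lebint_cst// mulrC. Qed.

Lemma vint_scale (f : R -> R) (v : 'rV[R]_n) (a b : R) :
  lebesgue_integrable a b f ->
  vint a b (fun s => f s *: v) = lebint a b f *: v.
Proof.
move=> fi; apply/rowP => i; rewrite !mxE [RHS]mulrC -lebintZ//.
by apply: eq_lebint => s _; rewrite !mxE mulrC.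
Qed.

Lemma vint_sum (I : Type) (r : seq I) (P : pred I) (H : I -> R -> 'rV[R]_n)
    (a b : R) : a <= b -> (forall i, vintegrable a b (H i)) ->
  vint a b (fun s => \sum_(i <- r | P i) H i s) =
  \sum_(i <- r | P i) vint a b (H i).
Proof.
move=> ab iH; apply/rowP => k; rewrite summxE mxE.
under [RHS]eq_bigr do rewrite mxE.
rewrite -lebint_sum//; last by move=> i _; exact: iH.
by apply: eq_lebint => s _; rewrite summxE.
Qed.

(** The default value for reversed endpoints: a curve defined by integration from t0 is constant to
    the left of t0, hence defined on the whole line. *)
Lemma vint_empty F (a b : R) : b <= a -> vint a b F = 0.
Proof.
rewrite le_eqVlt => /predU1P[->|ba]; apply/rowP => i; rewrite !mxE.
  exact: lebint_point.
by rewrite /lebint set_itv_ge ?Rintegral_set0// bnd_simp -ltNge.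
Qed.

End vector_integral.

(** * Limits at a geometric rate *)

Section geometric_limit.
Context {R : realType}.

(** The intervals of radius 2 c / 2^k around [v k] meet pairwise, so the supremum of their left
    endpoints lies in all of them; this gives the limit and the rate at once. *)
Lemma geometric_cvg (v : nat -> R) (c : R) :
  (forall k, `|v k.+1 - v k| <= c / 2 ^+ k) ->
  exists l, forall k, `|v k - l| <= 2 * c / 2 ^+ k.
Proof.
move=> vc.
have c0 : 0 <= c by have := vc 0%N; rewrite expr0 divr1; apply: le_trans.
have e0 k : 0 <= 2 * c / 2 ^+ k by rewrite divr_ge0 ?mulr_ge0.
have half k : 2 * c / 2 ^+ k = 2 * c / 2 ^+ k.+1 + c / 2 ^+ k.
  by rewrite exprS; field; rewrite expf_neq0.
have mono k j : `|v (k + j)%N - v k| <= 2 * c / 2 ^+ k - 2 * c / 2 ^+ (k + j).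
  elim: j => [|j IH]; first by rewrite addn0 !subrr normr0.
  rewrite addnS -[v _.+1](subrK (v (k + j)%N)) -addrA.
  apply: le_trans (ler_normD _ _) _; have := vc (k + j)%N.
  have := half (k + j)%N; lra.
have close k j : v k - 2 * c / 2 ^+ k <= v j + 2 * c / 2 ^+ j.
  have [kj|jk] := leqP k j.
    by have := mono k (j - k)%N; rewrite subnKC// => /ler_normlP[];
      have := e0 j; lra.
  by have := mono j (k - j)%N; rewrite subnKC 1?ltnW// => /ler_normlP[];
    have := e0 k; lra.
pose S := [set v k - 2 * c / 2 ^+ k | k in [set: nat]].
have S0 : S !=set0 by exists (v 0%N - 2 * c / 2 ^+ 0); exists 0%N.
exists (sup S) => k; apply/ler_normlP; split.
  have : sup S <= v k + 2 * c / 2 ^+ k.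
    by apply: ge_sup => // _ [j _ <-]; exact: close.
  lra.
have : v k - 2 * c / 2 ^+ k <= sup S.
  apply: ub_le_sup; last by exists k.
  by exists (v 0%N + 2 * c / 2 ^+ 0) => _ [j _ <-]; exact: close.
lra.
Qed.

Lemma geometric_cvg_row n (v : nat -> 'rV[R]_n) (c : R) :
  (forall k, `|v k.+1 - v k| <= c / 2 ^+ k) ->
  exists l, forall k, `|v k - l| <= 2 * c / 2 ^+ k.
Proof.
move=> vc.
have c0 : 0 <= c by have := vc 0%N; rewrite expr0 divr1; apply: le_trans.
have h i : exists l : R, forall k, `|v k 0 i - l| <= 2 * c / 2 ^+ k.
  apply: geometric_cvg => k; apply: le_trans (vc k).
  by have := rv_norm_coord (v k.+1 - v k) i; rewrite !mxE.
exists (\row_i projT1 (cid (h i))) => k; apply: rv_norm_le => [|i].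
  by rewrite divr_ge0 ?mulr_ge0.
by rewrite !mxE; exact: projT2 (cid (h i)) k.
Qed.

Lemma geometric_eq0 (x c : R) : (forall k, x <= c / 2 ^+ k) -> x <= 0.
Proof.
move=> xc; rewrite leNgt; apply/negP => x0.
have := xc (Num.truncn (c / x)).+1; rewrite ler_pdivlMr ?exprn_gt0//.
apply/negP; rewrite -ltNge mulrC -ltr_pdivrMr//.
apply: lt_trans (truncnS_gt _) _.
by rewrite -natrX ltr_nat ltn_expl.
Qed.

End geometric_limit.

(** * Picard iteration *)

Lemma lipschitz_continuous_rv (R : realType) (n : nat) (X : R -> 'rV[R]_n) (C : R) :
  (forall s t, s <= t -> `|X t - X s| <= C * (t - s)) -> continuous X.
Proof.
move=> XL.
have XL' s t : `|X t - X s| <= C * `|t - s|.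
  have [st|/ltW ts] := leP s t; first by rewrite ger0_norm ?subr_ge0// XL.
  by rewrite distrC [X in _ * X]distrC ger0_norm ?subr_ge0// XL.
have C0 : 0 <= C by have := XL 0 1 ler01; rewrite subr0 mulr1; apply: le_trans.
have C1 : 0 < C + 1 by rewrite ltr_wpDl.
move=> t; apply/cvgrPdist_le => e e0; near=> s.
apply: le_trans (XL' _ _) _.
apply: (@le_trans _ _ ((C + 1) * `|t - s|)).
  by apply: ler_wpM2r => //; rewrite lerDl.
rewrite -ler_pdivlMl//; near: s.
exists ((C + 1)^-1 * e) => /=; first by rewrite mulr_gt0// invr_gt0.
by move=> s /= /ltW.
Unshelve. all: by end_near. Qed.

Section picard.
Context {R : realType} {n : nat}.
Variables (F : R -> 'rV[R]_n -> 'rV[R]_n) (M L : R).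
Hypothesis F_meas : forall X : R -> 'rV[R]_n, continuous X ->
  vlmeas (fun s => F s (X s)).
Hypothesis F_bound : forall s x, `|F s x| <= M.
Hypothesis F_lip : forall s x y, `|F s x - F s y| <= L * `|x - y|.
Hypothesis L0 : 0 <= L.
Variables (t0 : R) (x0 : 'rV[R]_n).

Let M0 : 0 <= M. Proof. exact: le_trans (F_bound 0 0). Qed.

Let step (X : R -> 'rV[R]_n) (t : R) : 'rV[R]_n :=
  x0 + vint t0 t (fun s => F s (X s)).

Let integ (X : R -> 'rV[R]_n) a b : continuous X ->
  vintegrable a b (fun s => F s (X s)).
Proof. by move=> cX; apply: (vlmeas_integrable (M := M)) => //; exact: F_meas. Qed.

Let step_lip (X : R -> 'rV[R]_n) s t : continuous X -> s <= t ->
  `|step X t - step X s| <= M * (t - s).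
Proof.
move=> cX st; rewrite /step opprD addrACA subrr add0r.
have [ts|st0] := leP t t0.
  by rewrite !vint_empty ?(le_trans st)// subrr normr0 mulr_ge0// subr_ge0.
have [s0|/ltW s0] := leP s t0.
  rewrite [in X in _ - X]vint_empty// subr0.
  apply: le_trans (vint_bound (ltW st0) M0 _ _) _ => //.
    exact: integ.
  by apply: ler_wpM2l => //; rewrite lerD2l lerN2.
rewrite (vint_cat s0 st); last exact: integ.
rewrite addrC addKr; apply: vint_bound => //; exact: integ.
Qed.

Fixpoint picard_iter (k : nat) : R -> 'rV[R]_n :=
  if k is k'.+1 then step (picard_iter k') else fun=> x0.

Let iter_cont k : continuous (picard_iter k).
Proof.
elim: k => [|k IH]; first by move=> t; exact: cvg_cst.
apply: (@lipschitz_continuous_rv _ _ _ M) => s t st; exact: step_lip.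
Qed.

(* A weighted contraction: with weight 4^j on the j-th window of length tau, one
   iteration halves the error on all windows at once. *)
Let picard_step (X Y : R -> 'rV[R]_n) (C tau : R) : continuous X -> continuous Y ->
  0 < tau -> L * tau <= 1 / 4 -> 0 <= C ->
  (forall j t, t <= t0 + j%:R * tau -> `|X t - Y t| <= C * 4 ^+ j) ->
  (forall j t, t <= t0 + j%:R * tau -> `|step X t - step Y t| <= C / 2 * 4 ^+ j).
Proof.
move=> cX cY tau0 Ltau C0 XY.
have e t : step X t - step Y t =
    vint t0 t (fun s => F s (X s) - F s (Y s)).
  by rewrite /step opprD addrACA subrr add0r vintB//; exact: integ.
have iXY a b : vintegrable a b (fun s => F s (X s) - F s (Y s)).
  by apply: vintegrableB; exact: integ.
elim=> [|j IH] t.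
  rewrite mul0r addr0 => tt0; rewrite e vint_empty// normr0 mulr1 divr_ge0//.
have [tj _|jt tj1] := leP t (t0 + j%:R * tau).
  apply: le_trans (IH _ tj) _; apply: ler_wpM2l; first by rewrite divr_ge0.
  by rewrite exprS ler_peMl// ?exprn_ge0//; lra.
have t0j : t0 <= t0 + j%:R * tau by rewrite lerDl mulr_ge0// ltW.
(* Split at the start of the last window: the earlier windows give at most C / 2 * 4^j and the last
   one at most C * 4^j, together below C / 2 * 4^(j+1). *)
rewrite e (vint_cat t0j (ltW jt))// -e; apply: le_trans (ler_normD _ _) _.
have h1 := IH _ (lexx (t0 + j%:R * tau)).
have h2 : `|vint (t0 + j%:R * tau) t (fun s => F s (X s) - F s (Y s))| <=
    L * (C * 4 ^+ j.+1) * (t - (t0 + j%:R * tau)).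
  apply: vint_bound => //; [exact: ltW|nonneg|].
  move=> s /andP[_ st]; apply: le_trans (F_lip _ _ _) _.
  by apply: ler_wpM2l => //; apply: XY; exact: le_trans tj1.
apply: le_trans (lerD h1 h2) _.
have h3 : t - (t0 + j%:R * tau) <= tau.
  by move: tj1; rewrite -natr1; lra.
have h4 : L * (C * 4 ^+ j.+1) * (t - (t0 + j%:R * tau)) <=
    L * (C * 4 ^+ j.+1) * tau.
  by apply: ler_wpM2l => //; nonneg.
have h5 : L * tau * (C * 4 ^+ j.+1) <= 1 / 4 * (C * 4 ^+ j.+1).
  by apply: ler_wpM2r => //; nonneg.
have h6 : 0 <= C * 4 ^+ j by nonneg.
move: h5 h4; rewrite !exprS; lra.
Qed.

Let tau := (4 * (L + 1))^-1.

Let tau0 : 0 < tau.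
Proof. by rewrite invr_gt0 mulr_gt0// ltr_wpDl. Qed.

Let Ltau : L * tau <= 1 / 4.
Proof.
rewrite /tau ler_pdivrMr ?mulr_gt0 ?ltr_wpDl//.
rewrite (_ : 1 / 4 * _ = L + 1); last by field.
by rewrite lerDl.
Qed.

Let iter_bound k : forall j t, t <= t0 + j%:R * tau ->
  `|picard_iter k.+1 t - picard_iter k t| <= M * tau / 2 ^+ k * 4 ^+ j.
Proof.
have Mt : 0 <= M * tau by rewrite mulr_ge0// ltW.
elim: k => [|k IH] j t tj.
  rewrite expr0 divr1 /= /step addrAC subrr add0r.
  have [tt0|/ltW t0t] := leP t t0.
    by rewrite vint_empty// normr0; nonneg.
  apply: le_trans (vint_bound t0t M0 _ _) _ => //.
    by apply: (vlmeas_integrable (M := M)) => //; apply: F_meas => s; exact: cvg_cst.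
  rewrite -mulrA; apply: ler_wpM2l => //.
  (* The first iterate moves at most linearly in time, and j <= 4^j lets the weight absorb the j
     windows. *)
  apply: (@le_trans _ _ (tau * j%:R)); first by move: tj; lra.
  apply: ler_wpM2l; first exact: ltW.
  by rewrite -natrX ler_nat ltnW// ltn_expl.
have C0 : 0 <= M * tau / 2 ^+ k by rewrite divr_ge0.
have := picard_step (@iter_cont k.+1) (@iter_cont k) tau0 Ltau C0 IH tj.
rewrite (_ : _ / 2 * _ = M * tau / 2 ^+ k.+1 * 4 ^+ j)//.
by rewrite [in RHS]exprS invfM [2^-1 * _]mulrC mulrA.
Qed.

(** The limit inherits the Lipschitz bound of the iterates, hence is continuous; the measurability
    hypothesis then applies to it and the integral equation passes to the limit. *)
Lemma picard_exists : exists X : R -> 'rV[R]_n, [/\ X t0 = x0,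
  (forall s t, s <= t -> `|X t - X s| <= M * (t - s)) &
  forall s t, t0 <= s -> s <= t ->
    vintegrable s t (fun q => F q (X q)) /\
    X t - X s = vint s t (fun q => F q (X q))].
Proof.
(* The end of window [(bnd t).+1] lies beyond t; for t before t0 the truncation is 0, which remains
   valid. *)
pose bnd t := Num.truncn ((t - t0) / tau).
have tb t : t <= t0 + (bnd t).+1%:R * tau.
  rewrite -lerBlDl -ler_pdivrMr//; exact/ltW/truncnS_gt.
have lim t : exists l, forall k,
    `|picard_iter k t - l| <= 2 * (M * tau * 4 ^+ (bnd t).+1) / 2 ^+ k.
  apply: geometric_cvg_row => k; apply: le_trans (iter_bound k (tb t)) _.
  by rewrite mulrAC.
pose X t := projT1 (cid (lim t)).
have XP t k : `|picard_iter k t - X t| <=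
    2 * (M * tau * 4 ^+ (bnd t).+1) / 2 ^+ k by exact: projT2 (cid (lim t)) k.
have X_lip s t : s <= t -> `|X t - X s| <= M * (t - s).
  move=> st; rewrite -subr_le0.
  apply: (@geometric_eq0 _ _ (2 * (M * tau * 4 ^+ (bnd t).+1) +
    2 * (M * tau * 4 ^+ (bnd s).+1))) => k.
  have h : `|picard_iter k t - picard_iter k s| <= M * (t - s).
    case: k => [|k] /=; last exact: step_lip.
    by rewrite subrr normr0 mulr_ge0// subr_ge0.
  have -> : X t - X s = (picard_iter k t - picard_iter k s) -
    (picard_iter k t - X t) + (picard_iter k s - X s).
    by move: (picard_iter k t) (picard_iter k s) (X t) (X s) => *; vring.
  rewrite mulrDl lerBlDr.
  apply: le_trans (ler_normD _ _) _; apply: le_trans (lerD (ler_normB _ _) (XP _ _)) _.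
  have := XP t k; lra.
have cX := lipschitz_continuous_rv X_lip.
(* The rate in [XP] varies with q through [bnd q]. Telescoping with the weight of t and sending j to
   infinity makes it uniform for q <= t, as the integral requires. *)
have unif t k : forall q, q <= t -> `|picard_iter k q - X q| <=
    2 * (M * tau * 4 ^+ (bnd t).+1) / 2 ^+ k.
  move=> q qt; rewrite -subr_le0.
  apply: (@geometric_eq0 _ _ (2 * (M * tau * 4 ^+ (bnd q).+1))) => j.
  have tel i : `|picard_iter k q - picard_iter (k + i)%N q| <=
      2 * (M * tau * 4 ^+ (bnd t).+1) / 2 ^+ k -
      2 * (M * tau * 4 ^+ (bnd t).+1) / 2 ^+ (k + i).
    elim: i => [|i IH]; first by rewrite addn0 !subrr normr0.
    rewrite addnS; have := iter_bound (k + i) (le_trans qt (tb t)).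
    rewrite distrC; set A := picard_iter k q; set B := picard_iter _ q.
    set C := picard_iter _ q => h.
    have -> : A - C = (A - B) + (B - C) by rewrite addrA subrK.
    apply: le_trans (ler_normD _ _) _; apply: le_trans (lerD IH h) _.
    rewrite [2 ^+ (k + i).+1]exprS invfM.
    move: (2 ^+ (k + i))^-1 (2 ^+ k)^-1 (4 ^+ _) => a b d.
    by rewrite le_eqVlt; apply/orP; left; apply/eqP; field.
  have h1 := tel j; have h2 := XP q (k + j)%N.
  have -> : picard_iter k q - X q = (picard_iter k q - picard_iter (k + j)%N q) +
    (picard_iter (k + j)%N q - X q) by rewrite addrA subrK.
  rewrite lerBlDr; apply: le_trans (ler_normD _ _) _.
  have h3 : 2 * (M * tau * 4 ^+ (bnd q).+1) / 2 ^+ (k + j) <=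
      2 * (M * tau * 4 ^+ (bnd q).+1) / 2 ^+ j.
    apply: ler_wpM2l; first by rewrite !mulr_ge0 ?exprn_ge0// ltW.
    by rewrite lef_pV2 ?posrE ?exprn_gt0// ler_weXn2l// ?leq_addl// ler1n.
  have h4 : 0 <= 2 * (M * tau * 4 ^+ (bnd t).+1) / 2 ^+ (k + j).
    by rewrite divr_ge0 ?exprn_ge0// !mulr_ge0 ?exprn_ge0// ltW.
  lra.
have Xeq t : t0 <= t -> X t = x0 + vint t0 t (fun q => F q (X q)).
  move=> t0t; apply/eqP; rewrite -subr_eq0 -normr_le0.
  set c := 2 * (M * tau * 4 ^+ (bnd t).+1).
  apply: (@geometric_eq0 _ _ (c + L * c * (t - t0))) => k.
  have -> : X t - (x0 + vint t0 t (fun q => F q (X q))) =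
      - (picard_iter k.+1 t - X t) +
      vint t0 t (fun q => F q (picard_iter k q) - F q (X q)).
    rewrite vintB; [|exact: integ..].
    rewrite /= /step; move: (vint _ _ _) (vint _ _ _) (X t) => *; vring.
  apply: le_trans (ler_normD _ _) _; rewrite normrN mulrDl.
  have c0 : 0 <= c by rewrite !mulr_ge0 ?exprn_ge0// ltW.
  apply: lerD.
    apply: le_trans (XP t k.+1) _; rewrite -/c; apply: ler_wpM2l => //.
    by rewrite lef_pV2 ?posrE ?exprn_gt0// ler_weXn2l// ler1n.
  rewrite (_ : L * c * (t - t0) / 2 ^+ k = (L * (c / 2 ^+ k)) * (t - t0)).
    apply: vint_bound => //; first by rewrite mulr_ge0// divr_ge0.
      by apply: vintegrableB; exact: integ.
    move=> q /andP[_ qt]; apply: le_trans (F_lip _ _ _) _.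
    by apply: ler_wpM2l => //; exact: unif.
  by ring.
exists X; split => //.
  by rewrite Xeq// vint_empty// addr0.
move=> s t t0s st; split; first exact: integ.
rewrite (Xeq s t0s) (Xeq t (le_trans t0s st)) (vint_cat t0s st); last exact: integ.
by rewrite opprD addrACA subrr add0r addrC addKr.
Qed.

End picard.

(** * Estimates on the fields *)

Section calculus.
Context {R : realType}.

Lemma differentiable_rV (V : normedModType R) n (f : V -> 'rV[R]_n) x :
  (forall k, differentiable (fun y => f y 0 k) x) -> differentiable f x.
Proof.
move=> df; rewrite (_ : f = \sum_(k < n) (fun y => f y 0 k *: delta_mx 0 k)).
  by apply: differentiable_sum => k; exact: differentiableZl.
by apply/funext => y; rewrite fct_sumE -row_sum_delta.
Qed.

Lemma differentiable_coord_rV (V : normedModType R) n (f : V -> 'rV[R]_n) x k :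
  differentiable f x -> differentiable (fun y => f y 0 k) x.
Proof.
by move=> df; apply: (@differentiable_comp _ _ _ _ f (fun v : 'rV[R]_n => v 0 k)) => //;
  exact: differentiable_coord.
Qed.

Lemma is_derive_segment (V W : normedModType R) (f : V -> W) (x d : V) (tau : R) :
  differentiable f (x + tau *: d) ->
  is_derive tau (1 : R) (fun q : R => f (x + q *: d)) ('d f (x + tau *: d) d).
Proof.
move=> df.
have e : (fun h : R => h^-1 *: (((fun q : R => f (x + q *: d)) \o shift tau)
    (h *: (1 : R)) - f (x + tau *: d))) =
  (fun h : R => h^-1 *: ((f \o shift (x + tau *: d)) (h *: d) -
    f (x + tau *: d))).
  apply/funext => h /=; congr (_ *: (f _ - _)).
  by rewrite -[h%:A]/(h * 1) mulr1 scalerDl addrCA.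
split; first by rewrite /derivable e; exact: diff_derivable.
by rewrite /derive e -deriveE.
Qed.

(** The mean value theorem is scalar; in the sup norm it can be applied to each coordinate
    separately, with its own intermediate point. *)
Lemma segment_mvt (V : normedModType R) n (f : V -> 'rV[R]_n) (x d : V) (c : R) :
  0 <= c -> (forall y, differentiable f y) ->
  (forall tau, 0 <= tau <= 1 -> `|'d f (x + tau *: d) d| <= c) ->
  `|f (x + d) - f x| <= c.
Proof.
move=> c0 df dc; apply: rv_norm_le => // k; rewrite !mxE.
pose phi (q : R) := f (x + q *: d) 0 k.
have dphi (q : R) : is_derive q (1 : R) phi ('d f (x + q *: d) d 0 k).
  have [dq e] := is_derive_segment (df (x + q *: d)).
  have h := (derivable_mxP _ _ _).1 dq 0 k.
  split; first exact: h.
  by rewrite -e derive_mx// mxE.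
have cphi : {within `[0, 1], continuous phi}.
  apply: continuous_subspaceT => q; apply: differentiable_continuous.
  by apply/derivable1_diffP; have [] := dphi q.
have [q q01] := MVT_segment ler01 (fun q _ => dphi q) cphi.
rewrite /phi scale1r scale0r addr0 subr0 mulr1 => ->.
apply: le_trans (rv_norm_coord _ _) _; apply: dc.
by move: q01; rewrite in_itv.
Qed.

Lemma differentiable_slice2 (V1 V2 W : normedModType R) (F : V1 * V2 -> W) t x :
  differentiable F (t, x) -> differentiable (fun y => F (t, y)) x.
Proof.
move=> dF; apply: (@differentiable_comp _ _ _ _ (fun y => (t, y)) F) => //.
Qed.

Lemma differentiable_slice1 (V1 V2 W : normedModType R) (F : V1 * V2 -> W) t x :
  differentiable F (t, x) -> differentiable (fun s => F (s, x)) t.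
Proof.
move=> dF; apply: (@differentiable_comp _ _ _ _ (fun s => (s, x)) F) => //.
Qed.

Lemma derive_slice2 (V1 V2 W : normedModType R) (F : V1 * V2 -> W) t x v :
  'D_v (fun y => F (t, y)) x = 'D_(0, v) F (t, x).
Proof.
have e : (fun h : R => h^-1 *: (((fun y => F (t, y)) \o shift x) (h *: v) -
    F (t, x))) =
  (fun h : R => h^-1 *: ((F \o shift (t, x)) (h *: ((0, v) : V1 * V2)) -
    F (t, x))).
  apply/funext => h /=; congr (_ *: (F _ - _)).
  by rewrite -[RHS]/(h *: (0 : V1) + t, h *: v + x) scaler0 add0r.
by rewrite /derive e.
Qed.

Lemma jacobian_entry n p (f : 'rV[R]_n -> 'rV[R]_p) x i k :
  differentiable f x -> ('J f x) i k = 'D_(delta_mx 0 i) f x 0 k.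
Proof. by move=> df; rewrite deriveEjacobian// -rowE [RHS]mxE. Qed.

Lemma box_compact n (r : R) : compact [set x : 'rV[R]_n | `|x| <= r].
Proof.
apply: bounded_closed_compact.
  exists r; split; first exact: num_real.
  by move=> s rs x /= xr; apply: le_trans xr (ltW rs).
rewrite (_ : mkset _ = (fun x : 'rV[R]_n => `|x|) @^-1` [set s | s <= r])//.
apply: closed_comp; last exact: closed_le.
by move=> x _; exact: norm_continuous.
Qed.

Lemma continuous_box_bound n (W : normedModType R) (g : 'rV[R]_n -> W) (r : R) :
  continuous g -> exists2 C : R, 0 <= C & forall x, `|x| <= r -> `|g x| <= C.
Proof.
move=> cg.
have /compact_bounded[M [_ Mg]] : compact (g @` [set x | `|x| <= r]).
  by apply: continuous_compact; [exact: continuous_subspaceT|exact: box_compact].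
exists (`|M| + 1); first by rewrite addr_ge0.
move=> x xr; apply: Mg; last by exists x.
by rewrite (le_lt_trans (ler_norm _))// ltrDl.
Qed.

Lemma box_convex n (r : R) (x y : 'rV[R]_n) (tau : R) : 0 <= tau <= 1 ->
  `|x| <= r -> `|y| <= r -> `|x + tau *: (y - x)| <= r.
Proof.
move=> /andP[t0 t1] xr yr.
have -> : x + tau *: (y - x) = (1 - tau) *: x + tau *: y by vring.
apply: le_trans (ler_normD _ _) _; rewrite !normrZ.
rewrite (ger0_norm t0) ger0_norm ?subr_ge0//.
rewrite [leRHS](_ : _ = (1 - tau) * r + tau * r); last by ring.
by apply: lerD; apply: ler_wpM2l => //; rewrite subr_ge0.
Qed.

Lemma enormZ n (c : R) (v : 'rV[R]_n) : enorm (c *: v) = `|c| * enorm v.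
Proof.
rewrite /enorm; under eq_bigr do rewrite mxE exprMn.
by rewrite -mulr_sumr sqrtrM ?sqr_ge0// sqrtr_sqr.
Qed.

Lemma enorm0 n : enorm (0 : 'rV[R]_n) = 0.
Proof. by rewrite -(scale0r 0) enormZ normr0 mul0r. Qed.

Lemma norm_mulmx n p (M : 'M[R]_(n, p)) (v : 'rV[R]_n) (K : R) : 0 <= K ->
  (forall i j, `|M i j| <= K) -> `|v *m M| <= n%:R * K * `|v|.
Proof.
move=> K0 MK; apply: rv_norm_le => [|j]; first by rewrite !mulr_ge0.
rewrite mxE; apply: le_trans (ler_norm_sum _ _ _) _.
rewrite -mulrA mulr_natl -[n in _ *+ n]card_ord -sumr_const; apply: ler_sum => i _.
by rewrite normrM mulrC; apply: ler_pM => //; exact: rv_norm_coord.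
Qed.

Lemma opnorm_bound n p (M : 'M[R]_(n, p)) (v : 'rV[R]_n) :
  enorm (v *m M) <= opnorm M * enorm v.
Proof.
have [v0|v0] := eqVneq (enorm v) 0.
  have -> : v = 0.
    by apply/eqP; rewrite -normr_le0 -v0; exact: norm_le_enorm.
  by rewrite mul0mx !enorm0 mulr0.
have vp : 0 < enorm v by rewrite lt_def v0 sqrtr_ge0.
rewrite -ler_pdivrMr// mulrC -{1}(gtr0_norm vp) -normfV -enormZ scalemxAl.
apply: ub_le_sup; last first.
  exists ((enorm v)^-1 *: v) => //=.
  by rewrite enormZ normfV (gtr0_norm vp) mulVf.
(* A supremum dominates its elements only for a set bounded above; this crude bound comes from the
   entries of [M]. *)
exists (p%:R * (n%:R * `|M| )) => _ [w /= w1 <-].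
apply: le_trans (enorm_le_norm _) _; apply: ler_wpM2l => //.
apply: le_trans (norm_mulmx (K := `|M|) _ _ _) _ => // [i j|].
  rewrite [leRHS]mx_normrE.
  exact: (le_bigmax _ (fun ij : 'I_n * 'I_p => `|M ij.1 ij.2|) (i, j)).
by rewrite ler_piMr ?mulr_ge0// (le_trans (norm_le_enorm _)).
Qed.

Lemma opnorm_norm n p (M : 'M[R]_(n, p)) (v : 'rV[R]_n) (A : R) : 0 <= A ->
  opnorm M <= A -> `|v *m M| <= A * n%:R * `|v|.
Proof.
move=> A0 MA; apply: le_trans (norm_le_enorm _) _.
apply: le_trans (opnorm_bound _ _) _; rewrite -mulrA.
apply: (@le_trans _ _ (A * enorm v)).
  by apply: ler_wpM2r => //; exact: sqrtr_ge0.
by apply: ler_wpM2l => //; exact: enorm_le_norm.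
Qed.

Lemma differentiable_mulmxr n p (M : 'M[R]_(n, p)) (x : 'rV[R]_n) :
  differentiable (fun z : 'rV[R]_n => z *m M) x.
Proof.
apply: differentiable_rV => k.
rewrite (_ : (fun y : 'rV[R]_n => _) =
  \sum_(l < n) ((fun y : 'rV[R]_n => y 0 l) * cst (M l k))).
  apply: differentiable_sum => l; apply: differentiableM => //.
  exact: differentiable_coord.
by apply/funext => y; rewrite fct_sumE mxE.
Qed.

Lemma diff_mulmxr n p (M : 'M[R]_(n, p)) (x d : 'rV[R]_n) :
  'd (fun z : 'rV[R]_n => z *m M) x d = d *m M.
Proof.
have c : continuous (mulmxr M : 'rV[R]_n -> 'rV[R]_p).
  by move=> z; exact: (differentiable_continuous (differentiable_mulmxr M z)).
by have := diff_lin x c => /(congr1 (fun f => f d)).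
Qed.

End calculus.

(** * Uniform bounds for the fields and their brackets *)

Section field_estimates.
Context {R : realType} {n m : nat}.
Variable b : 'I_m.+1 -> R -> 'rV[R]_n -> 'rV[R]_n.
Hypothesis b_C2 : C2_fields b.

Let F i := fun p : R * 'rV[R]_n => b i p.1 p.2.

Let F_diff i p : differentiable (F i) p.
Proof. by have [] := b_C2 i. Qed.

Let DF_diff i v p : differentiable ('D_v (F i)) p.
Proof. by have [_ /(_ v)[]] := b_C2 i. Qed.

Let DDF_cont i v w : continuous ('D_w ('D_v (F i))).
Proof. by have [_ /(_ v)[_ /(_ w)]] := b_C2 i. Qed.

Lemma field_differentiable i t x : differentiable (b i t) x.
Proof. exact: (differentiable_slice2 (F_diff i (t, x))). Qed.

Lemma field_differentiable_time i t x : differentiable (fun s => b i s x) t.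
Proof. exact: (differentiable_slice1 (F_diff i (t, x))). Qed.

Lemma field_continuous i (X : R -> 'rV[R]_n) : continuous X ->
  continuous (fun s => b i s (X s)).
Proof.
move=> cX s; have cF := differentiable_continuous (F_diff i (s, X s)).
apply: (@continuous_comp _ _ _ (fun s => (s, X s)) (F i)) => //.
apply: (@cvg_pair _ _ _ (nbhs s) (nbhs s) (nbhs (X s))) => //; exact: cX.
Qed.

(** Coordinatewise, the bracket is a sum of products of coordinates of the fields and of their first
    partial derivatives, all jointly differentiable for fields of class C^2. *)
Let bracket_diff i j p :
  differentiable (fun p : R * 'rV[R]_n => lie_bracket (b i) (b j) p.1 p.2) p.
Proof.
apply: differentiable_rV => k.
rewrite (_ : (fun y : R * 'rV[R]_n => _) =
  (\sum_(l < n) ((fun y => F i y 0 l) * (fun y => 'D_(0, delta_mx 0 l) (F j) y 0 k)))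
  - (\sum_(l < n) ((fun y => F j y 0 l) * (fun y => 'D_(0, delta_mx 0 l) (F i) y 0 k)))).
  by apply: differentiableB; apply: differentiable_sum => l;
    apply: differentiableM; apply: differentiable_coord_rV;
    first [exact: F_diff | exact: DF_diff].
apply/funext => -[t x] /=; rewrite /lie_bracket !mxE.
rewrite [RHS]/(_ - _) /=; congr (_ - _).
  rewrite fct_sumE; apply: eq_bigr => l _ /=.
  by rewrite jacobian_entry ?(derive_slice2 (F j))//; exact: field_differentiable.
rewrite fct_sumE; apply: eq_bigr => l _ /=.
by rewrite jacobian_entry ?(derive_slice2 (F i))//; exact: field_differentiable.
Qed.

Lemma lipschitz_space (f : 'rV[R]_n -> 'rV[R]_n) (r A : R) : 0 <= A ->
  (forall x, differentiable f x) ->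
  (forall x, `|x| <= r -> opnorm ('J f x) <= A) ->
  forall x y, `|x| <= r -> `|y| <= r -> `|f y - f x| <= A * n%:R * `|y - x|.
Proof.
move=> A0 df fA x y xr yr.
rewrite -[in f y](subrK x y) [y - x + x]addrC.
apply: segment_mvt => //; first nonneg.
move=> tau tau01; rewrite -deriveE// deriveEjacobian//.
by apply: opnorm_norm => //; apply: fA; exact: box_convex.
Qed.

Lemma lipschitz_time (f : R -> 'rV[R]_n) (A : R) : 0 <= A ->
  (forall t, differentiable f t) -> (forall t, enorm (derive1 f t) <= A) ->
  forall s t, `|f t - f s| <= A * `|t - s|.
Proof.
move=> A0 df fA s t.
rewrite -[in f t](subrK s t) [t - s + s]addrC.
apply: (@segment_mvt R R) => //; first nonneg.
move=> tau _; rewrite -[X in 'd f _ X]mulr1 -[X in 'd f _ X]/((t - s) *: (1 : R)).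
rewrite linearZ /= -derive1E'// normrZ mulrC; apply: ler_wpM2r => //.
exact: le_trans (norm_le_enorm _) (fA _).
Qed.

(* [E] depends on [t]: A2 gives no bound uniform in time. *)
Lemma quadratic_remainder i t (r : R) : exists2 E : R, 0 <= E &
  forall x y, `|x| <= r -> `|y| <= r ->
  `|b i t y - b i t x - (y - x) *m 'J (b i t) x| <= E * `|y - x| ^+ 2.
Proof.
have ex (kl : 'I_n * 'I_n) : exists2 C : R, 0 <= C & forall x, `|x| <= r ->
    `|('D_(0, delta_mx 0 kl.2) ('D_(0, delta_mx 0 kl.1) (F i)) (t, x))| <= C.
  apply: continuous_box_bound => x.
  apply: (@continuous_comp _ _ _ (fun x : 'rV[R]_n => (t, x))
    ('D_(0, delta_mx 0 kl.2) ('D_(0, delta_mx 0 kl.1) (F i)))).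
    by apply: (@cvg_pair _ _ _ (nbhs x) (nbhs t) (nbhs x)) => //; exact: cvg_cst.
  exact: DDF_cont.
pose C := \sum_kl projT1 (cid2 (ex kl)).
have C0 kl : 0 <= projT1 (cid2 (ex kl)) by case: (cid2 (ex kl)).
have CP k l x : `|x| <= r ->
    `|('D_(0, delta_mx 0 l) ('D_(0, delta_mx 0 k) (F i)) (t, x))| <= C.
  move=> xr; apply: (@le_trans _ _ (projT1 (cid2 (ex (k, l))))).
    by case: (cid2 (ex (k, l))) => D _ /= /(_ x xr).
  by rewrite /C (bigD1 (k, l))//= lerDl; apply: sumr_ge0 => *; exact: C0.
have CC0 : 0 <= C by apply: sumr_ge0 => *; exact: C0.
have [J JP] : exists J : 'rV[R]_n -> 'M[R]_n, forall x, J x = 'J (b i t) x.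
  by exists (fun x => 'J (b i t) x).
have J_lip x y : `|x| <= r -> `|y| <= r -> forall k l,
    `|J y k l - J x k l| <= n%:R * C * `|y - x|.
  move=> xr yr k l.
  have JE z : J z k l = 'D_(0, delta_mx 0 k) (F i) (t, z) 0 l.
    rewrite JP -derive_slice2 -jacobian_entry//; exact: field_differentiable.
  rewrite (JE x) (JE y).
  pose g x := 'D_(0, delta_mx 0 k) (F i) (t, x).
  have dg z : differentiable g z.
    exact: (differentiable_slice2 (DF_diff i (0, delta_mx 0 k) (t, z))).
  have := rv_norm_coord (g y - g x) l; rewrite !mxE; move/le_trans; apply.
  rewrite -[in g y](subrK x y) [y - x + x]addrC.
  apply: segment_mvt => //; first nonneg.
  move=> tau tau01; rewrite -deriveE// deriveEjacobian//.
  apply: norm_mulmx => // i1 j1; rewrite jacobian_entry//.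
  apply: le_trans (rv_norm_coord _ _) _; rewrite /g (derive_slice2 ('D_(0, delta_mx 0 k) (F i))).
  by apply: CP; exact: box_convex.
exists (n%:R * (n%:R * C)); first nonneg.
move=> x y xr yr; rewrite -JP.
(* Mean value estimate for the field minus its linearisation at x: the differential at z is J z - J
   x, and [J_lip] supplies the second factor |y - x|. *)
have -> : b i t y - b i t x - (y - x) *m J x =
    (fun z => b i t z - z *m J x) (x + (y - x)) - (fun z => b i t z - z *m J x) x.
  have e : x + (y - x) = y by vring.
  rewrite /= e mulmxBl; move: (b i t y) (b i t x) (y *m _) (x *m _) => *; vring.
have db z := field_differentiable i t z.
have dm z := differentiable_mulmxr (J x) z.
apply: (@segment_mvt R _ n (b i t - (fun z => z *m J x)) x (y - x)).
- nonneg.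
- by move=> z; exact: (differentiableB (db z) (dm z)).
move=> tau tau01.
rewrite -deriveE; last exact: (differentiableB (db _) (dm _)).
rewrite deriveB; [|exact: diff_derivable..].
rewrite [X in `|X|](_ : _ = (y - x) *m (J (x + tau *: (y - x)) - J x)).
  rewrite expr2 mulrA; apply: le_trans (norm_mulmx _ (K := n%:R * C * `|y - x|) _ _) _.
  - nonneg.
  - move=> k l; rewrite !mxE; apply: le_trans (J_lip _ _ xr _ k l) _.
      exact: box_convex.
    rewrite addrC addKr normrZ; apply: ler_wpM2l; first nonneg.
    by case/andP: tau01 => t0 t1; rewrite ger0_norm// ler_piMl.
  - by rewrite le_eqVlt; apply/orP; left; apply/eqP; ring.
by rewrite deriveEjacobian// [X in _ - X]deriveE// diff_mulmxr mulmxBr !JP.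
Qed.

(** The constants do not depend on t, which makes the final frequency threshold independent of
    t0. *)
Record field_bounds (r M L Tm Lg Tg : R) : Prop := FieldBounds {
  fb_M0 : 0 <= M; fb_L0 : 0 <= L; fb_Tm0 : 0 <= Tm; fb_Lg0 : 0 <= Lg;
  fb_Tg0 : 0 <= Tg;
  fb_bound : forall i t (x : 'rV[R]_n), `|x| <= r -> `|b i t x| <= M;
  fb_lip : forall i t (x y : 'rV[R]_n), `|x| <= r -> `|y| <= r ->
    `|b i t y - b i t x| <= L * `|y - x|;
  fb_jac : forall i t (x d : 'rV[R]_n), `|x| <= r -> `|d *m 'J (b i t) x| <= L * `|d|;
  fb_time : forall i s t (x : 'rV[R]_n), `|x| <= r -> `|b i t x - b i s x| <= Tm * `|t - s|;
  fb_lie_lip : forall (i j : 'I_m) t (x y : 'rV[R]_n), `|x| <= r -> `|y| <= r ->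
    `|lie_bracket (ctrl b i) (ctrl b j) t y -
      lie_bracket (ctrl b i) (ctrl b j) t x| <= Lg * `|y - x|;
  fb_lie_time : forall (i j : 'I_m) s t (x : 'rV[R]_n), `|x| <= r ->
    `|lie_bracket (ctrl b i) (ctrl b j) t x -
      lie_bracket (ctrl b i) (ctrl b j) s x| <= Tg * `|t - s| }.

(** The mean value theorem on the convex box turns derivative bounds into Lipschitz bounds; the
    factor n converts the Euclidean operator norm to the sup norm. Brackets are bounded for j <= k
    only, and antisymmetry gives the other order. *)
Lemma field_bounds_exist (b_bounded : bounded_fields b) (r : R) :
  exists M L Tm Lg Tg, field_bounds r M L Tm Lg Tg.
Proof.
have [A1 [A2 [A3 [A4 [A5 [A6 [[A10 A20 A30] [[_ A50 A60] bA]]]]]]]] :=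
  b_bounded _ (@box_compact R n r).
have lieN f g t (x : 'rV[R]_n) : lie_bracket f g t x = - lie_bracket g f t x.
  by rewrite /lie_bracket opprB.
exists A1, (A3 * n%:R), A2, (A5 * n%:R), A6; split => //; try nonneg.
- move=> i t x xr; have [/(_ i)[h _ _] _ _] := bA x t xr.
  exact: le_trans (norm_le_enorm _) h.
- move=> i t x y xr yr; apply: (lipschitz_space (r := r)) => //.
    exact: field_differentiable.
  by move=> z zr; have [/(_ i)[]] := bA z t zr.
- move=> i t x d xr; have [/(_ i)[_ _ h] _ _] := bA x t xr.
  exact: opnorm_norm.
- move=> i s t x xr; apply: (lipschitz_time (f := fun s => b i s x)) => //.
    by move=> q; exact: field_differentiable_time.
  by move=> q; have [/(_ i)[]] := bA x q xr.
- have h (i j : 'I_m) t (x y : 'rV[R]_n) : (i <= j)%N -> `|x| <= r -> `|y| <= r ->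
    `|lie_bracket (ctrl b i) (ctrl b j) t y -
      lie_bracket (ctrl b i) (ctrl b j) t x| <= A5 * n%:R * `|y - x|.
    move=> ij xr yr; apply: (lipschitz_space (r := r)) => // z.
      exact: (differentiable_slice2 (bracket_diff _ _ (t, z))).
    by move=> zr; have [_ _ /(_ i j ij)[]] := bA z t zr.
  move=> i j t x y xr yr; have [ij|/ltnW ji] := leqP i j; first exact: h.
  rewrite (lieN _ _ t x) (lieN _ _ t y) -opprD normrN; exact: h.
- have h (i j : 'I_m) s t (x : 'rV[R]_n) : (i <= j)%N -> `|x| <= r ->
    `|lie_bracket (ctrl b i) (ctrl b j) t x -
      lie_bracket (ctrl b i) (ctrl b j) s x| <= A6 * `|t - s|.
    move=> ij xr.
    apply: (lipschitz_time (f := fun s => lie_bracket (ctrl b i) (ctrl b j) s x))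
      => // q.
      exact: (differentiable_slice1 (bracket_diff _ _ (q, x))).
    by have [_ _ /(_ i j ij)[]] := bA x q xr.
  move=> i j s t x xr; have [ij|/ltnW ji] := leqP i j; first exact: h.
  rewrite (lieN _ _ t x) (lieN _ _ s x) -opprD normrN; exact: h.
Qed.

End field_estimates.

(** * The Lie bracket system *)

Section clamp.
Context {R : realType} {n : nat}.
Variable r : R.
Hypothesis r0 : 0 <= r.
Implicit Types x y : 'rV[R]_n.

(** This retraction onto the sup-norm box is 1-Lipschitz, so bounds and Lipschitz constants on the
    box become global after composition. *)
Definition clamp x : 'rV[R]_n := \row_i Num.max (- r) (Num.min (x 0 i) r).

Lemma clamp_norm x : `|clamp x| <= r.
Proof.
apply: rv_norm_le => // i; rewrite mxE ler_norml le_max lexx/= ge_max.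
by rewrite ge_min lexx orbT andbT (le_trans _ r0)// oppr_le0.
Qed.

Lemma clamp_id x : `|x| <= r -> clamp x = x.
Proof.
move=> xr; apply/rowP => i; rewrite mxE.
have := le_trans (rv_norm_coord x i) xr; rewrite ler_norml => /andP[h1 h2].
by rewrite min_l// max_r.
Qed.

Lemma clamp_lip x y : `|clamp x - clamp y| <= `|x - y|.
Proof.
apply: rv_norm_le => // i; rewrite !mxE.
apply: le_trans (rv_norm_coord _ i); rewrite !mxE.
move: (x 0 i) (y 0 i) => a c; move: r0 => r0'.
rewrite ler_norml; have := ler_norm (a - c); have := ler_norm (c - a).
rewrite [`|c - a|]distrC => h1 h2.
have h0 := normr_ge0 (a - c).
case: (leP a r) => ?; case: (leP c r) => ?; case: (leP (- r) a) => ?;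
  case: (leP (- r) c) => ?; case: (leP (- r) r) => ?; apply/andP; split; lra.
Qed.

Lemma clamp_continuous (X : R -> 'rV[R]_n) : continuous X ->
  continuous (fun s => clamp (X s)).
Proof.
move=> cX t; apply/cvgrPdist_le => e e0.
have /cvgrPdist_le/(_ _ e0) := cX t; apply: filterS => s.
by apply: le_trans; exact: clamp_lip.
Qed.

End clamp.

(** * Bounds for the averaged coefficients and the averaged field *)

Section lie_bracket_field.
Context {R : realType} {n m : nat}.
Variables (b : 'I_m.+1 -> R -> 'rV[R]_n -> 'rV[R]_n) (u : 'I_m -> R -> R -> R).
Variables (T Mu Lu : R).
Hypotheses (T0 : 0 < T) (Mu0 : 0 <= Mu) (Lu0 : 0 <= Lu).
Hypothesis u_meas : forall i t, lmeas (u i t).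
Hypothesis u_bound : forall i t th, `|u i t th| <= Mu.
Hypothesis u_lip : forall i t1 t2 th,
  `|u i t1 th - u i t2 th| <= Lu * `|t1 - t2|.

Lemma input_integrable i t x y : lebesgue_integrable x y (u i t).
Proof. by apply: (lmeas_integrable (M := Mu)). Qed.

(** To the left of 0 the integral runs over an empty interval and vanishes, so the bound holds on
    the whole line, as continuity there needs. *)
Lemma primitive_lip i t x y : x <= y ->
  `|lebint 0 y (u i t) - lebint 0 x (u i t)| <= Mu * (y - x).
Proof.
move=> xy; have int0 z : z <= 0 -> lebint 0 z (u i t) = 0.
  rewrite le_eqVlt => /predU1P[->|z0]; first exact: lebint_point.
  by rewrite /lebint set_itv_ge ?Rintegral_set0// bnd_simp -ltNge.
have bnd z1 z2 : z1 <= z2 -> `|lebint z1 z2 (u i t)| <= Mu * (z2 - z1).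
  by move=> zz; apply: lebint_bound => //; exact: input_integrable.
have [x0|/ltW x0] := leP x 0.
  rewrite (int0 x x0) subr0; have [y0|/ltW y0] := leP y 0.
    by rewrite int0// normr0 mulr_ge0// subr_ge0.
  by apply: le_trans (bnd _ _ y0) _; apply: ler_wpM2l => //; rewrite lerD2l lerN2.
rewrite (lebint_cat x0 xy); last exact: input_integrable.
rewrite addrC addKr; exact: bnd.
Qed.

Lemma primitive_lmeas i t : lmeas (fun th => lebint 0 th (u i t)).
Proof.
have c : continuous (fun th => \row_(k < 1) lebint 0 th (u i t)).
  apply: (@lipschitz_continuous_rv _ _ _ Mu) => x y xy; apply: rv_norm_le => [|k].
    by rewrite mulr_ge0// subr_ge0.
  by rewrite !mxE; exact: primitive_lip.
apply: continuous_lmeas => x; apply/cvgrPdist_le => e e0.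
have /cvgrPdist_le/(_ _ e0) := c x; apply: filterS => s.
move=> h; have := le_trans (rv_norm_coord _ ord0) h.
by rewrite !mxE.
Qed.

Lemma primitive_bound i t th : 0 <= th <= T -> `|lebint 0 th (u i t)| <= Mu * T.
Proof.
move=> /andP[th0 thT].
have := primitive_lip i t th0; rewrite lebint_point !subr0 => /le_trans; apply.
exact: ler_wpM2l.
Qed.

Lemma area_integrable i j t : lebesgue_integrable 0 T
  (fun th => u j t th * lebint 0 th (u i t)).
Proof.
apply: (lmeas_integrable (M := Mu * (Mu * T))).
  by apply: lmeasM => //; exact: primitive_lmeas.
move=> th thT; rewrite normrM; apply: ler_pM => //; exact: primitive_bound.
Qed.

Lemma nu_bound j i t : `|nu u T j i t| <= Mu * (Mu * T).
Proof.
rewrite /nu normrM gtr0_norm ?invr_gt0// ler_pdivrMl// mulrC.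
rewrite -[X in _ * X]subr0; apply: lebint_bound; [exact: ltW|exact: area_integrable|].
by move=> th thT; rewrite normrM; apply: ler_pM => //; exact: primitive_bound.
Qed.

(** Replacing t by s in either of the two inputs costs Lu |t - s| times Mu T, whence the factor 2;
    averaging over the period preserves the bound. *)
Lemma nu_lip j i s t : `|nu u T j i t - nu u T j i s| <= 2 * Mu * Lu * T * `|t - s|.
Proof.
rewrite /nu -mulrBr normrM gtr0_norm ?invr_gt0// ler_pdivrMl//.
rewrite -lebintB; [|exact: area_integrable..].
have -> : T * (2 * Mu * Lu * T * `|t - s|) =
  (2 * Mu * Lu * T * `|t - s|) * (T - 0) by ring.
apply: lebint_bound; [exact: ltW| |].
  by apply: lebesgue_integrableB; exact: area_integrable.
move=> th thT.
have -> : u j t th * lebint 0 th (u i t) - u j s th * lebint 0 th (u i s) =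
  (u j t th - u j s th) * lebint 0 th (u i t) +
  u j s th * (lebint 0 th (u i t) - lebint 0 th (u i s)) by ring.
have -> : 2 * Mu * Lu * T * `|t - s| = (Lu * `|t - s|) * (Mu * T) +
  Mu * (Lu * `|t - s| * T) by ring.
apply: le_trans (ler_normD _ _) _; rewrite !normrM; apply: lerD.
  by apply: ler_pM => //; exact: primitive_bound.
apply: ler_pM => //.
case/andP: thT => th0 thT.
rewrite -lebintB; [|exact: input_integrable..].
apply: (@le_trans _ _ (Lu * `|t - s| * (th - 0))).
  by apply: lebint_bound => //; apply: lebesgue_integrableB; exact: input_integrable.
by rewrite subr0; apply: ler_wpM2l => //; rewrite mulr_ge0.
Qed.

Variables (r M L Tm Lg Tg : R).
Hypothesis fb : field_bounds b r M L Tm Lg Tg.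
Let M0 : 0 <= M := fb_M0 fb.
Let L0 : 0 <= L := fb_L0 fb.
Let Lg0 : 0 <= Lg := fb_Lg0 fb.
Let Tm0 : 0 <= Tm := fb_Tm0 fb.
Let Tg0 : 0 <= Tg := fb_Tg0 fb.

Lemma lie_bracket_bound i j t (x : 'rV[R]_n) : `|x| <= r ->
  `|lie_bracket (ctrl b i) (ctrl b j) t x| <= 2 * (L * M).
Proof.
move=> xr; rewrite /lie_bracket; apply: le_trans (ler_normB _ _) _.
rewrite mulr_natl mulr2n; apply: lerD;
  (apply: le_trans (fb_jac fb _ _ _ xr) _; apply: ler_wpM2l => //;
   exact: (fb_bound fb)).
Qed.

Lemma norm_double_sum (c : 'I_m -> 'I_m -> 'rV[R]_n) (B : R) : 0 <= B ->
  (forall i j, `|c i j| <= B) ->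
  `|\sum_(i < m) \sum_(j < m | (i < j)%N) c i j| <= m%:R * (m%:R * B).
Proof.
move=> B0 cB.
have h (p : pred 'I_m) (v : 'I_m -> 'rV[R]_n) (K : R) : 0 <= K ->
    (forall j, `|v j| <= K) -> `|\sum_(j < m | p j) v j| <= m%:R * K.
  move=> K0 vK; rewrite big_mkcond/=; apply: le_trans (ler_norm_sum _ _ _) _.
  rewrite mulr_natl -[m in _ *+ m]card_ord -sumr_const; apply: ler_sum => j _.
  by case: ifP => _; rewrite ?normr0.
have h' := h; apply: h' => [|i]; [nonneg|exact: h].
Qed.

Definition lb_lip_const := L + m%:R * (m%:R * (Mu * (Mu * T) * Lg)).
Definition lb_bound_const := M + m%:R * (m%:R * (Mu * (Mu * T) * (2 * (L * M)))).
Definition lb_time_const := Tm + m%:R * (m%:R *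
  (2 * Mu * Lu * T * (2 * (L * M)) + Mu * (Mu * T) * Tg)).

Lemma lb_lip t x y : `|x| <= r -> `|y| <= r ->
  `|lb_field b u T t y - lb_field b u T t x| <= lb_lip_const * `|y - x|.
Proof.
move=> xr yr; rewrite /lb_field opprD addrACA mulrDl.
apply: le_trans (ler_normD _ _) _; apply: lerD; first exact: (fb_lip fb).
rewrite -sumrB; under eq_bigr do rewrite -sumrB.
rewrite -!mulrA; apply: norm_double_sum => [|i j]; first nonneg.
rewrite -scalerBr normrZ.
have -> : Mu * (Mu * (T * (Lg * `|y - x|))) = Mu * (Mu * T) * (Lg * `|y - x|).
  by ring.
by apply: ler_pM => //; [exact: nu_bound|exact: (fb_lie_lip fb)].
Qed.

Lemma lb_bound t x : `|x| <= r -> `|lb_field b u T t x| <= lb_bound_const.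
Proof.
move=> xr; rewrite /lb_field; apply: le_trans (ler_normD _ _) _.
apply: lerD; first exact: (fb_bound fb).
apply: norm_double_sum => [|i j]; first nonneg.
by rewrite normrZ; apply: ler_pM => //; [exact: nu_bound|exact: lie_bracket_bound].
Qed.

Lemma lb_time s t x : `|x| <= r ->
  `|lb_field b u T t x - lb_field b u T s x| <= lb_time_const * `|t - s|.
Proof.
move=> xr; rewrite /lb_field opprD addrACA mulrDl.
apply: le_trans (ler_normD _ _) _; apply: lerD; first exact: (fb_time fb).
rewrite -sumrB; under eq_bigr do rewrite -sumrB.
rewrite -!mulrA; apply: norm_double_sum => [|i j]; first nonneg.
set G := lie_bracket _ _.
have -> : nu u T j i t *: G t x - nu u T j i s *: G s x =
    (nu u T j i t - nu u T j i s) *: G t x + nu u T j i s *: (G t x - G s x).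
  by move: (nu _ _ _ _ _) (nu _ _ _ _ _) (G t x) (G s x) => *; vring.
apply: le_trans (ler_normD _ _) _; rewrite normrZ [X in _ + X <= _]normrZ.
have -> : (2 * (Mu * (Lu * (T * (2 * (L * M))))) + Mu * (Mu * (T * Tg))) * `|t - s|
  = 2 * Mu * Lu * T * `|t - s| * (2 * (L * M)) +
    Mu * (Mu * T) * (Tg * `|t - s|) by ring.
apply: lerD; apply: ler_pM => //; [exact: nu_lip|exact: lie_bracket_bound|
  exact: nu_bound|exact: (fb_lie_time fb)].
Qed.

End lie_bracket_field.

(** * One period of the fast input *)

Lemma lebint_cells {R : realType} (f : R -> R) (a d : R) (P : nat) : 0 <= d ->
  lebesgue_integrable a (a + P%:R * d) f ->
  lebint a (a + P%:R * d) f =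
  \sum_(l < P) lebint (a + l%:R * d) (a + l.+1%:R * d) f.
Proof.
move=> d0; elim: P => [|P IH] fi.
  by rewrite mul0r addr0 lebint_point big_ord0.
have h1 : a <= a + P%:R * d by rewrite lerDl mulr_ge0.
have h2 : a + P%:R * d <= a + P.+1%:R * d.
  by rewrite lerD2l ler_wpM2r// ler_nat.
rewrite big_ord_recr/= -IH; first exact: lebint_cat.
exact: integrable_lebesgueS fi.
Qed.

Lemma vanishing_error {R : realType} (x K Q : R) :
  (forall P : nat, (0 < P)%N -> x <= K + Q / P%:R) -> x <= K.
Proof.
move=> xP; rewrite leNgt; apply/negP => Kx.
have d0 : 0 < x - K by rewrite subr_gt0.
have := xP (Num.truncn (Q / (x - K))).+1 isT; rewrite -lerBlDl.
rewrite ler_pdivlMr ?ltr0n// mulrC -ler_pdivlMr//.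
by apply/negP; rewrite -ltNge truncnS_gt.
Qed.

Section period.
Context {R : realType} {n m : nat}.
Variables (b : 'I_m.+1 -> R -> 'rV[R]_n -> 'rV[R]_n) (u : 'I_m -> R -> R -> R).
Variables (T Mu Lu : R).
Hypotheses (T0 : 0 < T) (Mu0 : 0 <= Mu) (Lu0 : 0 <= Lu).
Hypothesis u_meas : forall i t, lmeas (u i t).
Hypothesis u_bound : forall i t th, `|u i t th| <= Mu.
Hypothesis u_lip : forall i t1 t2 th,
  `|u i t1 th - u i t2 th| <= Lu * `|t1 - t2|.
Hypothesis u_mean : forall i t, lebint 0 T (u i t) = 0.
Variables (r M L Tm Lg Tg : R).
Hypothesis r0 : 0 <= r.
Hypothesis fb : field_bounds b r M L Tm Lg Tg.
Hypothesis b_C2 : C2_fields b.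
Let M0 : 0 <= M := fb_M0 fb.
Let L0 : 0 <= L := fb_L0 fb.
Let Lg0 : 0 <= Lg := fb_Lg0 fb.
Let Tm0 : 0 <= Tm := fb_Tm0 fb.
Let Tg0 : 0 <= Tg := fb_Tg0 fb.

Variable w : R.
Hypothesis w0 : 0 < w.
Hypothesis u_diag : forall i, lmeas (fun s => u i s (w * s)).

(** [g] is the amplitude of the inputs, [e] its inverse and the small parameter, [h] = T / w one
    fast period. In one period the controls can displace the state by order g h = T e, the drift
    only by order e^2. *)
Let g := Num.sqrt w.
Let e := g^-1.
Let h := T * e ^+ 2.
Let g0 : 0 < g. Proof. by rewrite sqrtr_gt0. Qed.
Let e0 : 0 < e. Proof. by rewrite invr_gt0. Qed.
Let ge1 : g * e = 1. Proof. by rewrite divff// gt_eqF. Qed.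
Let wg : w = g ^+ 2. Proof. by rewrite sqr_sqrtr// ltW. Qed.
Let we : w * e ^+ 2 = 1. Proof. by rewrite wg -exprMn ge1 expr1n. Qed.
Let wh : w * h = T. Proof. by rewrite /h mulrCA we mulr1. Qed.
Let h0 : 0 < h. Proof. by rewrite mulr_gt0// exprn_gt0. Qed.

Definition clamped_field (s : R) (x : 'rV[R]_n) := ia_field b u w s (clamp r x).

Lemma clamped_field_meas (X : R -> 'rV[R]_n) : continuous X ->
  vlmeas (fun s => clamped_field s (X s)).
Proof.
move=> cX k.
have cc i : lmeas (fun s => b i s (clamp r (X s)) 0 k).
  apply: continuous_lmeas => t; apply: (@continuous_comp _ _ _
    (fun s => b i s (clamp r (X s))) (fun v : 'rV[R]_n => v 0 k)).
    by apply: field_continuous => //; exact: clamp_continuous.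
  exact: coord_continuous.
under eq_fun do rewrite /clamped_field /ia_field mxE summxE.
apply: lmeasD => //; apply: lmeas_sum => i.
under eq_fun do rewrite mxE.
apply: lmeasM; last exact: cc.
by apply: lmeasM => //; exact: lmeas_cst.
Qed.

(** Velocity in units of [g]: the drift counts 1 because g >= 1, each control counts [Mu]. *)
Definition speed := (1 + m%:R * Mu) * M.

Let speed0 : 0 <= speed. Proof. by rewrite /speed; nonneg. Qed.

Lemma clamped_field_bound s x : e <= 1 -> `|clamped_field s x| <= speed * g.
Proof.
move=> e1; have xr := clamp_norm r0 x.
have g1 : 1 <= g by rewrite -[g]invrK invf_ge1.
rewrite /clamped_field /ia_field; apply: le_trans (ler_normD _ _) _.
rewrite (_ : speed * g = M * g + m%:R * (g * Mu) * M); last by rewrite /speed; ring.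
apply: lerD.
  by apply: le_trans (fb_bound fb _ _ xr) _; rewrite ler_peMr.
apply: norm_lincomb => [|i|i]; first nonneg.
  by rewrite normrM (ger0_norm (ltW g0)) ler_pM2l.
exact: (fb_bound fb).
Qed.

(** The constant grows with [g]; it serves the existence of the trajectory, not the estimates
    uniform in w. *)
Lemma clamped_field_lip s x y :
  `|clamped_field s x - clamped_field s y| <= (L + m%:R * (g * Mu) * L) * `|x - y|.
Proof.
have xr := clamp_norm r0 x; have yr := clamp_norm r0 y.
rewrite /clamped_field /ia_field opprD addrACA mulrDl.
apply: le_trans (ler_normD _ _) _; apply: lerD.
  by apply: le_trans (fb_lip fb _ _ yr xr) _; apply: ler_wpM2l => //; exact: clamp_lip.
rewrite -sumrB; under eq_bigr do rewrite -scalerBr.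
rewrite -[leRHS]mulrA; apply: norm_lincomb => [|i|i]; first nonneg.
  by rewrite normrM (ger0_norm (ltW g0)) ler_pM2l.
by apply: le_trans (fb_lip fb _ _ yr xr) _; apply: ler_wpM2l => //; exact: clamp_lip.
Qed.

Section one_period.
Variables (s : R) (P : nat).
Hypothesis s_grid : forall i t th, u i t (th + w * s) = u i t th.
Hypothesis P0 : (0 < P)%N.
Let d := h / P%:R.
Let dT := T / P%:R.
Let PR : 0 < P%:R :> R. Proof. by rewrite ltr0n. Qed.
Let d0 : 0 < d. Proof. by rewrite divr_gt0. Qed.
Let dT0 : 0 < dT. Proof. by rewrite divr_gt0. Qed.

Definition coef (i : 'I_m) (l : nat) : R :=
  g * lebint (s + l%:R * d) (s + l.+1%:R * d) (fun q => u i s (w * q)).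

(** Change of variables th = w (q - s): [s_grid] restarts the fast phase at zero, and the factor g /
    w is [e]. *)
Let coefE i l : coef i l = e * lebint (l%:R * dT) (l.+1%:R * dT) (u i s).
Proof.
have st k : w * (s + k%:R * d) + - (w * s) = k%:R * dT.
  rewrite /dT -wh /d; ring.
have uw q : u i s (w * q) = u i s (w * q + - (w * s)).
  by rewrite -[in RHS](s_grid i s) subrK.
rewrite /coef; under [in LHS]eq_lebint do rewrite uw.
rewrite -!st (lebint_affine w0)//; last first.
- by apply: (lmeas_integrable (M := Mu)) => //; exact: lmeas_comp_affine.
- exact: input_integrable.
have ew : e * w = g by rewrite [X in e * X]wg expr2 mulrA [e * g]mulrC ge1 mul1r.
by rewrite [RHS]mulrA ew.
Qed.

Let kappa := Mu * T * e.

Let coef_bound i l : (l < P)%N -> `|coef i l| <= kappa / P%:R.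
Proof.
move=> _; rewrite coefE normrM (ger0_norm (ltW e0)).
rewrite (_ : kappa / P%:R = e * (Mu * (l.+1%:R * dT - l%:R * dT))); last first.
  by rewrite -natr1 /kappa /dT; ring.
rewrite ler_pM2l//; apply: lebint_bound => //.
  by rewrite ler_pM2r// ler_nat.
exact: input_integrable.
Qed.

Let coef_sum i l : \sum_(q < l) coef i q = e * lebint 0 (l%:R * dT) (u i s).
Proof.
have := @lebint_cells R (u i s) 0 dT l (ltW dT0) (input_integrable u_meas u_bound _ _ _ _).
rewrite add0r => ->//; rewrite mulr_sumr; apply: eq_bigr => q _.
by rewrite coefE !add0r.
Qed.

Let PdT : P%:R * dT = T.
Proof. by rewrite /dT mulrC divfK// gt_eqF. Qed.

Let coef_sum0 i : \sum_(q < P) coef i q = 0.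
Proof. by rewrite coef_sum PdT u_mean mulr0. Qed.

(** On each cell the primitive is frozen at the left end, with error at most Mu dT; over P cells of
    length dT = T / P this leaves O(1/P). *)
Let area_nu i j : `|area P coef i j - h * nu u T j i s| <=
  e ^+ 2 * (Mu ^+ 2 * T ^+ 2) / P%:R.
Proof.
pose U th := lebint 0 th (u i s).
have -> : h * nu u T j i s = e ^+ 2 * lebint 0 T (fun th => u j s th * U th).
  rewrite /h /nu -/U mulrA; congr (_ * _).
  by rewrite mulrAC divff ?mul1r// gt_eqF.
have ai : lebesgue_integrable 0 T (fun th => u j s th * U th).
  exact: (area_integrable T Mu0 u_meas u_bound i j s).
have := @lebint_cells R (fun th => u j s th * U th) 0 dT P (ltW dT0).
rewrite PdT add0r => -> //.
rewrite /area mulr_sumr -sumrB.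
apply: (@le_trans _ _ (\sum_(l < P) e ^+ 2 * (Mu * (Mu * dT) * dT))); last first.
  rewrite sumr_const card_ord -[_ *+ P]mulr_natr /dT le_eqVlt; apply/orP; left.
  by apply/eqP; field; rewrite gt_eqF.
apply: le_trans (ler_norm_sum _ _ _) _; apply: ler_sum => l _.
rewrite coef_sum coefE !add0r.
have ll : l%:R * dT <= l.+1%:R * dT by rewrite ler_pM2r// ler_nat.
have l0 : 0 <= l%:R * dT by nonneg.
have lT : l.+1%:R * dT <= T by rewrite -PdT ler_pM2r// ler_nat.
have -> : e * lebint (l%:R * dT) (l.+1%:R * dT) (u j s) *
    (e * lebint 0 (l%:R * dT) (u i s)) =
  e ^+ 2 * lebint (l%:R * dT) (l.+1%:R * dT) (fun th => U (l%:R * dT) * u j s th).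
  by rewrite lebintZ; [rewrite /U; ring|exact: input_integrable].
rewrite -mulrBr normrM (@ger0_norm _ (e ^+ 2)); last nonneg.
rewrite ler_pM2l ?exprn_gt0//.
rewrite -lebintB; last first.
- exact: integrable_lebesgueS ai.
- by apply: lebesgue_integrableZ; exact: input_integrable.
rewrite (_ : Mu * (Mu * dT) * dT = Mu * (Mu * dT) * (l.+1%:R * dT - l%:R * dT));
  last by rewrite -natr1; ring.
apply: lebint_bound => //.
  apply: lebesgue_integrableB; last exact: integrable_lebesgueS ai.
  by apply: lebesgue_integrableZ; exact: input_integrable.
move=> th /andP[h1 h2]; rewrite [U _ * _]mulrC -mulrBr normrM; apply: ler_pM => //.
rewrite distrC; apply: le_trans (primitive_lip Mu0 u_meas u_bound i s h1) _.
apply: ler_wpM2l => //; move: h2; rewrite -natr1; lra.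
Qed.

Let alpha := m%:R * kappa.
Hypothesis e1 : e <= 1.
Hypotheses (alphaM : alpha * M <= 1) (alphaL : alpha * L <= 1 / 2).
Variable X : R -> 'rV[R]_n.
Hypothesis X_lip : forall p q, p <= q -> `|X q - X p| <= speed * g * (q - p).
Hypothesis X_int : forall p q, s <= p -> p <= q ->
  vintegrable p q (fun t => clamped_field t (X t)) /\
  X q - X p = vint p q (fun t => clamped_field t (X t)).
(** The margin 1 is what the polygon can travel, by [alphaM]. *)
Hypothesis Xs : `|X s| + 1 <= r.

Let Y := euler (lincomb (fun j => ctrl b j s) coef) (X s) 1.

Let Xsr : `|X s| <= r.
Proof. by apply: le_trans Xs; rewrite lerDl. Qed.

Let Y_near l : (l <= P)%N -> `|Y l - X s| <= alpha * M * (l%:R / P%:R) /\ `|Y l| <= r.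
Proof.
move=> lP; apply: (@euler_near R n P _ (X s) r alpha M) => //.
- by rewrite /alpha /kappa; nonneg.
- by apply: le_trans Xs; rewrite lerD2l.
- move=> k y kP yr.
  rewrite (_ : alpha * M / P%:R = m%:R * (kappa / P%:R) * M); last first.
    by rewrite /alpha; ring.
  apply: norm_lincomb => [|j|j]; [by rewrite /kappa; nonneg|exact: coef_bound|].
  exact: (fb_bound fb).
- by rewrite ler01 lexx.
Qed.

(** Coefficient of [e] in the cell defect [Wb] below. The first two terms come from freezing the
    drift field in time and space; the others, multiplied by the number of controls, from freezing
    the slow time of the inputs and of the control fields, and from the displacement h M caused by
    the drift. *)
Definition drift_const := Tm * T + L * speed * T +
  m%:R * (Lu * T * M + Mu * Tm * T + Mu * L * T * M).

Let drift0 : 0 <= drift_const.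
Proof. by rewrite /drift_const; nonneg. Qed.

(** The polygon carries the controls only; the drift is added to first order as (l d) b_0. The
    remaining difference obeys [small_gronwall] with rate alpha L, forced by the defect of the
    integrand on each cell. *)
Let X_Y l : (l <= P)%N ->
  `|X (s + l%:R * d) - Y l - (l%:R * d) *: b ord0 s (X s)| <=
  2 * (T * drift_const * e ^+ 3 + T * (m%:R * Mu * L * speed * T) * e ^+ 2 / P%:R).
Proof.
move=> lP.
pose q l := X (s + l%:R * d) - Y l - (l%:R * d) *: b ord0 s (X s).
set B := T * drift_const * _ + _.
have B0 : 0 <= B by rewrite /B; nonneg.
suff hh : `|q l| <= 2 * B * (l%:R / P%:R).
  apply: le_trans hh _; rewrite ler_piMr ?mulr_ge0//.
  by rewrite ler_pdivrMr// mul1r ler_nat.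
have al0 : 0 <= alpha * L by rewrite /alpha /kappa; nonneg.
apply: (@small_gronwall R P (fun l => `|q l|) (alpha * L) B) => //.
- by rewrite al0 alphaL.
- by rewrite /q /Y /= mul0r addr0 scale0r subrr subr0 normr0.
move=> {lP}k kP.
set a := s + k%:R * d; set c := s + k.+1%:R * d.
have ca : c - a = d by rewrite /c /a -natr1; ring.
have ac : a <= c by rewrite -subr_ge0 ca ltW.
have sa : s <= a by rewrite /a lerDl mulr_ge0// ltW.
have Pd : P%:R * d = h by rewrite /d mulrC divfK// gt_eqF.
have csh : c <= s + h by rewrite lerD2l -Pd ler_pM2r// ler_nat.
have [iX eX] := X_int sa ac.
have [Yk Ykr] := Y_near (ltnW kP).
pose v t := \sum_j (g * u j s (w * t)) *: ctrl b j s (Y k).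
have mj j : lmeas (fun t => u j s (w * t)).
  by have := lmeas_comp_affine 0 w0 (u_meas j s); under eq_fun do rewrite addr0.
have ij j x y : lebesgue_integrable x y (fun t => u j s (w * t)).
  by apply: (lmeas_integrable (M := Mu)).
have ivj j : vintegrable a c (fun t => (g * u j s (w * t)) *: ctrl b j s (Y k)).
  move=> i; under eq_fun do rewrite mxE mulrC mulrA.
  exact: lebesgue_integrableZ.
have iv : vintegrable a c v.
  move=> i; under eq_fun do rewrite summxE.
  by apply: lebesgue_integrable_sum => j _; exact: ivj.
have ev : vint a c v = lincomb (fun j => ctrl b j s) coef k (Y k).
  rewrite /v vint_sum//; apply: eq_bigr => j _.
  by rewrite vint_scale ?lebintZ//; exact: lebesgue_integrableZ.
have i0 : vintegrable a c (fun=> b ord0 s (X s)).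
  by move=> i; exact: lebesgue_integrable_cst.
pose W t := clamped_field t (X t) - v t - b ord0 s (X s).
have iW : vintegrable a c W.
  by apply: vintegrableB => //; exact: vintegrableB.
have qS : q k.+1 = q k + vint a c W.
  rewrite /W vintB//; last exact: vintegrableB.
  rewrite vintB// vint_cst// ca ev -eX /q -/a -/c.
  have -> : Y k.+1 = Y k + 1 *: lincomb (fun j => ctrl b j s) coef k (Y k) by [].
  rewrite scale1r -natr1.
  have alg (xc xa yk l0 b0 : 'rV[R]_n) (z : R) :
    xc - (yk + l0) - ((z + 1) * d) *: b0 =
    xa - yk - (z * d) *: b0 + (xc - xa - l0 - d *: b0) by vring.
  exact: alg.
have Xa t : a <= t <= c -> `|X t - X a| <= speed * g * d.
  move=> /andP[at_ tc]; apply: le_trans (X_lip at_) _.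
  apply: ler_wpM2l; first by rewrite mulr_ge0// ltW.
  by rewrite -ca lerD2r.
have qa : `|X a - Y k| <= `|q k| + h * M.
  have -> : X a - Y k = q k + (k%:R * d) *: b ord0 s (X s).
    by rewrite /q -/a subrK.
  apply: le_trans (ler_normD _ _) _; rewrite lerD2l normrZ ger0_norm; last nonneg.
  apply: ler_pM => //; [nonneg| |exact: (fb_bound fb)].
  by rewrite -Pd ler_pM2r// ler_nat ltnW.
(* Sources in order: time and space variation of the drift field, slow time of the inputs, time and
   space variation of the control fields. *)
set Wb := Tm * h + L * (speed * g * h) + m%:R * g * (Lu * h * M +
  Mu * (Tm * h + L * (speed * g * d + (`|q k| + h * M)))).
have W_bound t : a <= t <= c -> `|W t| <= Wb.
  move=> tac; have /andP[at_ tc] := tac.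
  have st : s <= t by exact: le_trans at_.
  have tsh : `|t - s| <= h by rewrite ger0_norm ?subr_ge0//; lra.
  have cr := clamp_norm r0 (X t).
  have cXY : `|clamp r (X t) - Y k| <= speed * g * d + (`|q k| + h * M).
    rewrite -[in X in _ - X](clamp_id Ykr); apply: le_trans (clamp_lip r0 _ _) _.
    rewrite -(subrK (X a) (X t)) -addrA; apply: le_trans (ler_normD _ _) _.
    by apply: lerD; [exact: Xa|exact: qa].
  have cXs : `|clamp r (X t) - X s| <= speed * g * h.
    rewrite -[in X in _ - X](clamp_id Xsr); apply: le_trans (clamp_lip r0 _ _) _.
    apply: le_trans (X_lip st) _; apply: ler_wpM2l.
      by rewrite mulr_ge0// ltW.
    by move: tsh; rewrite ger0_norm ?subr_ge0.
  have -> : W t = (b ord0 t (clamp r (X t)) - b ord0 s (clamp r (X t))) +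
    (b ord0 s (clamp r (X t)) - b ord0 s (X s)) +
    \sum_j g *: ((u j t (w * t) - u j s (w * t)) *: ctrl b j t (clamp r (X t)) +
      u j s (w * t) *: ((ctrl b j t (clamp r (X t)) - ctrl b j s (clamp r (X t))) +
        (ctrl b j s (clamp r (X t)) - ctrl b j s (Y k)))).
    rewrite /W /v /clamped_field /ia_field -/g.
    have -> : \sum_j g *: ((u j t (w * t) - u j s (w * t)) *:
        ctrl b j t (clamp r (X t)) + u j s (w * t) *:
        ((ctrl b j t (clamp r (X t)) - ctrl b j s (clamp r (X t))) +
        (ctrl b j s (clamp r (X t)) - ctrl b j s (Y k)))) =
      \sum_j (g * u j t (w * t)) *: ctrl b j t (clamp r (X t)) -
      \sum_j (g * u j s (w * t)) *: ctrl b j s (Y k).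
      rewrite -sumrB; apply: eq_bigr => j _.
      move: (ctrl b j t _) (ctrl b j s (Y k)) (ctrl b j s _) => *; vring.
    move: (\sum_j _) (\sum_j _) (b ord0 t _) (b ord0 s (X s)) (b ord0 s _) => *.
    by vring.
  apply: le_trans (ler_normD _ _) _; apply: lerD.
    apply: le_trans (ler_normD _ _) _; apply: lerD.
      by apply: le_trans (fb_time fb _ _ _ cr) _; apply: ler_wpM2l.
    by apply: le_trans (fb_lip fb _ _ Xsr cr) _; apply: ler_wpM2l.
  apply: norm_lincomb => [|j|j]; [nonneg|by rewrite ger0_norm// ltW|].
  apply: le_trans (ler_normD _ _) _; apply: lerD; rewrite normrZ.
    apply: ler_pM => //; last exact: (fb_bound fb).
    by apply: le_trans (u_lip _ _ _ _) _; apply: ler_wpM2l.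
  apply: ler_pM => //; apply: le_trans (ler_normD _ _) _; apply: lerD.
    by apply: le_trans (fb_time fb _ _ _ cr) _; apply: ler_wpM2l.
  by apply: le_trans (fb_lip fb _ _ Ykr cr) _; apply: ler_wpM2l.
have Wb0 : 0 <= Wb.
  by apply: le_trans (W_bound a _); rewrite ?lexx.
have := vint_bound ac Wb0 iW W_bound; rewrite ca => hW.
rewrite qS; apply: le_trans (ler_normD _ _) _.
rewrite mulrDr mulr1 -[leRHS]addrA lerD2l; apply: le_trans hW _.
have gh : g * h = T * e by rewrite /h expr2 mulrCA [g * _]mulrA ge1 mul1r.
(* Motion inside a cell is amplified by [g] twice, through the speed and through the input: this
   term gains no power of [e] and is small only through P. *)
have ggd : g * g * d = T / P%:R.
  rewrite /d mulrA -[g * g * h]mulrA gh mulrCA ge1 mulr1//.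
have Wle : Wb <= drift_const * e + (m%:R * Mu * L * speed * T) / P%:R +
    m%:R * g * Mu * L * `|q k|.
  have -> : Wb = Tm * T * e ^+ 2 + L * speed * (g * h) + m%:R * (Lu * (g * h) * M +
     Mu * Tm * (g * h) + Mu * L * (g * h) * M) +
     m%:R * Mu * L * speed * (g * g * d) + m%:R * g * Mu * L * `|q k|.
    by rewrite /Wb /h; ring.
  rewrite lerD2r gh ggd.
  have -> : m%:R * Mu * L * speed * (T / P%:R) = m%:R * Mu * L * speed * T / P%:R.
    by ring.
  rewrite lerD2r /drift_const.
  have -> : (Tm * T + L * speed * T + m%:R * (Lu * T * M + Mu * Tm * T +
      Mu * L * T * M)) * e = Tm * T * e + L * speed * (T * e) +
      m%:R * (Lu * (T * e) * M + Mu * Tm * (T * e) + Mu * L * (T * e) * M) by ring.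
  rewrite !lerD2r; apply: ler_wpM2l; first nonneg.
  by rewrite expr2 ler_piMl// ltW.
apply: le_trans (ler_wpM2r (ltW d0) Wle) _.
have -> : (drift_const * e + (m%:R * Mu * L * speed * T) / P%:R +
    m%:R * g * Mu * L * `|q k|) * d = B / P%:R +
    m%:R * Mu * L * T * e * (g * e) * `|q k| / P%:R.
  by rewrite /B /d /h; field; rewrite gt_eqF.
rewrite ge1 mulr1 le_eqVlt; apply/orP; left; apply/eqP.
by rewrite /alpha /kappa; ring.
Qed.

(** The first summand is the e^3 part of [X_Y], the second that of [field_loop] with alpha = m Mu T
    e. *)
Definition period_const := 2 * (T * drift_const) +
  (m%:R * Mu * T) ^+ 3 * (4 * L ^+ 2 * M + Lg * M).

(** Three comparisons are added: trajectory with polygon, polygon with brackets weighted by areas,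
    areas with h nu. Whatever involves [E] or has only order e^2 is divided by P. *)
Lemma one_period_error (E : R) : 0 <= E ->
  (forall j x y, `|x| <= r -> `|y| <= r ->
    `|ctrl b j s y - ctrl b j s x - (y - x) *m 'J (ctrl b j s) x| <=
    E * `|y - x| ^+ 2) ->
  `|X (s + h) - X s - h *: lb_field b u T s (X s)| <= period_const * e ^+ 3 +
  (2 * (T * (m%:R * Mu * L * speed * T) * e ^+ 2) +
   (8 * (alpha ^+ 2 * L * M) + 10 * (alpha ^+ 3 * E * M ^+ 2)) +
   m%:R * (m%:R * (e ^+ 2 * (Mu ^+ 2 * T ^+ 2) * (2 * (L * M))))) / P%:R.
Proof.
move=> E0 hE.
have Pd : P%:R * d = h by rewrite /d mulrC divfK// gt_eqF.
have h1 := X_Y (leqnn P); rewrite Pd in h1.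
pose Df j (y v : 'rV[R]_n) : 'rV[R]_n := v *m 'J (ctrl b j s) y.
have kappa0 : 0 <= kappa by rewrite /kappa; nonneg.
have h2 : `|Y P - X s - \sum_(i < m) \sum_(j < m | (i < j)%N)
    area P coef i j *: lie_bracket (ctrl b i) (ctrl b j) s (X s)| <=
  alpha ^+ 3 * (4 * L ^+ 2 * M + Lg * M) +
  (8 * (alpha ^+ 2 * L * M) + 10 * (alpha ^+ 3 * E * M ^+ 2)) / P%:R.
  apply: (@field_loop R m n P (fun j => ctrl b j s) Df coef (X s) r kappa) => //.
  - by apply: le_trans Xs; rewrite lerD2l.
  - by move=> j y d1 d2; rewrite /Df mulmxDl.
  - by move=> j y c v; rewrite /Df scalemxAl.
  - by move=> j y yr; exact: (fb_bound fb).
  - by move=> j y y' yr y'r; exact: (fb_lip fb).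
  - by move=> j y v yr; exact: (fb_jac fb).
  - by move=> i j y y' yr y'r; exact: (fb_lie_lip fb).
have h3 : `|\sum_(i < m) \sum_(j < m | (i < j)%N)
    (area P coef i j - h * nu u T j i s) *:
      lie_bracket (ctrl b i) (ctrl b j) s (X s)| <=
    m%:R * (m%:R * (e ^+ 2 * (Mu ^+ 2 * T ^+ 2) / P%:R * (2 * (L * M)))).
  apply: norm_double_sum => [|i j]; first nonneg.
  have an : `|area P coef i j - h * nu u T j i s| <=
    e ^+ 2 * (Mu ^+ 2 * T ^+ 2) / P%:R by exact: area_nu.
  rewrite normrZ; apply: (ler_pM (normr_ge0 _) (normr_ge0 _) an).
  exact: (lie_bracket_bound fb).
have -> : X (s + h) - X s - h *: lb_field b u T s (X s) =
  (X (s + h) - Y P - h *: b ord0 s (X s)) +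
  (Y P - X s - \sum_(i < m) \sum_(j < m | (i < j)%N)
    area P coef i j *: lie_bracket (ctrl b i) (ctrl b j) s (X s)) +
  \sum_(i < m) \sum_(j < m | (i < j)%N)
    (area P coef i j - h * nu u T j i s) *:
      lie_bracket (ctrl b i) (ctrl b j) s (X s).
  have -> : \sum_(i < m) \sum_(j < m | (i < j)%N)
      (area P coef i j - h * nu u T j i s) *:
        lie_bracket (ctrl b i) (ctrl b j) s (X s) =
    \sum_(i < m) \sum_(j < m | (i < j)%N)
      area P coef i j *: lie_bracket (ctrl b i) (ctrl b j) s (X s) -
    h *: \sum_(i < m) \sum_(j < m | (i < j)%N)
      nu u T j i s *: lie_bracket (ctrl b i) (ctrl b j) s (X s).
    rewrite scaler_sumr -sumrB; apply: eq_bigr => i _.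
    rewrite scaler_sumr -sumrB; apply: eq_bigr => j _.
    by rewrite scalerA -scalerBl.
  have alg (x1 xs y0 b0 A N : 'rV[R]_n) : x1 - xs - h *: (b0 + N) =
    (x1 - y0 - h *: b0) + (y0 - xs - A) + (A - h *: N) by vring.
  exact: alg.
apply: le_trans (ler_normD _ _) _.
apply: le_trans (lerD (ler_normD _ _) (lexx _)) _.
apply: le_trans (lerD (lerD h1 h2) h3) _.
rewrite le_eqVlt; apply/orP; left; apply/eqP.
by rewrite /period_const /alpha /kappa; ring.
Qed.

End one_period.

(** At fixed s the quadratic remainder has a finite constant and the left-hand side does not contain
    P; the limit in P leaves a bound independent of s. *)
Lemma period_step (s : R) (X : R -> 'rV[R]_n) :
  (forall i t th, u i t (th + w * s) = u i t th) ->
  e <= 1 -> m%:R * (Mu * T * e) * M <= 1 -> m%:R * (Mu * T * e) * L <= 1 / 2 ->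
  (forall p q, p <= q -> `|X q - X p| <= speed * g * (q - p)) ->
  (forall p q, s <= p -> p <= q ->
    vintegrable p q (fun t => clamped_field t (X t)) /\
    X q - X p = vint p q (fun t => clamped_field t (X t))) ->
  `|X s| + 1 <= r ->
  `|X (s + h) - X s - h *: lb_field b u T s (X s)| <= period_const * e ^+ 3.
Proof.
move=> sg e1 aM aL Xl Xi Xr.
have ex i : exists2 E : R, 0 <= E & forall x y, `|x| <= r -> `|y| <= r ->
    `|b i s y - b i s x - (y - x) *m 'J (b i s) x| <= E * `|y - x| ^+ 2.
  exact: quadratic_remainder.
pose E := \sum_i projT1 (cid2 (ex i)).
have E0 i : 0 <= projT1 (cid2 (ex i)) by case: (cid2 (ex i)).
have EE0 : 0 <= E by apply: sumr_ge0 => i _; exact: E0.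
have hE (j : 'I_m) (x y : 'rV[R]_n) : `|x| <= r -> `|y| <= r ->
    `|ctrl b j s y - ctrl b j s x - (y - x) *m 'J (ctrl b j s) x| <=
    E * `|y - x| ^+ 2.
  move=> xr yr; apply: (@le_trans _ _ (projT1 (cid2 (ex (lift ord0 j))) *
      `|y - x| ^+ 2)).
    by case: (cid2 (ex (lift ord0 j))) => D _ /= /(_ x y xr yr).
  apply: ler_wpM2r; first by rewrite exprn_ge0.
  by rewrite /E (bigD1 (lift ord0 j))//= lerDl; apply: sumr_ge0 => i _; exact: E0.
(* [E] enters only in the term O(1/P). *)
apply: vanishing_error => P P0.
exact: (one_period_error sg P0 e1 aM aL Xl Xi Xr EE0 hE).
Qed.

End period.

(** * Averaging *)

Section solutions.
Context {R : realType} {n : nat}.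
Implicit Types (f : R -> 'rV[R]_n -> 'rV[R]_n) (x : R -> 'rV[R]_n).

Lemma eq_lebesgue_integrable (g1 g2 : R -> R) (a c : R) :
  (forall s, a <= s <= c -> g1 s = g2 s) ->
  lebesgue_integrable a c g1 -> lebesgue_integrable a c g2.
Proof.
move=> e; apply: eq_integrable; first exact: measurable_itv_lebesgue.
by move=> s; rewrite inE/= in_itv/= => sac; rewrite e.
Qed.

Lemma lipschitz_absolutely_continuous x (a c C : R) : 0 <= C ->
  (forall s t, a <= s -> s <= t -> `|x t - x s| <= C * (t - s)) ->
  absolutely_continuous_on a c x.
Proof.
move=> C0 xC e e0; have K0 : 0 < n%:R * C + 1 by rewrite ltr_wpDl// mulr_ge0.
exists (e / (n%:R * C + 1)); first by rewrite divr_gt0.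
move=> k l r lr _ sum_lt.
apply: (@le_lt_trans _ _ ((n%:R * C + 1) * \sum_i (r i - l i))).
  rewrite mulr_sumr; apply: ler_sum => i _; have [/andP[al lri] _] := lr i.
  apply: le_trans (enorm_le_norm _) _.
  apply: (@le_trans _ _ (n%:R * (C * (r i - l i)))).
    by apply: ler_wpM2l => //; exact: xC.
  by rewrite mulrA; apply: ler_wpM2r; [rewrite subr_ge0|rewrite lerDl].
by rewrite mulrC -ltr_pdivlMr.
Qed.

Lemma is_solution_increment f (t0 : R) (x0 : 'rV[R]_n) (J : interval R) x
    (s t : R) :
  is_solution f t0 x0 J x -> s \in J -> t \in J -> t0 <= s -> s <= t ->
  vintegrable s t (fun q => f q (x q)) /\
  x t - x s = vint s t (fun q => f q (x q)).
Proof.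
move=> [x0E xJ] sJ tJ t0s st; have [_ hs] := xJ s sJ; have [_ ht] := xJ t tJ.
split=> [i|]; first by apply: integrable_lebesgueS (ht i).1.
apply/rowP => i; rewrite !mxE (hs i).2 (ht i).2.
rewrite (lebint_cat t0s st); last exact: (ht i).1.
by rewrite opprD addrACA subrr add0r addrC addKr.
Qed.

Lemma is_solutionS f t0 (x0 : 'rV[R]_n) (J J' : interval R) x :
  (forall t, t \in J' -> t \in J) ->
  is_solution f t0 x0 J x -> is_solution f t0 x0 J' x.
Proof. by move=> JJ [x0E xJ]; split=> // t /JJ; exact: xJ. Qed.

Lemma lipschitz_solution f t0 (x0 : 'rV[R]_n) (t1 C : R) x : 0 <= C -> x t0 = x0 ->
  (forall s t, t0 <= s -> s <= t -> `|x t - x s| <= C * (t - s)) ->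
  (forall t, t0 <= t -> t <= t1 -> vintegrable t0 t (fun s => f s (x s)) /\
    x t - x t0 = vint t0 t (fun s => f s (x s))) ->
  is_solution f t0 x0 `[t0, t1] x.
Proof.
move=> C0 x0E xC xf; split=> // t; rewrite in_itv/= => /andP[t0t tt1].
split; first exact: (lipschitz_absolutely_continuous _ C0).
move=> i; have [fi e] := xf t t0t tt1; split; first exact: fi.
have {}e := congr1 (fun v : 'rV[R]_n => v 0 i) e.
have {}e : x t 0 i - x0 0 i = lebint t0 t (fun s => f s (x s) 0 i).
  by move: e; rewrite !mxE x0E.
by rewrite -e addrC subrK.
Qed.

End solutions.

Lemma int_periodic {R : realType} (f : R -> R) (T : R) :
  (forall th, f (th + T) = f th) -> forall (k : int) th, f (th + k%:~R * T) = f th.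
Proof.
move=> fT; have nat_per (k : nat) th : f (th + k%:R * T) = f th.
  elim: k => [|k IH]; first by rewrite mul0r addr0.
  by rewrite -natr1 mulrDl mul1r addrA fT.
move=> [k|k] th; first exact: nat_per.
rewrite NegzE -[LHS](nat_per k.+1) -addrA -mulrDl.
have -> : (- k.+1%:Z)%:~R + k.+1%:R = 0 :> R by rewrite mulrNz addNr.
by rewrite mul0r addr0.
Qed.

(** * Comparison of the two trajectories *)

Section averaging.
Context {R : realType} {n m : nat}.
Variables (b : 'I_m.+1 -> R -> 'rV[R]_n -> 'rV[R]_n) (u : 'I_m -> R -> R -> R).
Variables (T Mu Lu : R).
Hypotheses (T0 : 0 < T) (Mu0 : 0 <= Mu) (Lu0 : 0 <= Lu).
Hypothesis u_meas : forall i t, lmeas (u i t).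
Hypothesis u_bound : forall i t th, `|u i t th| <= Mu.
Hypothesis u_lip : forall i t1 t2 th,
  `|u i t1 th - u i t2 th| <= Lu * `|t1 - t2|.
Hypothesis u_mean : forall i t, lebint 0 T (u i t) = 0.
Hypothesis u_per : forall i t th, u i t (th + T) = u i t th.
Variables (A M L Tm Lg Tg : R).
Hypothesis A0 : 0 <= A.
(** A for the bounded solution, 1 for the gap between the trajectories and 1 for the excursion of
    the polygon within a period. *)
Let r := A + 2.
Hypothesis fb : field_bounds b r M L Tm Lg Tg.
Hypothesis b_C2 : C2_fields b.
Variable tf : R.
Hypothesis tf0 : 0 < tf.
Let M0 : 0 <= M := fb_M0 fb.
Let L0 : 0 <= L := fb_L0 fb.
Let Lg0 : 0 <= Lg := fb_Lg0 fb.
Let Tm0 : 0 <= Tm := fb_Tm0 fb.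
Let Tg0 : 0 <= Tg := fb_Tg0 fb.
Let r0 : 0 <= r. Proof. by rewrite /r addr_ge0. Qed.

Let V := @speed R m Mu M.
Let Mz := @lb_bound_const R m T Mu M L.
Let Lz := @lb_lip_const R m T Mu L Lg.
Let Tz := @lb_time_const R m T Mu Lu M L Tm Tg.
Let V0 : 0 <= V. Proof. by rewrite /V /speed; nonneg. Qed.
Let Mz0 : 0 <= Mz. Proof. by rewrite /Mz /lb_bound_const; nonneg. Qed.
Let Lz0 : 0 <= Lz. Proof. by rewrite /Lz /lb_lip_const; nonneg. Qed.
Let Tz0 : 0 <= Tz. Proof. by rewrite /Tz /lb_time_const; nonneg. Qed.

(** [K] bounds one period's error in units of e^3: the averaging error plus the Euler defect of z,
    of order h^2 = T^2 e^4. [C0] is the joint displacement of both curves in a period, in units of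
    [e]. [Xi] accumulates K e^3 over tf / h periods with the Gronwall exponential. *)
Let K := @period_const R m T Mu Lu M L Tm Lg + (Tz + Lz * Mz) * T ^+ 2.
Let C0 := (V + Mz) * T.
Let Xi := (C0 + K * (tf / T)) * expR (Lz * tf).

Let K0 : 0 <= K.
Proof. by rewrite /K /period_const /drift_const -/V; nonneg. Qed.
Let C00 : 0 <= C0. Proof. by rewrite /C0; nonneg. Qed.
Let Xi0 : 0 <= Xi.
Proof. by rewrite /Xi mulr_ge0 ?expR_ge0//; nonneg. Qed.

Definition gap_const := Xi + C0.

Lemma gap_const_ge0 : 0 <= gap_const. Proof. by rewrite addr_ge0. Qed.

Variable w : R.
Hypothesis w0 : 0 < w.
Let g := Num.sqrt w.
Let e := g^-1.
Let h := T * e ^+ 2.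
Let g0 : 0 < g. Proof. by rewrite sqrtr_gt0. Qed.
Let e0 : 0 < e. Proof. by rewrite invr_gt0. Qed.
Let h0 : 0 < h. Proof. by rewrite mulr_gt0// exprn_gt0. Qed.
Let ge1 : g * e = 1. Proof. by rewrite divff// gt_eqF. Qed.
Let wh : w * h = T.
Proof. by rewrite /h mulrCA -[w]sqr_sqrtr ?ltW// -exprMn -/g ge1 expr1n mulr1. Qed.
Let gh : g * h = T * e.
Proof. by rewrite /h expr2 mulrCA [g * _]mulrA ge1 mul1r. Qed.

Hypotheses (e1 : e <= 1) (eM : m%:R * (Mu * T * e) * M <= 1).
Hypotheses (eL : m%:R * (Mu * T * e) * L <= 1 / 2) (eXi : gap_const * e <= 1).

(** As w h = T, the fast phase is a multiple of T at the multiples of h; t0 is arbitrary, so the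
    grid starts at the first multiple after it. *)
Lemma grid_exists t0 : exists s0, [/\ t0 <= s0, s0 <= t0 + h &
  forall (k : nat) i t th, u i t (th + w * (s0 + k%:R * h)) = u i t th].
Proof.
pose k := Num.floor (t0 / h) + 1.
have := floor_itv (t0 / h); rewrite -/k.
rewrite ler_pdivlMr// ltr_pdivrMr// => /andP[h1 h2].
exists (k%:~R * h); split; first exact: ltW.
  by rewrite /k intrD mulrDl mul1r lerD2r.
move=> j i t th; rewrite mulrDr mulrCA [w * (j%:R * h)]mulrCA wh addrA.
by rewrite (int_periodic (u_per i t) j) (int_periodic (u_per i t) k).
Qed.

Variables (t0 : R) (x0 : 'rV[R]_n) (z X : R -> 'rV[R]_n).
Hypothesis z_start : z t0 = x0.
Hypothesis z_bound : forall t, t0 <= t -> `|z t| <= A.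
Hypothesis z_int : forall s t, t0 <= s -> s <= t ->
  vintegrable s t (fun q => lb_field b u T q (z q)) /\
  z t - z s = vint s t (fun q => lb_field b u T q (z q)).
Hypothesis X_start : X t0 = x0.
Hypothesis X_lip : forall s t, s <= t -> `|X t - X s| <= V * g * (t - s).
Hypothesis X_int : forall s t, t0 <= s -> s <= t ->
  vintegrable s t (fun q => clamped_field b u r w q (X q)) /\
  X t - X s = vint s t (fun q => clamped_field b u r w q (X q)).

Let zr t : t0 <= t -> `|z t| <= r.
Proof. by move=> t0t; apply: le_trans (z_bound t0t) _; rewrite /r lerDl. Qed.

Lemma average_lip s t : t0 <= s -> s <= t -> `|z t - z s| <= Mz * (t - s).
Proof.
move=> t0s st; have [zi ->] := z_int t0s st.
apply: vint_bound => // q /andP[sq _].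
by apply: (lb_bound T0 Mu0 u_meas u_bound fb); apply: zr; exact: le_trans sq.
Qed.

(** Along z the averaged field varies by at most (Tz + Lz Mz) h over a period, so an Euler step has
    a defect of order h^2. *)
Let z_step s : t0 <= s ->
  `|z (s + h) - z s - h *: lb_field b u T s (z s)| <= (Tz + Lz * Mz) * h * h.
Proof.
move=> t0s; have sh : s <= s + h by rewrite lerDl ltW.
have [zi ->] := z_int t0s sh.
have ci : vintegrable s (s + h) (fun=> lb_field b u T s (z s)).
  by move=> i; exact: lebesgue_integrable_cst.
have -> : h *: lb_field b u T s (z s) =
    vint s (s + h) (fun=> lb_field b u T s (z s)).
  by rewrite vint_cst// addrC addKr.
rewrite -vintB//.
rewrite [X in _ <= _ * X](_ : h = s + h - s); last by rewrite addrC addKr.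
apply: vint_bound => //; [nonneg|
  exact: vintegrableB|].
move=> q /andP[sq qh]; have t0q := le_trans t0s sq.
have qs : `|q - s| <= h by rewrite ger0_norm ?subr_ge0//; lra.
have -> : lb_field b u T q (z q) - lb_field b u T s (z s) =
  (lb_field b u T q (z q) - lb_field b u T s (z q)) +
  (lb_field b u T s (z q) - lb_field b u T s (z s)) by rewrite addrA subrK.
rewrite mulrDl; apply: le_trans (ler_normD _ _) _; apply: lerD.
  apply: le_trans (lb_time T0 Mu0 Lu0 u_meas u_bound u_lip fb _ _ (zr t0q)) _.
  exact: ler_wpM2l.
apply: le_trans (lb_lip T0 Mu0 u_meas u_bound fb _ (zr t0s) (zr t0q)) _.
rewrite -mulrA; apply: ler_wpM2l => //.
apply: le_trans (average_lip t0s sq) _; apply: ler_wpM2l => //.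
by move: qs; rewrite ger0_norm ?subr_ge0.
Qed.

Let period_drift : V * (g * h) + Mz * h <= C0 * e.
Proof.
rewrite gh (_ : C0 * e = V * (T * e) + Mz * (T * e)); last by rewrite /C0; ring.
rewrite lerD2l; apply: ler_wpM2l => //.
by rewrite /h ler_pM2l// expr2 ler_piMl// ltW.
Qed.

(** No dynamics are compared: both curves leave x0 and together move at most C0 e in a period. *)
Let start_close t : t0 <= t -> t <= t0 + h -> `|X t - z t| <= C0 * e.
Proof.
move=> t0t th; have tt : t - t0 <= h by lra.
have -> : X t - z t = (X t - X t0) - (z t - z t0).
  by rewrite X_start z_start opprB addrA subrK.
apply: le_trans (ler_normB _ _) _.
apply: (@le_trans _ _ (V * (g * h) + Mz * h)).
  apply: lerD.
    apply: le_trans (X_lip t0t) _; rewrite -mulrA; apply: ler_wpM2l => //.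
    by rewrite ler_pM2l.
  by apply: le_trans (average_lip (lexx _) t0t) _; apply: ler_wpM2l.
exact: period_drift.
Qed.

Let drift_close s t : t0 <= s -> s <= t -> t <= s + h ->
  `|X t - z t| <= `|X s - z s| + C0 * e.
Proof.
move=> t0s st ts.
have tt : t - s <= h by lra.
have -> : X t - z t = (X s - z s) + ((X t - X s) - (z t - z s)).
  by move: (X t) (X s) (z t) (z s) => *; vring.
apply: le_trans (ler_normD _ _) _; rewrite lerD2l.
apply: le_trans (ler_normB _ _) _.
apply: (@le_trans _ _ (V * (g * h) + Mz * h)).
  apply: lerD.
    apply: le_trans (X_lip st) _; rewrite -mulrA; apply: ler_wpM2l => //.
    by rewrite ler_pM2l.
  by apply: le_trans (average_lip t0s st) _; apply: ler_wpM2l.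
exact: period_drift.
Qed.

(** At most tf / h = tf / (T e^2) periods fit, so the errors K e^3 add up to order [e]; the growth
    factor is controlled by 1 + x <= exp x. *)
Let bound_Xi (x : R) (k : nat) : k%:R * h <= tf ->
  x <= (C0 * e + k%:R * (K * e ^+ 3)) * (1 + Lz * h) ^+ k -> x <= Xi * e.
Proof.
move=> kh hs; apply: le_trans hs _.
have q1 : 1 <= 1 + Lz * h by rewrite lerDl; nonneg.
have qk : (1 + Lz * h) ^+ k <= expR (Lz * tf).
  apply: (@le_trans _ _ (expR (Lz * h) ^+ k)).
    apply: lerXn2r; rewrite ?nnegrE ?expR_ge0 ?expR_ge1Dx//.
    exact: le_trans ler01 q1.
  rewrite -expRM_natl ler_expR mulrCA; exact: ler_wpM2l.
have kK : k%:R * (K * e ^+ 3) <= K * (tf / T) * e.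
  have -> : k%:R * (K * e ^+ 3) = K * (k%:R * h / T) * e.
    by rewrite /h; field; rewrite gt_eqF.
  apply: ler_wpM2r; first exact: ltW.
  by apply: ler_wpM2l => //; rewrite ler_pM2r ?invr_gt0.
have -> : Xi * e = (C0 * e + K * (tf / T) * e) * expR (Lz * tf) by rewrite /Xi; ring.
apply: ler_pM; [nonneg| |by rewrite lerD2l|exact: qk].
by rewrite exprn_ge0// (le_trans ler01).
Qed.

(** The induction is also a bootstrap: the estimate at one grid point puts X within distance 1 of z,
    hence inside the box with the margin that [period_step] requires for the next period. *)
Let grid_close s0 (k : nat) : t0 <= s0 -> s0 <= t0 + h ->
  (forall (k : nat) i t th, u i t (th + w * (s0 + k%:R * h)) = u i t th) ->
  k%:R * h <= tf ->
  `|X (s0 + k%:R * h) - z (s0 + k%:R * h)| <=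
  (C0 * e + k%:R * (K * e ^+ 3)) * (1 + Lz * h) ^+ k.
Proof.
move=> t0s0 s0h grid.
have q1 : 1 <= 1 + Lz * h by rewrite lerDl; nonneg.
elim: k => [_|k IH kh].
  by rewrite !mul0r !addr0 expr0 mulr1; exact: start_close.
have kh' : k%:R * h <= tf.
  by apply: le_trans kh; rewrite ler_pM2r// ler_nat.
set s := s0 + k%:R * h in IH *.
have -> : s0 + k.+1%:R * h = s + h by rewrite /s -natr1; ring.
have {IH} hs := IH kh'.
have t0s : t0 <= s by apply: le_trans t0s0 _; rewrite lerDl; nonneg.
have hXi := bound_Xi kh' hs.
have Xs1 : `|X s| + 1 <= r.
  have -> : X s = z s + (X s - z s) by rewrite addrC subrK.
  have := z_bound t0s; have := ler_normD (z s) (X s - z s).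
  have : Xi * e <= 1.
    apply: le_trans eXi; rewrite /gap_const; apply: ler_wpM2r; first exact: ltW.
    by rewrite lerDl.
  by rewrite /r; lra.
have Xsr : `|X s| <= r by apply: le_trans Xs1; rewrite lerDl.
have stepX := period_step T0 Mu0 Lu0 u_meas u_bound u_lip u_mean r0 fb b_C2 w0
  (grid k) e1 eM eL X_lip (fun p q sp pq => X_int (le_trans t0s sp) pq) Xs1.
have stepz := z_step t0s.
have steplb := lb_lip T0 Mu0 u_meas u_bound fb s (zr t0s) Xsr.
rewrite -/g -/e -/h -/s in stepX.
have -> : X (s + h) - z (s + h) = (X s - z s) +
  h *: (lb_field b u T s (X s) - lb_field b u T s (z s)) +
  (X (s + h) - X s - h *: lb_field b u T s (X s)) -
  (z (s + h) - z s - h *: lb_field b u T s (z s)).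
  have alg (x1 x2 z1 z2 f1 f2 : 'rV[R]_n) : x1 - z1 = (x2 - z2) + h *: (f1 - f2) +
    (x1 - x2 - h *: f1) - (z1 - z2 - h *: f2) by vring.
  exact: alg.
apply: le_trans (ler_normB _ _) _.
apply: le_trans (lerD (ler_normD _ _) stepz) _.
apply: le_trans (lerD (lerD (ler_normD _ _) stepX) (lexx _)) _.
rewrite normrZ (ger0_norm (ltW h0)).
have h1 : `|X s - z s| + h * `|lb_field b u T s (X s) - lb_field b u T s (z s)| <=
    (C0 * e + k%:R * (K * e ^+ 3)) * (1 + Lz * h) ^+ k.+1.
  apply: (@le_trans _ _ (`|X s - z s| * (1 + Lz * h))).
    rewrite mulrDr mulr1 lerD2l.
    have -> : `|X s - z s| * (Lz * h) = h * (Lz * `|X s - z s|) by ring.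
    by rewrite ler_pM2l.
  rewrite [leRHS](_ : _ = (C0 * e + k%:R * (K * e ^+ 3)) * (1 + Lz * h) ^+ k *
    (1 + Lz * h)); last by rewrite (exprSr (1 + Lz * h)) mulrA.
  by apply: ler_wpM2r => //; exact: le_trans ler01 q1.
have h2 : @period_const R m T Mu Lu M L Tm Lg * e ^+ 3 + (Tz + Lz * Mz) * h * h <=
    K * e ^+ 3.
  rewrite [leRHS](mulrDl (@period_const R m T Mu Lu M L Tm Lg)) lerD2l.
  have -> : (Tz + Lz * Mz) * h * h = (Tz + Lz * Mz) * T ^+ 2 * (e ^+ 3 * e).
    by rewrite /h; ring.
  apply: ler_wpM2l; first nonneg.
  by rewrite ler_piMr// exprn_ge0// ltW.
have h3 : K * e ^+ 3 <= K * e ^+ 3 * (1 + Lz * h) ^+ k.+1.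
  by rewrite ler_peMr ?exprn_ege1//; nonneg.
rewrite -[leLHS]addrA; apply: le_trans (lerD h1 (le_trans h2 h3)) _.
by rewrite -[leLHS]mulrDl -natr1 [(_ + 1) * _]mulrDl mul1r addrA.
Qed.

(** A time before the grid is covered by the start estimate; any other lies within one period after
    a grid point, and [drift_close] adds the second C0 e. *)
Lemma trajectories_close t : t0 <= t -> t <= t0 + tf ->
  `|X t - z t| <= gap_const * e.
Proof.
move=> t0t ttf; have [s0 [t0s0 s0h grid]] := grid_exists t0.
have [ts0|/ltW s0t] := leP t s0.
  apply: le_trans (start_close t0t (le_trans ts0 s0h)) _.
  apply: ler_wpM2r; first exact: ltW.
  by rewrite /gap_const lerDr.
pose k := Num.truncn ((t - s0) / h).
have /truncn_itv : 0 <= (t - s0) / h by rewrite divr_ge0 ?subr_ge0// ltW.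
rewrite -/k ler_pdivlMr// ltr_pdivrMr// => /andP[k1 k2].
have kh : k%:R * h <= tf by apply: le_trans k1 _; lra.
have t0s : t0 <= s0 + k%:R * h by apply: le_trans t0s0 _; rewrite lerDl; nonneg.
have st : s0 + k%:R * h <= t by lra.
have ts : t <= s0 + k%:R * h + h by move: k2; rewrite -natr1; lra.
apply: le_trans (drift_close t0s st ts) _.
rewrite /gap_const mulrDl lerD2r; exact: (bound_Xi kh (grid_close t0s0 s0h grid kh)).
Qed.

End averaging.

Lemma inputs_bound {R : realType} {m : nat} (u : 'I_m -> R -> R -> R) :
  regular_inputs u -> exists2 C : R, 0 <= C &
    (forall i t th, `|u i t th| <= C) /\
    (forall i t1 t2 th, `|u i t1 th - u i t2 th| <= C * `|t1 - t2|).
Proof.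
move=> ur.
have /choice[C hC] i : exists C : R, [/\ 0 <= C,
    forall t th, `|u i t th| <= C &
    forall t1 t2 th, `|u i t1 th - u i t2 th| <= C * `|t1 - t2|].
  have [_ [L [M [L0 M0 uL uM]]]] := ur i.
  exists (L + M); split=> [|t th|t1 t2 th]; first by rewrite ltW// addr_gt0.
    by apply: le_trans (uM t th) _; rewrite lerDr ltW.
  by apply: le_trans (uL t1 t2 th) _; rewrite ler_wpM2r// lerDl ltW.
have le_sum i : C i <= \sum_j C j.
  by rewrite (bigD1 i)//= lerDl sumr_ge0// => j _; case: (hC j).
exists (\sum_j C j); first by rewrite sumr_ge0// => j _; case: (hC j).
split=> [i t th|i t1 t2 th]; have [_ uM uL] := hC i.
  exact: le_trans (uM t th) (le_sum i).
by apply: le_trans (uL t1 t2 th) _; rewrite ler_wpM2r.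
Qed.

Theorem theorem1 (R : realType) (n m : nat)
    (b : 'I_m.+1 -> R -> 'rV[R]_n -> 'rV[R]_n) (u : 'I_m -> R -> R -> R) (T : R)
    (hA1 : C2_fields b) (hA2 : bounded_fields b)
    (hA3 : regular_inputs u) (hA4 : periodic_zero_mean u T)
    (B : set 'rV[R]_n)
    (hB : uniformly_bounded_solutions (lb_field b u T) B)
    (K : set 'rV[R]_n) (hKB : K `<=` B) (hK : bounded_set K)
    (D : R) (hD : 0 < D) (tf : R) (htf : 0 < tf) :
  exists2 w0 : R, 0 < w0 &
    forall w : R, w0 < w -> forall (t0 : R) (x0 : 'rV[R]_n), K x0 ->
      exists x z : R -> 'rV[R]_n,
        [/\ is_solution (ia_field b u w) t0 x0 `[t0, t0 + tf] x,
            is_solution (lb_field b u T) t0 x0 `[t0, t0 + tf] z &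
            forall t, t \in `[t0, t0 + tf] -> enorm (x t - z t) < D].
Proof.
have [T0 uT] := hA4; have [A A0 Bz] := hB.
have u_per i t th : u i t (th + T) = u i t th by have [+ _] := uT i t; apply.
have u_mean i t : lebint 0 T (u i t) = 0 by have [_ ->] := uT i t.
have [C C0 [u_bound u_lip]] := inputs_bound hA3.
have u_meas i t : lmeas (u i t) by exact: (lmeas_section (hA3 i).1 (u_lip i)).
have [M [L [Tm [Lg [Tg fb]]]]] := field_bounds_exist hA1 hA2 (A + 2).
have M0 := fb_M0 fb; have L0 := fb_L0 fb.
pose gap := @gap_const R m T C C M L Tm Lg Tg tf.
have gap0 : 0 <= gap by exact: (gap_const_ge0 T0 C0 C0 fb htf).
have r0 : 0 <= A + 2 by rewrite addr_ge0// ltW.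
(* One constant per smallness condition, each to be multiplied by [e]: the 2 in [cL] answers the
   bound 1/2 in [eL], the n in [cD] the passage to the Euclidean norm. Their sum [c] makes w > c^2
   sufficient for all of them. *)
pose cM := m%:R * (C * T) * M; pose cL := 2 * (m%:R * (C * T) * L).
pose cD := n%:R * gap / D.
have cM0 : 0 <= cM by rewrite /cM; nonneg.
have cL0 : 0 <= cL by rewrite /cL; nonneg.
have cD0 : 0 <= cD by rewrite /cD divr_ge0 ?mulr_ge0// ltW.
pose c := 1 + cM + cL + gap + cD.
have c0 : 0 < c by rewrite /c; lra.
exists (c ^+ 2); first by rewrite exprn_gt0.
move=> w cw t0 x0 Kx0.
have w0 : 0 < w by apply: lt_trans cw; rewrite exprn_gt0.
set e := (Num.sqrt w)^-1.
have g0 : 0 < Num.sqrt w by rewrite sqrtr_gt0.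
have e0 : 0 < e by rewrite invr_gt0.
have cg : c < Num.sqrt w.
  by rewrite -[c]ger0_norm ?ltW// -sqrtr_sqr ltr_sqrt.
have small x : 0 <= x -> x <= c -> x * e < 1.
  by move=> x_ge0 xc; rewrite ltr_pdivrMr// mul1r (le_lt_trans xc).
have e1 : e <= 1 by rewrite -[e]mul1r ltW// small// /c; lra.
have eM : m%:R * (C * T * e) * M <= 1.
  have -> : m%:R * (C * T * e) * M = cM * e by rewrite /cM; ring.
  by rewrite ltW// small// /c; lra.
have eL : m%:R * (C * T * e) * L <= 1 / 2.
  have : cL * e < 1 by rewrite small// /c; lra.
  have -> : cL * e = 2 * (m%:R * (C * T * e) * L) by rewrite /cL; ring.
  lra.
have egap : gap * e <= 1 by rewrite ltW// small// /c; lra.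
have eD : n%:R * (gap * e) < D.
  have : cD * e < 1 by rewrite small// /c; lra.
  have -> : cD * e = n%:R * (gap * e) / D by rewrite /cD; ring.
  by rewrite ltr_pdivrMr// mul1r.
have u_diag i : lmeas (fun s => u i s (w * s)).
  exact: (lmeas_diagonal w0 (hA3 i).1 (u_lip i)).
have [z z_sol zA] := Bz t0 x0 (hKB _ Kx0).
have z_bound t : t0 <= t -> `|z t| <= A.
  by move=> t0t; rewrite (le_trans (norm_le_enorm _))// ltW// zA.
have z_int s t : t0 <= s -> s <= t ->
    vintegrable s t (fun q => lb_field b u T q (z q)) /\
    z t - z s = vint s t (fun q => lb_field b u T q (z q)).
  move=> t0s st; apply: (is_solution_increment z_sol) => //.
    by rewrite in_itv/= t0s.
  by rewrite in_itv/= (le_trans t0s).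
have FL0 : 0 <= L + m%:R * (Num.sqrt w * C) * L by nonneg.
have [X [X_start X_lip X_int]] := picard_exists
  (fun X => clamped_field_meas r0 hA1 u_diag (X := X))
  (fun s x => clamped_field_bound C0 u_bound r0 fb w0 s x e1)
  (clamped_field_lip C0 u_bound r0 fb w0) FL0 t0 x0.
have close t : t0 <= t -> t <= t0 + tf -> `|X t - z t| <= gap * e.
  exact: (trajectories_close T0 C0 C0 u_meas u_bound u_lip u_mean u_per (ltW A0) fb
    hA1 htf w0 e1 eM eL egap z_sol.1 z_bound z_int X_start X_lip X_int).
(* A gap of at most 1 from a curve bounded by A keeps X in the box, so along X the clamped field is
   the original one. *)
have XA t : t0 <= t <= t0 + tf -> clamp (A + 2) (X t) = X t.
  move=> /andP[t0t ttf]; apply: clamp_id.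
  have := close t t0t ttf; have := z_bound t t0t.
  have := ler_normD (z t) (X t - z t); rewrite [z t + _]addrC subrK; lra.
exists X, z; split; last 1 first.
- move=> t; rewrite in_itv/= => /andP[t0t ttf].
  apply: le_lt_trans (enorm_le_norm _) _; apply: le_lt_trans eD.
  by rewrite ler_wpM2l// close.
- apply: (@lipschitz_solution _ _ _ _ _ _ (@speed R m C M * Num.sqrt w)) => //.
  + by rewrite /speed; nonneg.
  + by move=> s t _; exact: X_lip.
  move=> t t0t ttf; have [Xi ->] := X_int t0 t (lexx _) t0t.
  have E s : t0 <= s <= t ->
      clamped_field b u (A + 2) w s (X s) = ia_field b u w s (X s).
    by move=> /andP[t0s st]; rewrite /clamped_field XA// t0s (le_trans st).
  split=> [i|]; first by apply: eq_lebesgue_integrable (Xi i) => s /E ->.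
  by apply/rowP => i; rewrite !mxE; apply: eq_lebint => s /E ->.
- apply: is_solutionS z_sol => t; rewrite !in_itv/= => /andP[-> _]//.
Qed.
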